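(* Let $n\geq 3$. Suppose that for some $h_{n-1}>0$ and $p_{n-1}>1$ the following holds: for every $\varepsilon>0$ there is a constant $C_{\varepsilon}$ such that $$\|(f)^*_{\delta}\|_{L^{p_{n-1}}(S^{n-2})} \leq C_\varepsilon\, \delta^{-h_{n-1}-\varepsilon}\,\|f\|_{L^{p_{n-1}}(\mathbb{R}^{n-1})}$$ for all $f \in L^1_{loc}(\mathbb{R}^{n-1})$ and all $0<\delta<1$. Let $s\in[0,n]$ and let $A \subseteq \mathbb{R}^n$ be a nonempty bounded set with $\overline{\dim}_{\mathrm{B}} A \leq s$. Then for every $\varepsilon>0$ there is a constant $C'_\varepsilon$ (independent of $E$ and $\delta$) such that $$\|\mathcal{K}_{\delta,A}(\chi_E)\|_{L^{p,\infty}(S^{n-1})} \leq C'_\varepsilon\, \delta^{-\beta-\varepsilon}\,\|\chi_E\|_{L^p(\mathbb{R}^n)}$$ for all Lebesgue measurable sets $E\subseteq\mathbb{R}^n$ and all $0<\delta<1$, where $$p=\frac{p_{n-1}+n(p_{n-1}-1)+1}{p_{n-1}}, \qquad \beta=\frac{h_{n-1}p_{n-1}+s p_{n-1}-s}{p_{n-1}+n(p_{n-1}-1)+1}.$$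
   Context: In $\mathbb{R}^d$, for $e \in S^{d-1}$ and $a\in\mathbb{R}^d$, let $I_e(a) = \{a + t e : -1/2 \leq t \leq 1/2\}$, and for $\delta>0$ let the $\delta$-tube $T_e^\delta(a)$ be the $\delta$-neighbourhood of $I_e(a)$ in $\mathbb{R}^d$. For $f\in L^1_{loc}(\mathbb{R}^d)$, the Kakeya maximal function $(f)^*_\delta : S^{d-1}\to\mathbb{R}$ is $$(f)^*_\delta(e)=\sup_{a\in\mathbb{R}^d}\frac{1}{|T_e^\delta(a)|}\int_{T_e^\delta(a)}|f(x)|\,dx,$$ and for $A\subseteq\mathbb{R}^d$ the $A$-restricted Kakeya maximal function is $$\mathcal{K}_{\delta,A}(f)(e) = \sup_{a\in A} \frac{1}{|T_e^\delta(a)|}\int_{T_e^\delta(a)} |f(x)|\,dx .$$ (The hypothesis uses $d=n-1$, the conclusion uses $d=n$.) $\chi_E$ is the characteristic function of $E$, spheres carry surface measure ($|\cdot|_{n-1}$ on $S^{n-1}$), and $\|F\|_{L^{p,\infty}(S^{n-1})} = \sup_{\lambda>0} \lambda\, |\{e \in S^{n-1}: |F(e)|>\lambda\}|_{n-1}^{1/p}$. $\overline{\dim}_{\mathrm{B}} A = \limsup_{\delta\to 0} \frac{\log N_\delta(A)}{-\log\delta}$ is the upper box-counting dimension, where $N_\delta(A)$ is the smallest number of sets of diameter at most $\delta$ needed to cover $A$. *)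

(* Defs.v *)
From HB Require Import structures.
From mathcomp Require Import all_boot all_order all_algebra.
From mathcomp Require Import all_classical all_reals all_analysis.

Set Implicit Arguments.
Unset Strict Implicit.
Unset Printing Implicit Defensive.

Import Order.TTheory GRing.Theory Num.Theory.
Import numFieldNormedType.Exports.

Local Open Scope classical_set_scope.
Local Open Scope ring_scope.

(* The norm `|x| of 'rV[R]_d in the library is the sup norm, so the Euclidean
   norm is defined separately. *)
Definition enorm (R : realType) (d : nat) (x : 'rV[R]_d) : R :=
  Num.sqrt (\sum_i x 0 i ^+ 2).

Definition unit_sphere (R : realType) (d : nat) : set 'rV[R]_d :=
  [set e | enorm e = 1].

Definition box (R : realType) (d : nat) (u v : 'rV[R]_d) : set 'rV[R]_d :=
  [set x | forall i, u 0 i <= x 0 i <= v 0 i].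

Definition box_vol (R : realType) (d : nat) (u v : 'rV[R]_d) : R :=
  \prod_i (v 0 i - u 0 i).

(* Covers are indexed by an arbitrary set D of naturals, so that finite and
   empty covers are allowed; the latter matters only when d = 0. *)
Definition box_cover (R : realType) (d : nat) (X : set 'rV[R]_d)
    (D : set nat) (u v : nat -> 'rV[R]_d) : Prop :=
  (forall k i, u k 0 i <= v k 0 i) /\ X `<=` \bigcup_(k in D) box (u k) (v k).

Definition lebesgue_outer (R : realType) (d : nat) (X : set 'rV[R]_d) : \bar R :=
  ereal_inf [set r | exists D u v, box_cover X D u v /\
                     r = (\esum_(k in D) (box_vol (u k) (v k))%:E)%E].

Section lebesgue_outer_measure.
Context (R : realType) (d : nat).
Local Open Scope ereal_scope.

Let vol_ge0 (u v : nat -> 'rV[R]_d) : (forall k i, (u k 0 i <= v k 0 i)%R) ->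
  forall k, 0 <= (box_vol (u k) (v k))%:E.
Proof.
by move=> uv k; rewrite lee_fin; apply: prodr_ge0 => i _; rewrite subr_ge0.
Qed.

Let lebesgue_outer_ge0 (X : set 'rV[R]_d) : 0 <= lebesgue_outer X.
Proof.
apply: le_ereal_inf_tmp => _ [D [u [v [[uv _] ->]]]].
by apply: esum_ge0 => k _; exact: vol_ge0.
Qed.

Let lebesgue_outer0 : lebesgue_outer (@set0 'rV[R]_d) = 0.
Proof.
apply/eqP; rewrite eq_le lebesgue_outer_ge0 andbT.
apply: ereal_inf_lbound; exists set0, (fun=> 0%R), (fun=> 0%R).
by rewrite esum_set0; split => //; split.
Qed.

Let le_lebesgue_outer :
  {homo @lebesgue_outer R d : X Y / X `<=` Y >-> X <= Y}.
Proof.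
move=> X Y XY; apply: ereal_inf_le_tmp => _ [D [u [v [[uv YD] ->]]]].
by exists D, u, v; split => //; split => //; exact: subset_trans YD.
Qed.

Let lebesgue_outer_sigma_subadditive : sigma_subadditive (@lebesgue_outer R d).
Proof.
move=> X; have [[i ioo]|] := pselect (exists i, lebesgue_outer (X i) = +oo).
  rewrite (eseries_pinfty _ _ ioo) ?leey// => n _.
  by rewrite -ltNye (lt_le_trans _ (lebesgue_outer_ge0 _)).
rewrite -forallNE => Xoo.
apply/lee_addgt0Pr => e e0.
rewrite (le_trans _ (epsilon_trick _ _ (ltW e0)))//.
pose P n (c : set nat * ((nat -> 'rV[R]_d) * (nat -> 'rV[R]_d))) :=
  box_cover (X n) c.1 c.2.1 c.2.2 /\
  \esum_(k in c.1) (box_vol (c.2.1 k) (c.2.2 k))%:E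
    <= lebesgue_outer (X n) + (e / (2 ^ n.+1)%:R)%:E.
have [G PG] : {G & forall n, P n (G n)}.
  apply: (@choice _ _ P) => n.
  have en : (0 < e / (2 ^ n.+1)%:R)%R by rewrite divr_gt0// ltr0n expn_gt0.
  have Xfin : lebesgue_outer (X n) \is a fin_num.
    by rewrite ge0_fin_numE// ltey; apply/eqP/Xoo.
  have [_ [D [u [v [cov ->]]]] /ltW lt_e] := lb_ereal_inf_adherent en Xfin.
  by exists (D, (u, v)).
pose D n := (G n).1; pose u n := (G n).2.1; pose v n := (G n).2.2.
have uv n : forall k i, (u n k 0 i <= v n k 0 i)%R by have [[]] := PG n.
pose a (c : nat * nat) := (box_vol (u c.1 c.2) (v c.1 c.2))%:E.
have a_ge0 c : 0 <= a c by exact: (vol_ge0 (uv c.1)).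
apply: (@le_trans _ _ (\esum_(c in [set: nat] `*`` D) a c)).
  have /card_esym/ppcard_eqP[f] := card_nat2.
  have fK c : f (f^-1%FUN c) = c by rewrite invK// inE.
  apply: ereal_inf_lbound.
  exists [set k | ([set: nat] `*`` D) (f k)].
  exists (fun k => u (f k).1 (f k).2), (fun k => v (f k).1 (f k).2); split.
    split=> [k i|x [n _ Xnx]]; first exact: uv.
    have [[_ /(_ _ Xnx)[k Dk xk]] _] := PG n.
    by exists (f^-1%FUN (n, k)) => /=; rewrite ?fK.
  rewrite (reindex_esum [set k | ([set: nat] `*`` D) (f k)]
    ([set: nat] `*`` D) f)//.
  split=> //; first by move=> x y _ _; exact: (@inj _ _ _ f _ _ (in_setT _) (in_setT _)).
  by move=> c Dc; exists (f^-1%FUN c) => /=; rewrite ?fK.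
rewrite -(@esum_esum _ _ _ _ _ (fun i j => a (i, j)))//.
rewrite nneseries_esumT//; last first.
  by move=> n; rewrite adde_ge0// lee_fin divr_ge0// ltW.
by apply: le_esum => n _; have [] := PG n.
Qed.

HB.instance Definition _ := isOuterMeasure.Build R 'rV[R]_d
  (@lebesgue_outer R d) lebesgue_outer0 lebesgue_outer_ge0 le_lebesgue_outer
  lebesgue_outer_sigma_subadditive.

End lebesgue_outer_measure.

(* R^d with the sigma-algebra of Lebesgue measurable (not just Borel) sets. *)
Definition lebesgueType (R : realType) (d : nat) :=
  caratheodory_type (@lebesgue_outer R d).

Definition lebesgue (R : realType) (d : nat) :
    {measure set (lebesgueType R d) -> \bar R} :=
  [the outer_measure R 'rV[R]_d of @lebesgue_outer R d].

Definition cone (R : realType) (d : nat) (B : set 'rV[R]_d) : set 'rV[R]_d :=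
  [set t *: e | t in `]0, 1] & e in B `&` @unit_sphere R d].

(* Polar coordinates: the part of S^(d-1) inside B has surface measure d times
   the volume of cone B.  This gives a measure on R^d that does not charge the
   complement of the sphere, so norms of a function over (R^d, surface) depend
   only on its values on S^(d-1). *)
Definition surface_outer (R : realType) (d : nat) (B : set 'rV[R]_d) : \bar R :=
  (d%:R%:E * lebesgue_outer (cone B))%E.

Section surface_outer_measure.
Context (R : realType) (d : nat).
Local Open Scope ereal_scope.

Let surface_outer0 : surface_outer (@set0 'rV[R]_d) = 0.
Proof.
rewrite /surface_outer [X in lebesgue_outer X](_ : _ = set0).
  by rewrite outer_measure0 mule0.
by rewrite -subset0 => x [t _ [e [[]]]].
Qed.

Let surface_outer_ge0 (B : set 'rV[R]_d) : 0 <= surface_outer B.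
Proof. by rewrite mule_ge0// outer_measure_ge0. Qed.

Let le_surface_outer :
  {homo @surface_outer R d : X Y / X `<=` Y >-> X <= Y}.
Proof.
move=> X Y XY; rewrite lee_wpmul2l//; apply: le_outer_measure.
by move=> _ [t t01 [e [/XY Ye e1] <-]]; exists t => //; exists e.
Qed.

Let surface_outer_sigma_subadditive : sigma_subadditive (@surface_outer R d).
Proof.
move=> X; rewrite nneseriesZl; last by move=> n _; exact: outer_measure_ge0.
rewrite lee_wpmul2l//.
apply: le_trans (outer_measure_sigma_subadditive (@lebesgue_outer R d) _).
apply: le_outer_measure => _ [t t01 [e [[n _ Xe] e1] <-]].
by exists n => //; exists t => //; exists e.
Qed.

HB.instance Definition _ := isOuterMeasure.Build R 'rV[R]_d
  (@surface_outer R d) surface_outer0 surface_outer_ge0 le_surface_outer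
  surface_outer_sigma_subadditive.

End surface_outer_measure.

Definition surfaceType (R : realType) (d : nat) :=
  caratheodory_type (@surface_outer R d).

Definition surface (R : realType) (d : nat) :
    {measure set (surfaceType R d) -> \bar R} :=
  [the outer_measure R 'rV[R]_d of @surface_outer R d].

Definition L1loc (R : realType) (d : nat) (f : 'rV[R]_d -> R) : Prop :=
  measurable_fun [set: lebesgueType R d] (f : lebesgueType R d -> R) /\
  forall K : set 'rV[R]_d, compact K ->
    (\int[@lebesgue R d]_(x in K) `|f x|%:E < +oo)%E.

Definition segment (R : realType) (d : nat) (e a : 'rV[R]_d) : set 'rV[R]_d :=
  [set a + t *: e | t in `[- 2^-1, 2^-1]].

Definition tube (R : realType) (d : nat) (delta : R) (e a : 'rV[R]_d) :
    set 'rV[R]_d :=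
  [set x | exists2 y, segment e a y & enorm (x - y) < delta].

Definition tube_avg (R : realType) (d : nat) (delta : R) (f : 'rV[R]_d -> R)
    (e a : 'rV[R]_d) : \bar R :=
  ((@lebesgue R d (tube delta e a))^-1 *
     \int[@lebesgue R d]_(x in tube delta e a) `|f x|%:E)%E.

(* The maximal functions are extended-real valued: for f merely locally
   integrable the supremum may be infinite. *)
Definition kakeya_max (R : realType) (d : nat) (delta : R) (f : 'rV[R]_d -> R)
    (e : 'rV[R]_d) : \bar R :=
  ereal_sup [set tube_avg delta f e a | a in [set: 'rV[R]_d]].

Definition restricted_kakeya_max (R : realType) (d : nat) (delta : R)
    (A : set 'rV[R]_d) (f : 'rV[R]_d -> R) (e : 'rV[R]_d) : \bar R :=
  ereal_sup [set tube_avg delta f e a | a in A].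

Definition weakLnorm (disp : measure_display) (T : measurableType disp)
    (R : realType) (mu : {measure set T -> \bar R}) (p : R) (F : T -> \bar R) :
    \bar R :=
  ereal_sup [set (r%:E * mu [set x | r%:E < `|F x|] `^ p^-1)%E
            | r in [set r : R | 0 < r]].

Definition covering_number (R : realType) (d : nat) (A : set 'rV[R]_d)
    (delta : R) : \bar R :=
  ereal_inf [set k%:R%:E | k in [set k : nat | exists U : 'I_k -> set 'rV[R]_d,
    (forall i x y, U i x -> U i y -> enorm (x - y) <= delta) /\
    A `<=` \bigcup_i U i]].

Definition upper_box_dim (R : realType) (d : nat) (A : set 'rV[R]_d) : \bar R :=
  limf_esup (fun delta : R => lne (covering_number A delta) *
                              ((- ln delta)^-1)%:E)%E (0 : R)^'+.

(* Main.v *)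
(* Let Omega be the set of directions where the restricted maximal function of E exceeds lambda,
   and take a maximal O(delta)-separated family of D directions e in Omega, with tubes T_e
   centred in A such that |T_e /\ E| >~ lambda |T_e|. Discard the points of E lying on few of the
   tubes, then pigeonhole over the N <~ delta^(-s-) cells covering A and over the O(log
   (1/delta)) dyadic distances: a substantial part of the total mass sits on tubes centred in one
   cell, at distance about rho from its centre a0. Let X be the part of E on this bush. Tubes
   through a0 have overlap O(rho^(1-n)) at distance rho from a0, which bounds |X| from below, and
   each point of X lies on about D lambda delta^(n-1) / |E| of the D tubes, so the sum of the
   |T_e /\ X| is large. It remains to bound the sum of the |T_e /\ X|^q. The bush is a
   neighbourhood of a cone with vertex a0, so a tube T_e whose axis passes at distance ell from
   a0 may be dilated about a0 to normalise ell; then, for directions in a common slice, it only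
   sees a fixed section of the cone, and forgetting one coordinate yields a Kakeya tube of
   R^(n-1) and a small set F in R^(n-1) that depends only on the slice. The (n-1)-dimensional
   maximal estimate applied to the indicator of F does the rest. *)

Require Import Defs.
From mathcomp Require Import all_boot all_order all_algebra.
From mathcomp Require Import all_classical all_reals all_analysis.
From mathcomp Require Import measurable_realfun ring lra zify.

Set Implicit Arguments.
Unset Strict Implicit.
Unset Printing Implicit Defensive.

Import Order.TTheory GRing.Theory Num.Theory.
Import numFieldNormedType.Exports.

Local Open Scope classical_set_scope.
Local Open Scope ring_scope.

(** The volume y of the bush is eliminated between two bounds. From below, up to logarithms, y >~ D
    delta^(n-1) lambda^n / N, because a tube with a share >~ lambda delta^(n-1) of the bush forces
    rho >~ lambda. From above, Hoelder and the slice estimate give (D lambda y / |E|)^q <~ D^(q-1)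
    delta^(-hq) #Q, where Q is a (delta/rho)-separated set of rays and #Q lambda delta^(n-1) <~ y.
    Hence (D delta^(n-1))^q lambda^(q+1+n(q-1)) <~ N^(q-1) delta^(-hq) |E|^q, the theorem raised to
    the power q + 1 + n(q-1).

    The slices are delicate. Once normalised, the tubes of slope [tau] lie near one hyperplane x_j -
    tau x_l = const. It cuts each ray in a point, but a ray almost parallel to it stays close to it
    along a long piece, and there are about 1/delta slopes. A ray contributes O(rho/d) balls to [F],
    but only for O(d/(rho delta)) slopes; the product is O(1/delta) for all [d] and [rho]. So the
    sets [F] have total volume O(#Q delta^(n-2)), and delta^(n-2) is the measure of the caps in the
    (n-1)-dimensional estimate. *)

(** * Euclidean norm and Lebesgue measure *)

Section euclidean_norm.
Context {R : realType} {d : nat}.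
Implicit Types (x y z : 'rV[R]_d) (r : R).

Lemma enorm_ge0 x : 0 <= enorm x.
Proof. exact: sqrtr_ge0. Qed.

Lemma sqr_enorm x : enorm x ^+ 2 = \sum_i x 0 i ^+ 2.
Proof. by rewrite sqr_sqrtr// sumr_ge0// => i _; rewrite sqr_ge0. Qed.

Lemma coord_le_enorm x i : `|x 0 i| <= enorm x.
Proof.
rewrite -(ler_pXn2r (n := 2))// ?nnegrE ?enorm_ge0// sqr_enorm real_normK ?num_real//.
by rewrite (bigD1 i)//= lerDl sumr_ge0// => j _; rewrite sqr_ge0.
Qed.

Lemma enormZ c x : enorm (c *: x) = `|c| * enorm x.
Proof.
rewrite /enorm -sqrtr_sqr -sqrtrM ?sqr_ge0// mulr_sumr.
by congr Num.sqrt; apply: eq_bigr => i _; rewrite !mxE exprMn.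
Qed.

Lemma enormN x : enorm (- x) = enorm x.
Proof. by rewrite -scaleN1r enormZ normrN1 mul1r. Qed.

Lemma enormB x y : enorm (x - y) = enorm (y - x).
Proof. by rewrite -opprB enormN. Qed.

Lemma enorm0 : enorm (0 : 'rV[R]_d) = 0.
Proof. by rewrite -(scale0r 0) enormZ normr0 mul0r. Qed.

Lemma enorm0_eq0 x : enorm x = 0 -> x = 0.
Proof.
move=> x0; apply/rowP => i; rewrite mxE; apply/eqP.
by rewrite -normr_le0 -x0 coord_le_enorm.
Qed.

Lemma dot_le_enorm x y : \sum_i x 0 i * y 0 i <= enorm x * enorm y.
Proof.
have [/enorm0_eq0->|/eqP x0] := eqVneq (enorm x) 0.
  by rewrite enorm0 mul0r big1// => i _; rewrite mxE mul0r.
have [/enorm0_eq0->|/eqP y0] := eqVneq (enorm y) 0.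
  by rewrite enorm0 mulr0 big1// => i _; rewrite mxE mulr0.
have X0 : 0 < enorm x by rewrite lt_def enorm_ge0 andbT; exact/eqP.
have Y0 : 0 < enorm y by rewrite lt_def enorm_ge0 andbT; exact/eqP.
(* Young's inequality with weight [t], summed over the coordinates; for this [t] both halves equal
   the product of the norms. *)
pose t := enorm y / enorm x.
have t0 : 0 < t by rewrite divr_gt0.
have -> : enorm x * enorm y = 2^-1 * (t * enorm x ^+ 2 + t^-1 * enorm y ^+ 2).
  by rewrite /t; field; rewrite !gt_eqF.
rewrite !sqr_enorm !mulr_sumr -big_split/= mulr_sumr; apply: ler_sum => i _.
have -> : x 0 i * y 0 i = t * x 0 i * y 0 i / t by field; rewrite gt_eqF.
have -> : 2^-1 * (t * x 0 i ^+ 2 + t^-1 * y 0 i ^+ 2) =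
  2^-1 * ((t * x 0 i)^+2 + y 0 i ^+ 2) / t by field; rewrite gt_eqF.
by rewrite ler_pM2r ?invr_gt0//; have := sqr_ge0 (t * x 0 i - y 0 i); nra.
Qed.

Lemma ler_enormD x y : enorm (x + y) <= enorm x + enorm y.
Proof.
rewrite -(ler_pXn2r (n := 2))// ?nnegrE ?addr_ge0 ?enorm_ge0// sqrrD !sqr_enorm.
have -> : \sum_i (x + y) 0 i ^+ 2 =
    \sum_i x 0 i ^+ 2 + (\sum_i x 0 i * y 0 i) *+ 2 + \sum_i y 0 i ^+ 2.
  by rewrite -sumrMnl -!big_split/=; apply: eq_bigr => i _; rewrite mxE sqrrD.
by rewrite lerD2r lerD2l ler_wMn2r// dot_le_enorm.
Qed.

Lemma ler_enormB x y : enorm (x - y) <= enorm x + enorm y.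
Proof. by rewrite (le_trans (ler_enormD _ _))// enormN. Qed.

Lemma ler_enorm_dist z x y : enorm (x - y) <= enorm (x - z) + enorm (z - y).
Proof. by rewrite (le_trans _ (ler_enormD _ _))// addrA subrK. Qed.

Lemma lerB_enorm x y : enorm x - enorm y <= enorm (x - y).
Proof. by rewrite lerBlDr (le_trans _ (ler_enormD _ _))// subrK. Qed.

Lemma enorm_le r x : 0 <= r -> (forall i, `|x 0 i| <= r) -> enorm x <= d%:R * r.
Proof.
move=> r0 xr; rewrite -(ler_pXn2r (n := 2))// ?nnegrE ?enorm_ge0 ?mulr_ge0//.
rewrite sqr_enorm; apply: (@le_trans _ _ (\sum_(i < d) r ^+ 2)).
  by apply: ler_sum => i _; rewrite -real_normK ?num_real// ler_sqr ?nnegrE.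
rewrite sumr_const card_ord exprMn -[leLHS]mulr_natl ler_wpM2r ?sqr_ge0//.
by rewrite -natrX ler_nat; case: d => // k; rewrite leq_pmulr.
Qed.

Definition eball x r : set 'rV[R]_d := [set y | enorm (y - x) < r].

Lemma open_eball x r : open (eball x r).
Proof.
rewrite openE => y; rewrite /eball/= => yx; apply/nbhs_ballP.
(* The topology is that of the sup norm, and a sup ball of radius [eta] lies in a Euclidean one of
   radius [d * eta]; [d.+1] also covers [d = 0]. *)
pose eta := (r - enorm (y - x)) / d.+1%:R.
have eta0 : 0 < eta by rewrite divr_gt0// subr_gt0.
exists eta => //= z yz.
rewrite /= (le_lt_trans (ler_enorm_dist y _ _))// -ltrBrDr.
apply: (@le_lt_trans _ _ (d%:R * eta)).
  apply: enorm_le; first exact: ltW.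
  move=> i; rewrite !mxE distrC; apply: ltW; have := yz.2 0 i.
  by rewrite -ball_normE.
rewrite /eta mulrCA -[ltRHS]mulr1 ltr_pM2l ?subr_gt0//.
by rewrite ltr_pdivrMr// mul1r ltr_nat.
Qed.

End euclidean_norm.

Section lebesgue_basics.
Context {R : realType}.

(* Fubini in the last coordinate: the slices at height [t] of the cover are a cover of the slice. *)
Lemma prod_le_esum (d : nat) (u v : nat -> R) (D : set nat)
    (U V : nat -> nat -> R) :
  (forall i, u i <= v i) -> (forall k i, U k i <= V k i) ->
  (forall x : nat -> R, (forall i, (i < d)%N -> u i <= x i <= v i) ->
     exists2 k, D k & forall i, (i < d)%N -> U k i <= x i <= V k i) ->
  ((\prod_(i < d) (v i - u i))%:E <=
     \esum_(k in D) (\prod_(i < d) (V k i - U k i))%:E)%E.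
Proof.
move=> uv UV; elim: d D => [|d IH] D cov.
  have [//|k Dk _] := cov (fun=> 0).
  rewrite big_ord0; apply: (@le_trans _ _ (\esum_(i in [set k]) 1%:E)%E).
    by rewrite esum_set1// lee_fin.
  under [leRHS]eq_esum do rewrite big_ord0.
  rewrite (esumID [set k] D); last by move=> *; rewrite lee_fin.
  have -> : D `&` [set k] = [set k] by rewrite setIC; apply/setIidl => _ ->.
  by rewrite leeDl// esum_ge0.
pose P k : R := \prod_(i < d) (V k i - U k i).
have P0 k : 0 <= P k by apply: prodr_ge0 => i _; rewrite subr_ge0.
pose g k (t : measurableTypeR R) : \bar R := if k \in D then (P k * \1_(`[U k d, V k d]%classic)
  t)%:E else 0%E.
have g0 k t : (0 <= g k t)%E by rewrite /g; case: ifP => // _; rewrite lee_fin mulr_ge0.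
have mg k : measurable_fun setT (g k).
  rewrite /g; case: (k \in D) => //; apply/measurable_EFinP.
  by apply: measurable_funM => //; exact: measurable_indic.
rewrite [leLHS](_ : _ = \int[lebesgue_measure]_(t in `[u d, v d]) (\prod_(i < d)
  (v i - u i))%:E)%E; last first.
  rewrite integral_cst//= lebesgue_measure_itv/= lte_fin big_ord_recr/= EFinM.
  by have := uv d; rewrite le_eqVlt => /orP[/eqP->|->]//; rewrite ltxx subrr.
apply: (@le_trans _ _ (\int[lebesgue_measure]_(t in `[u d, v d]) \big[+%E/0%R]_(0 <= n <oo)
  g n t)%E).
  apply: ge0_le_integral => //.
  - by move=> t _; rewrite lee_fin prodr_ge0// => i _; rewrite subr_ge0.
  - apply: ge0_emeasurable_sum => // k _. exact: measurable_funTS.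
  - move=> t /=; rewrite in_itv/= => td.
    pose Dt := [set k | D k /\ U k d <= t <= V k d].
    have := IH Dt; rewrite nneseries_esumT//.
    have -> : \esum_(i in [set: nat]) g i t = \esum_(k in Dt) (P k)%:E.
      rewrite [RHS]esum_mkcond; apply: eq_esum => k _; rewrite /g indicE.
      have -> : (t \in `[U k d, V k d]%classic) = (U k d <= t <= V k d).
        by apply/idP/idP; rewrite inE/= in_itv.
      case: ifPn; rewrite ?inE notin_setE || rewrite inE; last first.
        by move=> Dk; rewrite ifF//; apply/negbTE; rewrite notin_setE => -[].
      move=> Dk; case: (boolP (_ <= _ <= _)) => tk; rewrite ?mulr1 ?mulr0.
        by rewrite ifT// inE.
      by rewrite ifF//; apply/negbTE; rewrite notin_setE => -[_]; exact/negP.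
    apply => x xuv.
    have [|k Dk kx] := cov (fun i => if i == d then t else x i).
      move=> i; rewrite ltnS leq_eqVlt; case: eqP => [->//|_ /= id]; exact: xuv.
    exists k.
      by split => //; have := kx d; rewrite eqxx; apply.
    by move=> i id; have := kx i (ltnW id); rewrite ltn_eqF.
rewrite integral_nneseries//; last by move=> k; exact: measurable_funTS.
rewrite nneseries_esumT; last by move=> k; exact: integral_ge0.
rewrite [leRHS]esum_mkcond; apply: le_esum => k _; rewrite /g.
case: ifPn => Dk; last by rewrite integral0.
under eq_integral do rewrite EFinM.
rewrite ge0_integralZl_EFin//; last first.
  by apply/measurable_EFinP; exact: measurable_indic.
rewrite integral_indic// big_ord_recr/= EFinM lee_wpmul2l ?lee_fin//.
apply: (@le_trans _ _ (lebesgue_measure `[U k d, V k d]%classic)).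
  by apply: le_measure => //; rewrite inE //; exact: measurableI.
rewrite lebesgue_measure_itv/= lte_fin; case: ifPn => // _.
by rewrite lee_fin subr_ge0.
Qed.

Lemma lebesgueE d (X : set 'rV[R]_d) : @lebesgue R d X = lebesgue_outer X.
Proof. by []. Qed.

Lemma le_lebesgue_outer d (X Y : set 'rV[R]_d) :
  X `<=` Y -> (lebesgue_outer X <= lebesgue_outer Y)%E.
Proof. exact: (le_outer_measure (@lebesgue_outer R d)). Qed.

Lemma box_vol_ge0 d (u v : 'rV[R]_d) : (forall i, u 0 i <= v 0 i) -> 0 <= box_vol u v.
Proof. by move=> uv; apply: prodr_ge0 => i _; rewrite subr_ge0. Qed.

Lemma lebesgue_outer_box d (u v : 'rV[R]_d) : (forall i, u 0 i <= v 0 i) ->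
  lebesgue_outer (box u v) = (box_vol u v)%:E.
Proof.
move=> uv; apply/eqP; rewrite eq_le; apply/andP; split.
  apply: ereal_inf_lbound; exists [set 0%N], (fun=> u), (fun=> v); split.
    by split => // x ux; exists 0%N.
  by rewrite esum_set1// lee_fin box_vol_ge0.
apply: le_ereal_inf_tmp => _ [D [U [V [[UV cov] ->]]]].
(* Vectors become sequences, zero from index [d] on, so that the induction on the dimension in
   [prod_le_esum] applies. *)
pose ext (x : 'rV[R]_d) i := oapp (x 0) 0 (insub i).
have extE x (i : 'I_d) : ext x i = x 0 i by rewrite /ext valK.
have ext_le (x y : 'rV[R]_d) : (forall i, x 0 i <= y 0 i) -> forall i, ext x i <= ext y i.
  by move=> xy i; rewrite /ext; case: insubP => //= j _ _.
have := @prod_le_esum d (ext u) (ext v) D (fun k => ext (U k)) (fun k => ext (V k)) (ext_le _ _ uv)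
  (fun k => ext_le _ _ (UV k)).
under eq_bigr do rewrite !extE.
under eq_esum do under eq_bigr do rewrite !extE.
apply => x ux.
have [i|k Dk kx] := cov (\row_i x i).
  by rewrite mxE; have := ux i (ltn_ord i); rewrite !extE.
exists k => // i id; have := kx (Ordinal id).
by rewrite mxE -!extE.
Qed.

(** The hyperplane cuts each box of a cover into two boxes whose volumes add up. Clamping the cut
    [w] to the box lets one of the two be degenerate without a case distinction. *)
Lemma measurable_halfspace d (i : 'I_d) (c : R) :
  measurable ([set x | x 0 i <= c] : set (lebesgueType R d)).
Proof.
apply: (@le_caratheodory_measurable _ _ (@lebesgue_outer R d)) => X.
apply: le_ereal_inf_tmp => _ [D [u [v [[uv cov] ->]]]].
pose w k := Num.max (u k 0 i) (Num.min (v k 0 i) c).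
have uw k : u k 0 i <= w k by rewrite le_max lexx.
have wv k : w k <= v k 0 i by rewrite ge_max uv ge_min lexx.
pose v' k : 'rV[R]_d := \row_j if j == i then w k else v k 0 j.
pose u' k : 'rV[R]_d := \row_j if j == i then w k else u k 0 j.
have uv' k j : u k 0 j <= v' k 0 j by rewrite mxE; case: eqP => [->|_].
have u'v k j : u' k 0 j <= v k 0 j by rewrite mxE; case: eqP => [->|_].
have volE k : (box_vol (u k) (v k))%:E =
    ((box_vol (u k) (v' k))%:E + (box_vol (u' k) (v k))%:E)%E.
  rewrite -EFinD; congr EFin; rewrite /box_vol (bigD1 i)//= (bigD1 i (P := predT))//=.
  rewrite [X in _ = _ + X](bigD1 i)//= !mxE eqxx.
  have -> : \prod_(j < d | j != i) (v' k 0 j - u k 0 j) = \prod_(j < d | j != i)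
    (v k 0 j - u k 0 j).
    by apply: eq_bigr => j ji; rewrite mxE (negbTE ji).
  have -> : \prod_(j < d | j != i) (v k 0 j - u' k 0 j) = \prod_(j < d | j != i)
    (v k 0 j - u k 0 j).
    by apply: eq_bigr => j ji; rewrite mxE (negbTE ji).
  by rewrite -mulrDl; congr (_ * _); ring.
under eq_esum do rewrite volE.
rewrite esumD; last 2 first.
- by move=> k _; rewrite lee_fin box_vol_ge0.
- by move=> k _; rewrite lee_fin box_vol_ge0.
apply: leeD.
  apply: ereal_inf_lbound; exists D, u, v'; split => //; split => // x [Xx /= xc].
  have [k Dk kx] := cov _ Xx; exists k => // j.
  have := kx j; rewrite mxE; case: eqP => [->|//] /andP[ux xv].
  by rewrite ux/= le_max le_min xv xc orbT.
apply: ereal_inf_lbound; exists D, u', v; split => //; split => // x [Xx /= xc].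
have [k Dk kx] := cov _ Xx; exists k => // j.
have := kx j; rewrite mxE; case: eqP => [->|//] /andP[ux xv].
rewrite xv andbT ge_max ux/= ge_min; apply/orP; right.
by move/negP : xc; rewrite -ltNge => /ltW.
Qed.

Lemma measurable_halfspace_ge d (i : 'I_d) (c : R) :
  measurable ([set x | c <= x 0 i] : set (lebesgueType R d)).
Proof.
rewrite [X in measurable X](_ : _ = \bigcap_k ~` [set x : lebesgueType R d | (x : 'rV[R]_d)
  0 i <= c - k.+1%:R^-1]).
  by apply: bigcapT_measurable => k; apply: measurableC; exact: measurable_halfspace.
apply/seteqP; split => [x/= cx k _ /=|x/= cx].
  apply/negP; rewrite -ltNge (lt_le_trans _ cx)// ltrBlDr ltrDl invr_gt0//.
rewrite leNgt; apply/negP => xc.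
have [k] := ltr_add_invr xc.
by have /= /negP := cx k I; rewrite -ltNge ltrBlDr => ck /(lt_trans ck); rewrite ltxx.
Qed.

Lemma measurable_box d (u v : 'rV[R]_d) : measurable (box u v : set (lebesgueType R d)).
Proof.
rewrite (_ : box u v = \bigcap_(i in [set: 'I_d])
   ([set x : 'rV[R]_d | u 0 i <= x 0 i] `&` [set x : 'rV[R]_d | x 0 i <= v 0 i])).
  apply: (@fin_bigcap_measurable _ (lebesgueType R d)); first exact: finite_finset.
  move=> i _; apply: measurableI; first exact: measurable_halfspace_ge.
  exact: measurable_halfspace.
apply/seteqP; split => [x ux i _|x ux i] /=; first by apply/andP; exact: ux.
by apply/andP; exact: ux.
Qed.

(** Boxes with rational centre and half-width [1 / (k + 1)] form a countable family, and those
    inside [U] exhaust it. *)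
Lemma open_lebesgue_measurable d (U : set 'rV[R]_d) :
  open U -> measurable (U : set (lebesgueType R d)).
Proof.
move=> oU.
pose c (a : 'rV[rat]_d * nat) : 'rV[R]_d := map_mx ratr a.1.
pose B a := box (c a - const_mx a.2.+1%:R^-1) (c a + const_mx a.2.+1%:R^-1).
rewrite (_ : U = \bigcup_a (if asbool (B a `<=` U) then B a else set0)).
  apply: (@countable_bigcupT_measurable _ (lebesgueType R d)).
    exact: countableP.
  by move=> a; case: ifP => _ //; exact: measurable_box.
apply/seteqP; split => [x Ux|x [a _]]; last by case: asboolP => // aU; exact: aU.
move: oU; rewrite openE => /(_ _ Ux) /nbhs_ballP[e /= e0 xe].
have [k ke] : exists k : nat, k.+1%:R^-1 < e / 2.
  by have [k] := ltr_add_invr (divr_gt0 e0 (@ltr0n R 2)); rewrite add0r; exists k.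
have k0 : 0 < k.+1%:R^-1 :> R by rewrite invr_gt0.
have qx i : {q : rat | `|ratr q - x 0 i| < k.+1%:R^-1}.
  move: k0; set r := _^-1 => r0.
  have /rat_in_itvoo/cid[q] : x 0 i - r < x 0 i + r by lra.
  by rewrite in_itv/= => qx; exists q; rewrite ltr_norml; apply/andP; lra.
have qi i := svalP (qx i).
exists (\row_i sval (qx i), k) => //.
have Bx : B (\row_i sval (qx i), k) x.
  by move=> i; have := qi i; rewrite !mxE ltr_norml; set r := _^-1; lra.
rewrite ifT//; apply/asboolP => y By; apply: xe; split => // i j.
rewrite [i]ord1; have := By j; have := Bx j; rewrite !mxE /= -ball_normE/=.
by move: ke; set r := _^-1 => ke h1 h2; rewrite ltr_norml; apply/andP; lra.
Qed.

End lebesgue_basics.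

(** * Overlap counting, coverings and packings by balls *)

Section overlap.
Context {disp : measure_display} {T : measurableType disp} {R : realType}
  (mu : {measure set T -> \bar R}) (I : finType).
Variables (P : pred I) (F : I -> set T) (X : set T).
Hypotheses (mF : forall i, measurable (F i)) (mX : measurable X).

(** Exchanging sum and integral turns a pointwise bound on the multiplicity into a bound on the
    total measure; both lemmas below rest on it. *)
Let sum_measure : (\sum_(i | P i) mu (F i `&` X))%E =
  (\int[mu]_(x in X) (\sum_(i | P i) \1_(F i) x)%:E)%E.
Proof.
under [RHS]eq_integral do rewrite -sumEFin -big_filter.
rewrite ge0_integral_sum//; last first.
  by move=> i; apply/measurable_EFinP; exact: measurable_indic.
by rewrite big_filter; apply: eq_bigr => i _; rewrite integral_indic.
Qed.

Let msum : measurable_fun X (fun x => (\sum_(i | P i) \1_(F i) x : R)%:E).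
Proof.
apply/measurable_EFinP; under eq_fun do rewrite -big_filter.
by apply: measurable_sum => i; exact: measurable_indic.
Qed.

Lemma sum_measure_le M : (forall x, X x -> \sum_(i | P i) \1_(F i) x <= M) ->
  0 <= M -> (\sum_(i | P i) mu (F i `&` X) <= M%:E * mu X)%E.
Proof.
move=> XM M0; rewrite sum_measure -integral_cst//; apply: ge0_le_integral => //.
by move=> x _; rewrite lee_fin sumr_ge0.
Qed.

Lemma sum_measure_ge M : (forall x, X x -> M <= \sum_(i | P i) \1_(F i) x) ->
  0 <= M -> (M%:E * mu X <= \sum_(i | P i) mu (F i `&` X))%E.
Proof.
by move=> XM M0; rewrite sum_measure -integral_cst//; apply: ge0_le_integral.
Qed.

End overlap.

Lemma sumr_const_pred {R : pzSemiRingType} (I : finType) (P : pred I) (x : R) :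
  \sum_(i | P i) x = #|P|%:R * x.
Proof. by rewrite mulr_natl -sumr_const; apply: eq_bigl. Qed.

Lemma sum_indic_card {T : Type} {R : realType} (I : finType) (P : pred I)
    (F : I -> set T) (x : T) :
  \sum_(i | P i) \1_(F i) x = #|[pred i | P i && (x \in F i)]|%:R :> R.
Proof.
rewrite -sum1_card natr_sum big_mkcond [RHS]big_mkcond; apply: eq_bigr => i _.
by rewrite inE/= indicE; case: (P i) => //=; case: (x \in F i).
Qed.

(** [X] may fail to be measurable, so the count is made on the union of the boxes circumscribed to
    the balls. *)
Lemma lebesgue_cover_le {R : realType} d (I : finType) (P : pred I)
    (c : I -> 'rV[R]_d) (r : R) (X : set 'rV[R]_d) : 0 <= r ->
  (forall x, X x -> exists2 i, P i & eball (c i) r x) ->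
  (lebesgue_outer X <= (#|P|%:R * (2 * r) ^+ d)%:E)%E.
Proof.
move=> r0 XP.
pose F i : set (lebesgueType R d) := box (c i - const_mx r) (c i + const_mx r).
pose Y := \bigcup_(i in [set i | P i]) F i.
have mF i : measurable (F i) by exact: measurable_box.
have mY : measurable Y.
  by apply: (@fin_bigcup_measurable _ (lebesgueType R d)) => //; exact: finite_finset.
have XY : X `<=` Y.
  move=> x /XP[i Pi /= xi]; exists i => // j; rewrite !mxE.
  have := le_lt_trans (coord_le_enorm _ j) xi; rewrite !mxE ltr_norml.
  by move=> /andP[h1 h2]; apply/andP; split; lra.
apply: (le_trans (le_lebesgue_outer XY)).
have := @sum_measure_ge _ _ _ (@lebesgue R d) I P F Y mF mY 1.
rewrite mul1e => H; apply: (le_trans (H _ ler01)).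
  move=> x [i Pi xi]; rewrite sum_indic_card ler1n; apply/card_gt0P.
  by exists i; rewrite inE Pi; apply/mem_set.
apply: (@le_trans _ _ (\sum_(i | P i) ((2 * r) ^+ d)%:E)%E).
  apply: lee_sum => i _; rewrite lebesgueE.
  apply: (@le_trans _ _ (lebesgue_outer (F i))); first exact: le_lebesgue_outer.
  rewrite lebesgue_outer_box; last by move=> j; rewrite !mxE; lra.
  rewrite lee_fin /box_vol (eq_bigr (fun=> 2 * r)).
    by rewrite prodr_const card_ord.
  by move=> j _; rewrite !mxE; ring.
by rewrite sumEFin lee_fin sumr_const_pred.
Qed.

(** The separation makes the balls disjoint, and each contains a box of half-width [r / d.+1]; no
    volume of a Euclidean ball is ever computed. *)
Lemma lebesgue_pack_ge {R : realType} d (I : finType) (P : pred I)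
    (c : I -> 'rV[R]_d) (r : R) (X : set 'rV[R]_d) : 0 < r ->
  {in P &, forall i j, i != j -> 2 * r <= enorm (c i - c j)} ->
  (forall i, P i -> eball (c i) r `<=` X) ->
  ((#|P|%:R * (r / d.+1%:R) ^+ d)%:E <= lebesgue_outer X)%E.
Proof.
move=> r0 sep PX; pose r' : R := r / d.+1%:R.
have r'0 : 0 < r' by rewrite divr_gt0.
pose F i : set (lebesgueType R d) := box (c i - const_mx r') (c i + const_mx r').
have Fball i : F i `<=` eball (c i) r.
  move=> x /= xi; apply: (@le_lt_trans _ _ (d%:R * r')).
    apply: enorm_le; first exact: ltW.
    by move=> j; have := xi j; rewrite !mxE ler_norml => /andP[h1 h2]; apply/andP; split; lra.
  by rewrite /r' mulrCA gtr_pMr// ltr_pdivrMr// mul1r ltr_nat.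
pose Y := \bigcup_(i in [set i | P i]) F i.
have mF i : measurable (F i) by exact: measurable_box.
have mY : measurable Y.
  by apply: (@fin_bigcup_measurable _ (lebesgueType R d)) => //; exact: finite_finset.
have YX : Y `<=` X by move=> x [i Pi /Fball]; exact: PX.
apply: (le_trans _ (le_lebesgue_outer YX)).
have := @sum_measure_le _ _ _ (@lebesgue R d) I P F Y mF mY 1.
rewrite mul1e => H; apply: (le_trans _ (H _ ler01)).
  apply: (@le_trans _ _ (\sum_(i | P i) (r' ^+ d)%:E)%E).
    by rewrite sumEFin lee_fin sumr_const_pred.
  apply: lee_sum => i Pi; rewrite lebesgueE.
  rewrite (_ : _ `&` _ = F i); last by apply/setIidl => x xi; exists i.
  rewrite lebesgue_outer_box; last by move=> j; rewrite !mxE; lra.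
  rewrite lee_fin /box_vol; apply: (@le_trans _ _ (\prod_(j < d) r')).
    by rewrite prodr_const card_ord.
  apply: ler_prod => j _; rewrite ltW//= !mxE; lra.
move=> x _; rewrite sum_indic_card lern1; apply/card_le1_eqP => i j.
rewrite !inE => /andP[Pi xi] /andP[Pj xj].
apply/eqP/negPn/negP => ij; have := sep _ _ Pj Pi ij.
apply/negP; rewrite -ltNge (le_lt_trans (ler_enorm_dist x _ _))// enormB.
have h1 : enorm (x - c i) < r := Fball _ _ (set_mem xi).
have h2 : enorm (x - c j) < r := Fball _ _ (set_mem xj).
by rewrite [ltRHS]mulr_natl mulr2n ltrD.
Qed.

(** * Tubes and caps *)

Section tubes.
Context {R : realType} {d : nat}.
Implicit Types (e a x : 'rV[R]_d) (delta : R).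

Lemma tubeE delta e a :
  tube delta e a = \bigcup_(y in segment e a) eball y delta.
Proof. by apply/seteqP; split => x [y]; exists y. Qed.

Lemma open_tube delta e a : open (tube delta e a).
Proof. by rewrite tubeE; apply: bigcup_open => y _; exact: open_eball. Qed.

Lemma measurable_tube delta e a : measurable (tube delta e a : set (lebesgueType R d)).
Proof. exact/open_lebesgue_measurable/open_tube. Qed.

Lemma tubeP delta e a x : tube delta e a x <->
  exists2 t, `|t| <= 2^-1 & enorm (x - (a + t *: e)) < delta.
Proof.
split => [[_ [t /= t2 <-] xt]|[t t2 xt]].
  by exists t => //; rewrite ler_norml; move: t2; rewrite in_itv.
exists (a + t *: e) => //; exists t => //=.
by move: t2; rewrite in_itv/= ler_norml.
Qed.

Lemma truncn_bounds (x : R) : 0 <= x ->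
  (Num.truncn x)%:R <= x < (Num.truncn x)%:R + 1.
Proof. by move=> /truncn_itv; rewrite -natr1. Qed.

End tubes.

(** Balls of radius [delta] centred on the axis at spacing [2 * delta] are disjoint, and at least
    [1 / (2 * delta)] of them fit. *)
Lemma tube_vol_ge {R : realType} m delta (e a : 'rV[R]_m.+1) : enorm e = 1 ->
  0 < delta -> ((2^-1 / m.+2%:R ^+ m.+1 * delta ^+ m)%:E <= lebesgue_outer (tube delta e a))%E.
Proof.
move=> e1 d0; pose K := Num.truncn (2 * delta)^-1.
have /andP[K1 K2] : K%:R <= (2 * delta)^-1 < K%:R + 1.
  by apply: truncn_bounds; rewrite invr_ge0 mulr_ge0 ?ltW.
have d20 : 0 < 2 * delta by rewrite mulr_gt0.
have K3 : K%:R * (2 * delta) <= 1 by rewrite -ler_pdivlMr// div1r.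
pose c (k : 'I_K.+1) := a + (k%:R * (2 * delta) - 2^-1) *: e.
apply: le_trans (@lebesgue_pack_ge R m.+1 'I_K.+1 predT c delta _ d0 _ _).
- rewrite lee_fin cardT size_enum_ord expr_div_n.
  apply: (@le_trans _ _ ((2 * delta)^-1 * (delta ^+ m.+1 / m.+2%:R ^+ m.+1))).
    have : m.+2%:R ^+ m.+1 != 0 :> R by rewrite expf_neq0.
    rewrite [delta ^+ m.+1]exprS; move: (delta ^+ m) (_ ^+ m.+1) => u w w0.
    by rewrite le_eqVlt; apply/orP; left; apply/eqP; field; rewrite w0 gt_eqF.
  apply: ler_wpM2r; last by rewrite -[K.+1%:R]natr1 ltW.
  by rewrite divr_ge0// exprn_ge0// ltW.
- move=> i j _ _ ij.
  have -> : c i - c j = ((i%:R - j%:R) * (2 * delta)) *: e.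
    by apply/rowP => l; rewrite !mxE; ring.
  rewrite enormZ e1 mulr1 normrM (gtr0_norm d20) ler_peMl//; first exact: ltW.
  wlog ji : i j ij / (j < i)%N.
    move=> W; have := ij; rewrite -(inj_eq val_inj) neq_ltn => /orP[h|h].
      by rewrite distrC W// eq_sym.
    exact: W.
  by rewrite -natrB 1?ltnW// normr_nat ler1n subn_gt0.
move=> i _ x /= xc; apply/tubeP; exists (i%:R * (2 * delta) - 2^-1) => //.
have i0 : 0 <= i%:R * (2 * delta) by rewrite mulr_ge0// ltW.
have iK : i%:R * (2 * delta) <= K%:R * (2 * delta).
  by rewrite ler_pM2r// ler_nat -ltnS.
by rewrite ler_norml; apply/andP; split; lra.
Qed.

Lemma tube_vol_le {R : realType} m delta (e a : 'rV[R]_m.+1) : enorm e = 1 ->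
  0 < delta < 1 -> (lebesgue_outer (tube delta e a) <= (2 * 4 ^+ m.+1 * delta ^+ m)%:E)%E.
Proof.
move=> e1 /andP[d0 d1]; pose K := Num.truncn delta^-1.
have /andP[K1 K2] : K%:R <= delta^-1 < K%:R + 1.
  by apply: truncn_bounds; rewrite invr_ge0 ltW.
pose c (k : 'I_K.+1) := a + (k%:R * delta - 2^-1) *: e.
apply: (@le_trans _ _ (#|'I_K.+1|%:R * (2 * (2 * delta)) ^+ m.+1)%:E).
  apply: (@lebesgue_cover_le R m.+1 'I_K.+1 predT c); first by rewrite mulr_ge0// ltW.
  move=> x /tubeP[t]; rewrite ler_norml => /andP[t1 t2] xt.
  have t0 : 0 <= t + 2^-1 by lra.
  pose k := Num.truncn ((t + 2^-1) / delta).
  have /andP[k1 k2] : k%:R <= (t + 2^-1) / delta < k%:R + 1.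
    by apply: truncn_bounds; rewrite divr_ge0// ltW.
  have kK : (k < K.+1)%N.
    rewrite ltnS; apply: le_truncn; rewrite -[leRHS]mul1r ler_pM2r ?invr_gt0//; lra.
  exists (Ordinal kK) => //=; rewrite /eball/=.
  apply: (le_lt_trans (ler_enorm_dist (a + t *: e) _ _)).
  have -> : a + t *: e - c (Ordinal kK) = (t + 2^-1 - k%:R * delta) *: e.
    by rewrite /c/= opprD addrACA subrr add0r -scalerBl; congr (_ *: _); ring.
  rewrite enormZ e1 mulr1 (_ : 2 * delta = delta + delta); last by ring.
  rewrite ltr_leD//.
  move: k1 k2; rewrite ler_pdivlMr// ltr_pdivrMr// => k1 k2.
  by rewrite ler_norml; apply/andP; split; lra.
rewrite lee_fin card_ord -natr1 mulrA (_ : 2 * 2 = 4 :> R); last by ring.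
rewrite exprMn [delta ^+ m.+1]exprS.
have K3 : (K%:R + 1) * delta <= 2.
  have : K%:R * delta <= 1 by rewrite -ler_pdivlMr// div1r.
  lra.
have u0 : 0 <= 4 ^+ m.+1 :> R by rewrite exprn_ge0.
have v0 : 0 <= delta ^+ m by rewrite exprn_ge0// ltW.
move: (4 ^+ _) (delta ^+ _) u0 v0 => u v u0 v0.
rewrite (_ : _ * (u * _) = (K%:R + 1) * delta * (u * v)); last by ring.
by rewrite -[leRHS]mulrA ler_wpM2r// mulr_ge0.
Qed.

Lemma open_of_eball {R : realType} d (U : set 'rV[R]_d) :
  (forall x, U x -> exists2 r, 0 < r & eball x r `<=` U) -> open U.
Proof.
move=> h; rewrite openE => x /h[r r0 xr]; rewrite /interior.
apply: (@filterS _ _ _ (eball x r)) => //.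
by apply: open_nbhs_nbhs; split; [exact: open_eball|rewrite /eball/= subrr enorm0].
Qed.

Section surface_measure.
Context {R : realType} (m : nat).
Implicit Types (e w x : 'rV[R]_m.+1).

(* The cone over a ball agrees on cones with an open set. *)
Lemma measurable_cap w r : measurable (eball w r : set (surfaceType R m.+1)).
Proof.
pose G : set 'rV[R]_m.+1 := [set x | enorm (x - enorm x *: w) < r * enorm x].
have oG : open G.
  apply: open_of_eball => x; rewrite /G/= => xG.
  pose g := r * enorm x - enorm (x - enorm x *: w).
  have g0 : 0 < g by rewrite subr_gt0.
  pose D := `|r| + 1 + enorm w.
  have D0 : 0 < D by rewrite /D ltr_wpDr ?enorm_ge0// ltr_wpDl.
  exists (g / D); first by rewrite divr_gt0.
  move=> y /= yx.
  set eta := enorm (y - x) in yx.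
  have yxn : `|enorm y - enorm x| <= eta.
    by rewrite ler_norml lerB_enorm andbT lerNl opprB /eta enormB lerB_enorm.
  have h1 : enorm (y - enorm y *: w) <= eta + enorm (x - enorm x *: w) + eta * enorm w.
    have -> : y - enorm y *: w = (y - x) + (x - enorm x *: w) + (enorm x - enorm y) *: w.
      by apply/rowP => l; rewrite !mxE; ring.
    rewrite (le_trans (ler_enormD _ _))// lerD ?ler_enormD//.
    by rewrite enormZ ler_wpM2r ?enorm_ge0// distrC.
  have h2 : r * enorm x - `|r| * eta <= r * enorm y.
    rewrite lerBlDr -lerBlDl -mulrBr (le_trans (ler_norm _))// normrM.
    by rewrite ler_wpM2l// distrC.
  apply: (le_lt_trans h1); apply: (lt_le_trans _ h2).
  move: yx; rewrite /eball/= -/eta ltr_pdivlMr// /D /g; lra.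
apply: (@le_caratheodory_measurable _ _ (@surface_outer R m.+1)) => X.
rewrite /surface_outer -muleDr ?ge0_adde_def ?inE ?outer_measure_ge0//.
rewrite lee_wpmul2l//.
have mG := open_lebesgue_measurable oG.
have -> : lebesgue_outer (cone X) = (lebesgue_outer (cone X `&` G)
  + lebesgue_outer (cone X `&` ~` G))%E by exact: mG.
have coneG t e : 0 < t -> enorm e = 1 -> G (t *: e) <-> eball w r e.
  move=> t0 e1; rewrite /G /eball/= enormZ e1 mulr1 gtr0_norm//.
  by rewrite -scalerBr enormZ gtr0_norm// [r * t]mulrC ltr_pM2l.
by apply: leeD; apply: le_lebesgue_outer => _ [t t01 [e [[Xe we] e1] <-]];
  move: (t01); rewrite /= in_itv/= => /andP[t0 _]; split;
  [exists t => //; exists e| exact/coneG |exists t => //; exists e| move=> /(coneG _ _ t0 e1)].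
Qed.

Lemma surface_cover_le (I : finType) (e : I -> 'rV[R]_m.+1) theta (X : set 'rV[R]_m.+1) :
  0 < theta <= 6 -> (forall i, enorm (e i) = 1) ->
  (forall x, X x -> enorm x = 1 -> exists i, enorm (x - e i) < theta) ->
  (surface_outer X <= (#|I|%:R * (m.+1%:R * 7 * 4 ^+ m.+1) * theta ^+ m)%:E)%E.
Proof.
move=> /andP[t0 t6] e1 cov; pose K := Num.truncn theta^-1.
have /andP[K1 K2] : K%:R <= theta^-1 < K%:R + 1.
  by apply: truncn_bounds; rewrite invr_ge0 ltW.
pose c (i : I * 'I_K.+1) := (i.2%:R * theta) *: e i.1.
have : (lebesgue_outer (cone X) <= (#|{: I * 'I_K.+1}|%:R * (2 * (2 * theta)) ^+ m.+1)%:E)%E.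
  apply: (@lebesgue_cover_le R m.+1 _ predT c); first by rewrite mulr_ge0// ltW.
  move=> _ [t /= t01 [x [Xx x1] <-]].
  move: t01; rewrite in_itv/= => /andP[tt0 tt1].
  have [i xi] := cov _ Xx x1.
  pose k := Num.truncn (t / theta).
  have /andP[k1 k2] : k%:R <= t / theta < k%:R + 1.
    by apply: truncn_bounds; rewrite divr_ge0// ltW.
  have kK : (k < K.+1)%N.
    rewrite ltnS; apply: le_truncn; rewrite -[leRHS]mul1r ler_pM2r ?invr_gt0//; lra.
  exists (i, Ordinal kK) => //=; rewrite /eball/= /c/=.
  have -> : t *: x - (k%:R * theta) *: e i = t *: (x - e i) + (t - k%:R * theta) *: e i.
    by rewrite scalerBr scalerBl addrA subrK.
  rewrite (le_lt_trans (ler_enormD _ _))// !enormZ e1 mulr1 (gtr0_norm tt0).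
  have -> : 2 * theta = theta + theta by ring.
  apply: ltr_leD.
    by rewrite (le_lt_trans _ xi)// ler_piMl ?enorm_ge0.
  move: k1 k2; rewrite ler_pdivlMr// ltr_pdivrMr// => k1 k2.
  by rewrite ler_norml; apply/andP; split; lra.
rewrite card_prod card_ord => h; rewrite /surface_outer.
apply: (@le_trans _ _ (m.+1%:R%:E * ((#|I| * K.+1)%:R * (2 * (2 * theta)) ^+ m.+1)%:E)%E).
  by rewrite lee_wpmul2l.
rewrite -EFinM lee_fin natrM -[K.+1%:R]natr1 mulrA (_ : 2 * 2 = 4 :> R); last by ring.
rewrite exprMn [theta ^+ m.+1]exprS.
have K3 : (K%:R + 1) * theta <= 7.
  have : K%:R * theta <= 1 by rewrite -ler_pdivlMr// div1r.
  lra.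
have u0 : 0 <= 4 ^+ m.+1 :> R by rewrite exprn_ge0.
have v0 : 0 <= theta ^+ m by rewrite exprn_ge0// ltW.
move: (4 ^+ _) (theta ^+ _) u0 v0 => u v u0 v0.
rewrite [leLHS](_ : _ = (m.+1%:R * #|I|%:R * (u * v)) * ((K%:R + 1) * theta)); last by ring.
rewrite [leRHS](_ : _ = (m.+1%:R * #|I|%:R * (u * v)) * 7); last by ring.
by rewrite ler_wpM2l// mulr_ge0// mulr_ge0.
Qed.

(** The cone over the cap contains disjoint balls of radius [r / 8] centred on the ray of [w].
    Heights between 1/2 and 3/4 keep them inside the unit ball and so far from the vertex that their
    radial projections stay in the cap. *)
Lemma surface_cap_ge w r : enorm w = 1 -> 0 < r <= 1 ->
  ((((8 * m.+2%:R) ^+ m.+1)^-1 * r ^+ m)%:E <= surface_outer (eball w r))%E.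
Proof.
move=> w1 /andP[r0 r1]; pose K := Num.truncn r^-1.
have /andP[K1 K2] : K%:R <= r^-1 < K%:R + 1.
  by apply: truncn_bounds; rewrite invr_ge0 ltW.
pose c (k : 'I_K.+1) := (2^-1 + k%:R * (r / 4)) *: w.
have r8 : 0 < r / 8 by rewrite divr_gt0.
have : ((#|'I_K.+1|%:R * (r / 8 / m.+2%:R) ^+ m.+1)%:E <= lebesgue_outer (cone (eball w r)))%E.
  apply: (@lebesgue_pack_ge R m.+1 _ predT c) => //.
  - move=> i j _ _ ij.
    have -> : c i - c j = ((i%:R - j%:R) * (r / 4)) *: w.
      by rewrite /c -scalerBl; congr (_ *: _); ring.
    rewrite enormZ w1 mulr1 normrM (gtr0_norm (_ : 0 < r / 4)) ?divr_gt0//.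
    rewrite (_ : 2 * (r / 8) = r / 4); last by field.
    rewrite ler_peMl//; first by rewrite ltW// divr_gt0.
    wlog ji : i j ij / (j < i)%N.
      move=> W; have := ij; rewrite -(inj_eq val_inj) neq_ltn => /orP[h|h].
        by rewrite distrC W// eq_sym.
      exact: W.
    by rewrite -natrB 1?ltnW// normr_nat ler1n subn_gt0.
  move=> k _ x; rewrite /eball/= => xk.
  set t := 2^-1 + k%:R * (r / 4).
  have t1 : 2^-1 <= t by rewrite lerDl mulr_ge0// ltW// divr_gt0.
  have t2 : t <= 3 / 4.
    have : k%:R * r <= 1 by rewrite -ler_pdivlMr// div1r (le_trans _ K1)// ler_nat -ltnS.
    rewrite /t; lra.
  have nx : `|enorm x - t| < r / 8.
    have ct : enorm (c k) = t by rewrite enormZ w1 mulr1 ger0_norm// (le_trans _ t1).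
    rewrite (le_lt_trans _ xk)// ler_norml -ct lerB_enorm andbT lerNl opprB.
    by rewrite [leRHS]enormB lerB_enorm.
  have x0 : 0 < enorm x by move: nx; rewrite ltr_norml; lra.
  exists (enorm x).
    by rewrite /= in_itv/= x0/=; move: nx; rewrite ltr_norml; lra.
  exists ((enorm x)^-1 *: x); last by rewrite scalerA divff ?scale1r// gt_eqF.
  split; last by rewrite /unit_sphere/= enormZ gtr0_norm ?invr_gt0// mulVf// gt_eqF.
  rewrite /eball/= -(ltr_pM2l x0) -[X in X * enorm (_ - _)](gtr0_norm x0) -enormZ.
  rewrite scalerBr scalerA divff ?gt_eqF// scale1r.
  apply: (le_lt_trans (ler_enorm_dist (c k) _ _)).
  rewrite /c -/t -scalerBl enormZ w1 mulr1 distrC.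
  move: xk nx; rewrite /c -/t => xk nx.
  have := ltrD xk nx; move=> /lt_le_trans; apply.
  move: nx; rewrite ltr_norml => /andP[nx _]; nra.
rewrite card_ord => h; rewrite /surface_outer.
apply: (@le_trans _ _ (m.+1%:R%:E * (K.+1%:R * (r / 8 / m.+2%:R) ^+ m.+1)%:E)%E); last first.
  by rewrite lee_wpmul2l.
rewrite -EFinM lee_fin -[K.+1%:R]natr1 -mulrA -invfM !expr_div_n [r ^+ m.+1]exprS.
have K3 : 1 <= (K%:R + 1) * r by rewrite -ler_pdivrMr// div1r ltW.
have u0 : 0 <= ((8 * m.+2%:R) ^+ m.+1)^-1 :> R by rewrite invr_ge0 exprn_ge0// mulr_ge0.
have v0 : 0 <= r ^+ m by rewrite exprn_ge0// ltW.
move: (_^-1) (r ^+ _) u0 v0 => u v u0 v0.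
rewrite [leRHS](_ : _ = (m.+1%:R * ((K%:R + 1) * r)) * (u * v)); last by ring.
rewrite ler_peMl ?mulr_ge0// -[X in X <= _]mulr1 ler_pM// ler1n//.
Qed.

End surface_measure.

Section tube_averages.
Context {R : realType} {m : nat}.
Implicit Types (e a : 'rV[R]_m.+1) (delta : R) (F : set (lebesgueType R m.+1)).

Lemma tube_volE delta e a : enorm e = 1 -> 0 < delta < 1 ->
  exists2 v, lebesgue_outer (tube delta e a) = v%:E &
    2^-1 / m.+2%:R ^+ m.+1 * delta ^+ m <= v <= 2 * 4 ^+ m.+1 * delta ^+ m.
Proof.
move=> e1 /andP[d0 d1]; have := tube_vol_ge a e1 d0.
have := tube_vol_le (delta := delta) a e1; rewrite d0 d1 => /(_ isT).
case: (lebesgue_outer _) => [v| |]//; rewrite !lee_fin => h1 h2.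
by exists v => //; rewrite h1 h2.
Qed.

Lemma tube_avg_indic delta e a F v : measurable F ->
  lebesgue_outer (tube delta e a) = v%:E -> v != 0 ->
  tube_avg delta \1_F e a = (v^-1%:E * lebesgue_outer (F `&` tube delta e a))%E.
Proof.
move=> mF hv v0; rewrite /tube_avg lebesgueE hv inver (negbTE v0); congr (_ * _)%E.
under eq_integral do rewrite ger0_norm//.
by rewrite integral_indic//; exact: measurable_tube.
Qed.

Lemma lt_tube_avg delta e a F lam : enorm e = 1 -> 0 < delta < 1 -> 0 < lam ->
  measurable F -> (lam%:E < tube_avg delta \1_F e a)%E ->
  ((lam * (2^-1 / m.+2%:R ^+ m.+1 * delta ^+ m))%:E <= lebesgue_outer (F `&` tube delta e a))%E.
Proof.
move=> e1 d01 lam0 mF; have [v hv /andP[v1 v2]] := tube_volE a e1 d01.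
have v0 : 0 < v.
  rewrite (lt_le_trans _ v1)// mulr_gt0 ?exprn_gt0 ?divr_gt0 ?exprn_gt0//.
  by case/andP : d01.
rewrite (tube_avg_indic mF hv) ?gt_eqF// => /ltW h.
apply: (@le_trans _ _ (lam * v)%:E); first by rewrite lee_fin ler_pM2l.
rewrite mulrC EFinM -[leRHS]mul1e -[in leRHS](@divff _ v) ?gt_eqF// EFinM -muleA.
by rewrite lee_pmul2l// lte_fin.
Qed.

Lemma tube_avg_ge delta e a F c : enorm e = 1 -> 0 < delta < 1 -> 0 <= c ->
  measurable F -> (c%:E <= lebesgue_outer (F `&` tube delta e a))%E ->
  ((c / (2 * 4 ^+ m.+1 * delta ^+ m))%:E <= tube_avg delta \1_F e a)%E.
Proof.
move=> e1 d01 c0 mF h; have [v hv /andP[v1 v2]] := tube_volE a e1 d01.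
have v0 : 0 < v.
  rewrite (lt_le_trans _ v1)// mulr_gt0 ?exprn_gt0 ?divr_gt0 ?exprn_gt0//.
  by case/andP : d01.
rewrite (tube_avg_indic mF hv) ?gt_eqF//.
apply: (@le_trans _ _ (v^-1%:E * c%:E)%E); last first.
  by rewrite lee_pmul2l// lte_fin invr_gt0.
rewrite -EFinM lee_fin mulrC ler_wpM2r// lef_pV2 ?posrE//.
exact: lt_le_trans v2.
Qed.

End tube_averages.

(* No measurability is asked of [g]: the integral of a nonnegative function is the supremum of the
   integrals of the simple functions below it. *)
Lemma ge0_le_integral_nomeas {disp : measure_display} {T : measurableType disp} {R : realType}
    (mu : {measure set T -> \bar R}) (f g : T -> \bar R) :
  (forall x, (0 <= f x)%E) -> (forall x, (f x <= g x)%E) ->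
  (\int[mu]_x f x <= \int[mu]_x g x)%E.
Proof.
move=> f0 fg; have g0 x : (0 <= g x)%E by exact: le_trans (fg x).
rewrite !ge0_integralTE//; apply: ereal_sup_le => _ [k kf <-].
by exists k => // x; exact: le_trans (fg x).
Qed.

Lemma LnormE {disp : measure_display} {T : measurableType disp} {R : realType}
    (mu : {measure set T -> \bar R}) (p : R) (f : T -> \bar R) :
  Lnorm mu p%:E f = ((\int[mu]_x `|f x| `^ p) `^ p^-1)%E.
Proof. by rewrite unlock. Qed.

Lemma Lnorm_indic {disp : measure_display} {T : measurableType disp} {R : realType}
    (mu : {measure set T -> \bar R}) (p : R) (F : set T) : measurable F -> p != 0 ->
  Lnorm mu p%:E (EFin \o \1_F) = (mu F `^ p^-1)%E.
Proof.
move=> mF p0; rewrite LnormE (eq_integral (fun x => (\1_F x)%:E)).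
  by rewrite integral_indic// setIT.
move=> x _; change (`|(\1_F x)%:E| `^ p = (\1_F x)%:E)%E; rewrite abse_EFin poweR_EFin indicE.
by case: (x \in F); rewrite ?normr1 ?normr0 ?powR1 ?powR0.
Qed.

Lemma integral_sum_indic {disp : measure_display} {T : measurableType disp} {R : realType}
    (mu : {measure set T -> \bar R}) (I : finType) (P : pred I) (c : I -> R) (F : I -> set T) :
  (forall i, 0 <= c i) -> (forall i, measurable (F i)) ->
  (\int[mu]_x \sum_(i | P i) (c i * \1_(F i) x)%:E = \sum_(i | P i) (c i)%:E * mu (F i))%E.
Proof.
move=> c0 mF; have mI i : measurable_fun [set: T] (\1_(F i) : T -> R).
  by apply: measurable_indic; exact: mF.
under eq_integral do rewrite -big_filter.
rewrite ge0_integral_sum.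
- rewrite big_filter; apply: eq_bigr => i _.
  under eq_integral do rewrite EFinM.
  rewrite ge0_integralZl_EFin.
  + by rewrite integral_indic ?setIT.
  + exact: measurableT.
  + by move=> x _; rewrite lee_fin.
  + exact/measurable_EFinP.
  + exact: c0.
- exact: measurableT.
- by move=> i; apply/measurable_EFinP; exact: measurable_funM.
- by move=> i x _; rewrite lee_fin mulr_ge0.
Qed.

Lemma measurable_unit_sphere {R : realType} m :
  measurable (@unit_sphere R m.+1 : set (surfaceType R m.+1)).
Proof.
apply: (@le_caratheodory_measurable _ _ (@surface_outer R m.+1)) => X.
rewrite [X in (_ + X)%E](_ : _ = 0%E) ?adde0.
  by apply: (le_outer_measure (@surface_outer R m.+1)) => x [].
change (m.+1%:R%:E * lebesgue_outer (cone (X `&` ~` @unit_sphere R m.+1)) = 0)%E.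
rewrite (_ : cone _ = set0) ?outer_measure0 ?mule0//.
by rewrite -subset0 => x [t _ [e [[_ ne] ue] _]].
Qed.

Lemma surface_outerI_sphere {R : realType} m (X : set 'rV[R]_m) :
  surface_outer (X `&` @unit_sphere R m) = surface_outer X.
Proof.
congr (_ * lebesgue_outer _)%E; apply/seteqP;
  split => [_ [t t01 [e [[Xe ue] _] <-]]|_ [t t01 [e [Xe ue] <-]]];
by exists t => //; exists e.
Qed.

(** * The Kakeya estimate for finite families of tubes *)

Section discrete_kakeya.
Context {R : realType} (m : nat) (h q : R) (q_gt1 : 1 < q).
Hypothesis kakeya_bound : forall eps : R, 0 < eps -> exists C : R,
  forall (f : 'rV[R]_m.+1 -> R) (delta : R), L1loc f -> 0 < delta < 1 ->
   (Lnorm (@surface R m.+1) q%:E (kakeya_max delta f)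
      <= (C * delta `^ (- h - eps))%:E *
         Lnorm (@lebesgue R m.+1) q%:E (EFin \o f))%E.

Let q0 : 0 < q. Proof. by rewrite (lt_trans _ q_gt1). Qed.

(** The maximal estimate is tested on the indicator of [F]. The condition on all [w'] near [w i]
    bounds the maximal function below on a whole cap of radius [delta / 4]; the separation makes
    these caps disjoint, so the powers of the bounds add up. *)
Lemma discrete_kakeya eps : 0 < eps -> exists2 C : R, 0 < C &
  forall (delta : R) (I : finType) (P : pred I) (w b : I -> 'rV[R]_m.+1) (M : I -> R)
    (F : set 'rV[R]_m.+1) (V : R),
  0 < delta < 1 -> open F -> (lebesgue_outer F <= V%:E)%E ->
  (forall i, P i -> enorm (w i) = 1) -> (forall i, P i -> 0 <= M i) ->
  {in P &, forall i j, i != j -> delta <= enorm (w i - w j)} ->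
  (forall i w', P i -> enorm w' = 1 -> enorm (w' - w i) < delta / 4 ->
    ((M i * delta ^+ m.+1)%:E <= lebesgue_outer (F `&` tube delta w' (b i)))%E) ->
  \sum_(i | P i) (M i * delta) `^ q * delta ^+ m <= C * delta `^ (- (h + eps) * q) * V.
Proof.
move=> /kakeya_bound[C CP].
(* [C2] comes from the volume of a tube, [C3] from the area of a cap of radius [delta / 4]. *)
pose C2 : R := 2 * 4 ^+ m.+1; have C20 : 0 < C2 by rewrite mulr_gt0// exprn_gt0.
pose C3 : R := ((8 * m.+2%:R) ^+ m.+1)^-1 / 4 ^+ m.
have C30 : 0 < C3 by rewrite divr_gt0 ?invr_gt0 ?exprn_gt0// mulr_gt0.
exists ((`|C| + 1) `^ q * C2 `^ q / C3).
  by rewrite divr_gt0// mulr_gt0 ?powR_gt0// ltr_wpDl.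
move=> delta I P w b M F V d01 oF FV w1 M0 wsep tubeF.
have /andP[d0 d1] := d01.
have mF : measurable (F : set (lebesgueType R m.+1)) by exact: open_lebesgue_measurable.
have F0 : (0 <= lebesgue_outer F)%E by exact: (outer_measure_ge0 (@lebesgue_outer R m.+1)).
have Ffin : lebesgue_outer F \is a fin_num.
  by rewrite ge0_fin_numE// (le_lt_trans FV)// ltry.
have Md0 i : P i -> 0 <= M i * delta by move=> Pi; rewrite mulr_ge0 ?M0// ltW.
pose f : 'rV[R]_m.+1 -> R := \1_F.
have L1f : L1loc f.
  split=> [|K _]; first exact: measurable_indic.
  apply: (@le_lt_trans _ _ (\int[@lebesgue R m.+1]_x `|f x|%:E)%E).
    rewrite integral_mkcond; apply: ge0_le_integral_nomeas => x; rewrite patchE; case: ifP => // _.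
    by change (0 <= `|f x|%:E)%E; rewrite lee_fin.
  under eq_integral do rewrite ger0_norm//.
  rewrite integral_indic// setIT lebesgueE (le_lt_trans FV)// ltry//.
have := CP _ _ L1f d01; set D := _ * _ `^ _.
(* Nothing says that the given [C] is positive. *)
have D_le : D <= (`|C| + 1) * delta `^ (- h - eps).
  by rewrite ler_wpM2r ?powR_ge0// (le_trans (ler_norm _))// lerDl.
set D' := _ * _ in D_le.
have D'0 : 0 <= D' by rewrite mulr_ge0 ?powR_ge0// addr_ge0.
rewrite Lnorm_indic ?gt_eqF// LnormE lebesgueE.
set J := (\int[_]_x _)%E => hJ.
have J0 : (0 <= J)%E by apply: integral_ge0 => x _; exact: poweR_ge0.
have {}hJ : (J <= (D' `^ q * V)%:E)%E.
  have : ((J `^ q^-1) `^ q <= (D'%:E * lebesgue_outer F `^ q^-1) `^ q)%E.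
    apply: gt0_ler_poweR; first exact: ltW.
    - by rewrite in_itv/= poweR_ge0 leey.
    - by rewrite in_itv/= mule_ge0 ?poweR_ge0// leey.
    apply: (le_trans hJ); rewrite lee_wpmul2r ?poweR_ge0// lee_fin//.
  rewrite poweRM ?poweR_ge0// -!poweRrM mulVf ?gt_eqF// !poweRe1// poweR_EFin => /le_trans; apply.
  by rewrite EFinM lee_wpmul2l// lee_fin powR_ge0.
pose cap i : set (surfaceType R m.+1) := eball (w i) (delta / 4) `&` @unit_sphere R m.+1.
have mcap i : measurable (cap i).
  by apply: measurableI; [exact: measurable_cap|exact: measurable_unit_sphere].
pose c i := (M i * delta / C2) `^ q.
pose g (x : surfaceType R m.+1) : \bar R := (\sum_(i | P i) (c i * \1_(cap i) x)%:E)%E.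
have g0 x : (0 <= g x)%E.
  by apply: sume_ge0 => i _; rewrite lee_fin mulr_ge0// powR_ge0.
have cap_le x i : P i -> cap i x ->
    ((c i)%:E <= `|kakeya_max delta f x| `^ q)%E.
  move=> Pi [xi x1]; rewrite -poweR_EFin; apply: gt0_ler_poweR.
  - exact: ltW.
  - by rewrite in_itv/= leey andbT lee_fin divr_ge0 ?Md0// ltW.
  - by rewrite in_itv/= leey andbT.
  rewrite (le_trans _ (lee_abs _))//.
  apply: (@le_trans _ _ (tube_avg delta f x (b i))); last first.
    by apply: ereal_sup_ubound; exists (b i).
  have := tubeF i x Pi x1 xi => /tube_avg_ge; rewrite -/C2 => /(_ _ _ _ _)/(le_trans _);
    apply => //.
    rewrite lee_fin le_eqVlt; apply/orP; left; apply/eqP.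
    rewrite exprS; move: (delta ^+ m) (expf_neq0 m (lt0r_neq0 d0)) => u u0.
    by field; rewrite u0 gt_eqF.
  by rewrite mulr_ge0 ?M0// exprn_ge0// ltW.
have gJ : (\int[@surface R m.+1]_x g x <= J)%E.
  apply: ge0_le_integral_nomeas => // x.
  have [[i [Pi xi]]|nx] := pselect (exists i, P i /\ cap i x); last first.
    rewrite /g big1 ?poweR_ge0// => i Pi.
    rewrite indicE memNset ?mulr0// => xi; by apply: nx; exists i.
  rewrite /g (bigD1 i)//= [X in (_ + X)%E]big1 ?adde0.
    by rewrite indicE mem_set// mulr1 cap_le.
  move=> j /andP[Pj ji]; rewrite indicE memNset ?mulr0// => xj.
  have := wsep _ _ Pj Pi ji; apply/negP; rewrite -ltNge.
  rewrite (le_lt_trans (ler_enorm_dist x _ _))// enormB.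
  have h1 : enorm (x - w i) < delta / 4 := xi.1.
  have h2 : enorm (x - w j) < delta / 4 := xj.1.
  apply: (lt_trans (ltrD h2 h1)); lra.
have gint : (\int[@surface R m.+1]_x g x = \sum_(i | P i) (c i)%:E * surface_outer (cap i))%E.
  exact: integral_sum_indic (fun i => powR_ge0 _ _) mcap.
have : ((\sum_(i | P i) c i * (C3 * delta ^+ m))%:E <= (D' `^ q * V)%:E)%E.
  apply: le_trans hJ; apply: le_trans gJ; rewrite gint -sumEFin.
  apply: lee_sum => i Pi; rewrite EFinM lee_wpmul2l ?lee_fin ?powR_ge0//.
  rewrite surface_outerI_sphere.
  have := @surface_cap_ge R m (w i) (delta / 4) (w1 _ Pi); rewrite divr_gt0//.
  have -> : delta / 4 <= 1 by lra.
  move=> /(_ isT); apply: le_trans.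
  by rewrite lee_fin /C3 expr_div_n mulrCA mulrA mulrC mulrA.
rewrite lee_fin => H.
have -> : \sum_(i | P i) (M i * delta) `^ q * delta ^+ m =
    (C2 `^ q / C3) * \sum_(i | P i) c i * (C3 * delta ^+ m).
  rewrite mulr_sumr; apply: eq_bigr => i Pi; rewrite /c.
  rewrite [in LHS](_ : M i * delta = C2 * (M i * delta / C2)); last by field; exact: lt0r_neq0.
  rewrite powRM; [|exact: ltW|by rewrite divr_ge0 ?Md0// ltW].
  by field; exact: lt0r_neq0.
apply: (@le_trans _ _ (C2 `^ q / C3 * (D' `^ q * V))).
  by rewrite ler_wpM2l// divr_ge0 ?powR_ge0// ltW.
have -> : D' `^ q = (`|C| + 1) `^ q * delta `^ (- (h + eps) * q).
  by rewrite /D' powRM ?powR_ge0 ?addr_ge0// -[(delta `^ _) `^ q]powRrM opprD.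
by rewrite le_eqVlt; apply/orP; left; apply/eqP; ring.
Qed.

End discrete_kakeya.

Lemma card_fibers_le {R : realType} (I J : finType) (P : pred I) (f : I -> J) (B : R) :
  (forall j, #|[pred i | P i && (f i == j)]|%:R <= B) -> #|P|%:R <= #|J|%:R * B.
Proof.
move=> PB; rewrite -sum1_card natr_sum (eq_bigl P)//.
rewrite (partition_big f predT)//= -sumr_const_pred; apply: ler_sum => j _.
by rewrite sumr_const_pred mulr1 (le_trans _ (PB j))// ler_nat.
Qed.

(** * Separated directions *)

Section packing.
Context {R : realType}.

(** Rounding every coordinate to a grid of step [theta] is injective on a separated family. *)
Lemma card_separated_le (I K : finType) (P : pred I) (x : I -> K -> R) (c : K -> R) (r theta : R) :
  0 < theta -> 0 <= r -> (forall i k, P i -> `|x i k - c k| <= r) ->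
  (forall i j, P i -> P j -> i != j -> exists k, theta <= `|x i k - x j k|) ->
  #|P|%:R <= (2 * r / theta + 1) ^+ #|K|.
Proof.
move=> t0 r0 xr xsep; pose N := Num.truncn (2 * r / theta).
have /andP[N1 N2] : N%:R <= 2 * r / theta < N%:R + 1.
  by apply: truncn_bounds; rewrite divr_ge0 ?(ltW t0) ?mulr_ge0.
pose y i k := (x i k - c k + r) / theta.
have y0 i k : P i -> 0 <= y i k.
  by move=> Pi; rewrite divr_ge0 ?(ltW t0)//; have := xr i k Pi; rewrite ler_norml; lra.
have yN i k : P i -> (Num.truncn (y i k) < N.+1)%N.
  move=> Pi; rewrite ltnS; apply: le_truncn; rewrite ler_pM2r ?invr_gt0//.
  by have := xr i k Pi; rewrite ler_norml; lra.
pose f i : {ffun K -> 'I_N.+1} := [ffun k => inord (Num.truncn (y i k))].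
have f_inj : {in P &, injective f}.
  move=> i j Pi Pj fij; apply/eqP/negPn/negP => ij.
  have [k] := xsep i j Pi Pj ij; apply/negP; rewrite -ltNge.
  have /ffunP/(_ k) := fij; rewrite !ffunE => /(congr1 (@nat_of_ord _));
    rewrite !inordK ?yN// => yij.
  have /andP[a1 a2] := truncn_bounds (y0 i k Pi).
  have /andP[b1 b2] := truncn_bounds (y0 j k Pj).
  have -> : x i k - x j k = (y i k - y j k) * theta by rewrite /y; field; rewrite gt_eqF.
  rewrite normrM (gtr0_norm t0) gtr_pMl// ltr_norml; move: a1 a2 b1 b2; rewrite yij; lra.
apply: (@le_trans _ _ ((N%:R + 1) ^+ #|K|)).
  rewrite natr1 -natrX ler_nat -[N.+1]card_ord -card_ffun; exact: leq_card_in f_inj.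
by apply: lerXn2r; rewrite ?nnegrE ?lerD2r// addr_ge0// divr_ge0 ?(ltW t0) ?mulr_ge0.
Qed.

Lemma unit_argmax m (e : 'rV[R]_m.+1) : enorm e = 1 ->
  exists2 l, (forall k, `|e 0 k| <= `|e 0 l|) & 1 <= m.+1%:R * `|e 0 l|.
Proof.
move=> e1; pose l := [arg max_(i > ord0) `|e 0 i|]%O.
have lmax k : `|e 0 k| <= `|e 0 l| by rewrite /l; case: arg_maxP => // i _; exact.
by exists l => //; have := enorm_le (normr_ge0 _) lmax; rewrite e1.
Qed.

Lemma unit_coord_le1 m (e : 'rV[R]_m) k : enorm e = 1 -> `|e 0 k| <= 1.
Proof. by move=> <-; exact: coord_le_enorm. Qed.

(* A unit vector is determined, with Lipschitz control, by the position and the sign of a large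
   coordinate and by its other [m] coordinates. *)
Lemma sphere_packing m (I : finType) (P : pred I) (e : I -> 'rV[R]_m.+1) (v : 'rV[R]_m.+1)
    (r theta : R) :
  0 < theta -> 0 <= r -> (forall i, enorm (e i) = 1) ->
  (forall i k, P i -> `|e i 0 k - v 0 k| <= r) ->
  {in P &, forall i j, i != j -> theta <= enorm (e i - e j)} ->
  #|P|%:R <= 2 * m.+1%:R * (4 * m.+1%:R ^+ 3 * r / theta + 1) ^+ m.
Proof.
move=> t0 r0 e1 ev sep; pose n : R := m.+1%:R.
have n1 : 1 <= n by rewrite ler1n.
have n0 : 0 < n by rewrite (lt_le_trans _ n1).
have mn : m%:R <= n by rewrite ler_nat.
have /choice[l lP] i : exists l, (forall k, `|e i 0 k| <= `|e i 0 l|) /\ 1 <= n * `|e i 0 l|.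
  by have [l] := unit_argmax (e1 i); exists l.
have -> : 2 * m.+1%:R = #|{: 'I_m.+1 * bool}|%:R :> R.
  by rewrite card_prod card_ord card_bool natrM mulrC.
apply: (card_fibers_le (f := fun i => (l i, 0 <= e i 0 (l i)))) => -[l0 s0].
(* Recovering the coordinate [l0] from the others costs a factor [n ^ 2], and passing from
   coordinates to the Euclidean norm a factor [n]; the 2 makes the final inequality strict. *)
pose eta := theta / (2 * n ^+ 3).
have n30 : 0 < n ^+ 3 by rewrite exprn_gt0.
have eta0 : 0 < eta by rewrite divr_gt0// mulr_gt0.
rewrite (_ : 4 * _ * r / theta = 2 * r / eta); last first.
  by rewrite /eta -/n; field; rewrite !gt_eqF.
rewrite -[X in _ ^+ X]card_ord.
apply: (@card_separated_le _ _ _ (fun i k => e i 0 (lift l0 k)) (fun k => v 0 (lift l0 k))) => //.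
  by move=> i k /andP[Pi _]; exact: ev.
move=> i j /andP[Pi /eqP[li si]] /andP[Pj /eqP[lj sj]] ij.
apply: contrapT => nk; have := sep i j Pi Pj ij; apply/negP; rewrite -ltNge.
have small k : k != l0 -> `|e i 0 k - e j 0 k| <= eta.
  rewrite eq_sym => /unlift_some[k' -> _]; rewrite leNgt; apply/negP => h.
  by apply: nk; exists k'; exact: ltW.
have [_ ei0] := lP i; have [_ ej0] := lP j.
have sumE x : enorm x = 1 -> x 0 l0 ^+ 2 = 1 - \sum_(k < m.+1 | k != l0) x 0 k ^+ 2 :> R.
  by move=> x1; have := sqr_enorm x; rewrite x1 expr1n (bigD1 l0)//= => ->; rewrite addrK.
(* The two coordinates have the same sign and modulus at least [1 / n], so their sum has modulus at
   least [2 / n]; dividing the difference of squares, known from the other coordinates, by this sum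
   controls the difference. *)
have dl : `|e i 0 l0 - e j 0 l0| <= n ^+ 2 * eta.
  have h1 : (e i 0 l0 - e j 0 l0) * (e i 0 l0 + e j 0 l0) =
      \sum_(k < m.+1 | k != l0) (e j 0 k - e i 0 k) * (e j 0 k + e i 0 k).
    rewrite -subr_sqr !sumE//; set S1 := \sum_(k < _ | _) _; set S2 := \sum_(k < _ | _) _.
    transitivity (S2 - S1); first by ring.
    rewrite -sumrB.
    by apply: eq_bigr => k _; rewrite subr_sqr.
  have h2 : `|(e i 0 l0 - e j 0 l0) * (e i 0 l0 + e j 0 l0)| <= n * (2 * eta).
    rewrite h1 (le_trans (ler_norm_sum _ _ _))//.
    apply: (@le_trans _ _ (\sum_(k < m.+1 | k != l0) (2 * eta))).
      apply: ler_sum => k kl; rewrite normrM distrC mulrC.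
      rewrite ler_pM// ?small// (le_trans (ler_normD _ _))//.
      have := unit_coord_le1 k (e1 j); have := unit_coord_le1 k (e1 i); lra.
    rewrite sumr_const_pred; apply: ler_wpM2r; first by rewrite mulr_ge0 ?(ltW eta0).
    by rewrite ler_nat -[leqRHS]card_ord max_card.
  have h3 : 2 <= n * `|e i 0 l0 + e j 0 l0|.
    have -> : `|e i 0 l0 + e j 0 l0| = `|e i 0 l0| + `|e j 0 l0|.
      move: si sj; rewrite li lj; case: (s0).
        by move=> p1 p2; rewrite !ger0_norm// addr_ge0.
      move=> /negbT; rewrite -ltNge => p1 /negbT; rewrite -ltNge => p2.
      by rewrite !ltr0_norm ?opprD// -oppr_gt0 opprD addr_gt0// oppr_gt0.
    by move: ei0 ej0; rewrite li lj mulrDr; lra.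
  move: h2; rewrite normrM; set A := `|_ - _|; set B := `|_ + _| in h3 *.
  have A0 : 0 <= A by exact: normr_ge0.
  move: (A) (B) A0 h3 => a b a0 h3 h2.
  by have := ler_wpM2l a0 h3; have := ler_wpM2l (ltW n0) h2; nra.
apply: (@le_lt_trans _ _ (n * (n ^+ 2 * eta))).
  apply: enorm_le; first by rewrite mulr_ge0 ?(ltW eta0)// exprn_ge0// ltW.
  move=> k; rewrite !mxE; have [->//|kl] := eqVneq k l0.
  by rewrite (le_trans (small _ kl))// ler_peMl ?(ltW eta0)// exprn_ege1.
have -> : n * (n ^+ 2 * eta) = theta / 2 by rewrite /eta; field; rewrite gt_eqF.
lra.
Qed.

Lemma maximal_separated m (theta : R) (X : set 'rV[R]_m.+1) : 0 < theta ->
  (forall x, X x -> enorm x = 1) ->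
  exists N, exists e : 'I_N -> 'rV[R]_m.+1,
    [/\ forall i, X (e i), forall i j, i != j -> theta <= enorm (e i - e j) &
        forall x, X x -> exists i, enorm (x - e i) < theta].
Proof.
move=> t0 X1.
pose Q N := exists e : 'I_N -> 'rV[R]_m.+1,
  (forall i, X (e i)) /\ (forall i j, i != j -> theta <= enorm (e i - e j)).
have Q0 : exists N, `[< Q N >].
  by exists 0%N; apply/asboolP; exists (fun=> 0); split; case.
pose B := Num.truncn (2 * m.+1%:R * (4 * m.+1%:R ^+ 3 * 1 / theta + 1) ^+ m : R).
have QB N : `[< Q N >] -> (N <= B)%N.
  move=> /asboolP[e [eX esep]].
  have := @sphere_packing m 'I_N predT e 0 1 theta t0 ler01 (fun i => X1 _ (eX i)).
  rewrite card_ord truncn_ge_nat; last first.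
    by rewrite mulr_ge0// exprn_ge0// addr_ge0// divr_ge0 ?(ltW t0)// !mulr_ge0// exprn_ge0.
  apply => [i k _|i j _ _]; last exact: esep.
  by rewrite mxE subr0 unit_coord_le1// X1.
have [N /asboolP[e [eX esep]] Nmax] := ex_maxnP Q0 QB.
exists N, e; split => // x Xx; apply: contrapT => nx.
have xe i : theta <= enorm (x - e i).
  by rewrite leNgt; apply/negP => h; apply: nx; exists i.
suff : `[< Q N.+1 >] by move=> /Nmax; rewrite ltnn.
apply/asboolP; exists (fun i => oapp e x (unlift ord_max i)); split.
  by move=> i; case: unliftP => //= j _.
move=> i j; case: (unliftP ord_max i) => [i' ->|->]; case: (unliftP ord_max j) => [j' ->|->]/=.
- by rewrite (inj_eq lift_inj) => /esep.
- by move=> _; rewrite enormB.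
- by [].
- by rewrite eqxx.
Qed.

Lemma maximal_separated_sub d (I : finType) (P : pred I) (e : I -> 'rV[R]_d) (theta : R) :
  0 < theta ->
  exists Q : {set I}, [/\ {subset Q <= P}, {in Q &, forall i j, i != j -> theta <= enorm (e i - e j)} &
    forall i, P i -> exists2 j, j \in Q & enorm (e i - e j) < theta].
Proof.
move=> t0; pose ok (S : {set I}) := `[< {subset S <= P} /\
  {in S &, forall i j, i != j -> theta <= enorm (e i - e j)} >].
have ok0 : ok finset.set0 by apply/asboolP; split=> [i|i j]; rewrite inE.
pose Q := [arg max_(S > finset.set0 | ok S) #|S|].
have : ok Q /\ forall S, ok S -> (#|S| <= #|Q|)%N by rewrite /Q; case: arg_maxnP.
move=> [/asboolP[QP Qsep] Qmax]; exists Q; split => // i Pi.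
apply: contrapT => ni.
have ie j : j \in Q -> theta <= enorm (e i - e j).
  by move=> jQ; rewrite leNgt; apply/negP => h; apply: ni; exists j.
have iQ : i \notin Q by apply/negP => /ie; rewrite subrr enorm0 leNgt t0.
suff /Qmax : ok (i |: Q) by rewrite cardsU1 iQ add1n ltnn.
apply/asboolP; split=> [j|j k]; first by rewrite !inE => /orP[/eqP->//|/QP].
rewrite !inE => /orP[/eqP->|jQ] /orP[/eqP->|kQ]; rewrite ?eqxx//.
- by move=> _; exact: ie.
- by move=> _; rewrite enormB; exact: ie.
- exact: Qsep.
Qed.

(* If the tube meets a point [x] at distance about [rho] from its (approximate) centre [a0], then
   its direction is within [O(delta / rho)] of that of [x - a0], up to sign. *)
Lemma tube_overlap m (I : finType) (P : pred I) (e a : I -> 'rV[R]_m.+1) (a0 x : 'rV[R]_m.+1)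
    (delta rho theta : R) : 0 < theta -> 0 < delta -> 0 < rho ->
  (forall i, enorm (e i) = 1) -> {in P &, forall i j, i != j -> theta <= enorm (e i - e j)} ->
  (forall i, P i -> enorm (a i - a0) <= delta) -> (forall i, P i -> tube delta (e i) (a i) x) ->
  rho <= delta \/ rho / 2 <= enorm (x - a0) ->
  #|P|%:R <= 4 * m.+1%:R * (32 * m.+1%:R ^+ 3 * (delta / (rho * theta)) + 1) ^+ m.
Proof.
move=> t0 d0 rho0 e1 sep aa0 xP far.
pose r := 8 * delta / rho.
have r0 : 0 < r by rewrite divr_gt0// mulr_gt0.
set B := (_ + 1) ^+ m.
have BE : B = (4 * m.+1%:R ^+ 3 * r / theta + 1) ^+ m.
  by congr ((_ + 1) ^+ m); rewrite /r; field; rewrite !gt_eqF.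
have B0 : 0 <= B.
  rewrite BE exprn_ge0// addr_ge0// divr_ge0 ?(ltW t0)// mulr_ge0 ?(ltW r0)// mulr_ge0//.
have nB0 : 0 <= 2 * m.+1%:R * B by rewrite mulr_ge0.
suff [s Ps] : exists s : I -> bool, forall b, #|[pred i | P i && (s i == b)]|%:R <= 2 * m.+1%:R * B.
  have := card_fibers_le Ps; rewrite card_bool; lra.
case: far => [rd|far].
  exists (fun=> true) => b; rewrite BE; apply: (@sphere_packing _ _ _ _ 0) => //.
  - exact: ltW.
  - move=> i k _; rewrite mxE subr0 (le_trans (unit_coord_le1 _ (e1 i)))//.
    by rewrite ler_pdivlMr//; lra.
  - by move=> i j /andP[Pi _] /andP[Pj _]; exact: sep.
set u := x - a0 in far.
have u0 : 0 < enorm u by rewrite (lt_le_trans _ far)// divr_gt0.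
have main i : P i -> exists b : bool, enorm (e i - ((-1) ^+ b / enorm u) *: u) <= r.
  move=> Pi; have /tubeP[t t2 xt] := xP _ Pi.
  have ut : enorm (u - t *: e i) <= 2 * delta.
    have -> : u - t *: e i = (x - (a i + t *: e i)) + (a i - a0).
      by apply/rowP => k; rewrite !mxE; ring.
    by rewrite (le_trans (ler_enormD _ _))//; have := aa0 i Pi; lra.
  have tu : `|enorm u - `|t| | <= 2 * delta.
    have te : enorm (t *: e i) = `|t| by rewrite enormZ e1 mulr1.
    rewrite -te (le_trans _ ut)// ler_norml lerB_enorm andbT lerNl opprB.
    by rewrite [leRHS]enormB lerB_enorm.
  (* The sign of [t] tells whether [e i] is close to [u / |u|] or to its opposite; each sign class
     is packed separately. *)
  exists (t < 0); set sg := (-1) ^+ _.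
  have sgt : sg * t = `|t|.
    rewrite /sg; case: ltP => t0'; first by rewrite expr1 mulN1r ltr0_norm.
    by rewrite expr0 mul1r ger0_norm.
  have sg1 : `|sg| = 1 by rewrite /sg normrX normrN1 expr1n.
  have -> : e i - (sg / enorm u) *: u =
     ((enorm u - `|t|) / enorm u) *: e i + (- (sg / enorm u)) *: (u - t *: e i).
    rewrite -sgt; apply/rowP => k; rewrite !mxE; field; rewrite gt_eqF//.
  rewrite (le_trans (ler_enormD _ _))// !enormZ e1 mulr1 normrN !normrM sg1 mul1r.
  rewrite [ `|(enorm u)^-1| ]gtr0_norm ?invr_gt0// [leLHS](_ : _ = (`|enorm u - `|t| | + enorm (u - t *: e i)) / enorm u); last by ring.
  rewrite ler_pdivrMr// (@le_trans _ _ (4 * delta))//; first by lra.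
  rewrite /r mulrAC ler_pdivlMr//; nra.
have [s sP] : {s : I -> bool & forall i, P i -> enorm (e i - ((-1) ^+ s i / enorm u) *: u) <= r}.
  apply: (@choice _ _ (fun i b => P i -> enorm (e i - ((-1) ^+ (b : bool) / enorm u) *: u) <= r))
    => i.
  have [Pi|nPi] := boolP (P i); last by exists true.
  by have [b hb] := main i Pi; exists b.
exists s => b; rewrite BE.
apply: (@sphere_packing _ _ _ _ (((-1) ^+ b / enorm u) *: u)) => //.
- exact: ltW.
- move=> i k /andP[Pi /eqP si]; rewrite -si.
  by have := le_trans (coord_le_enorm _ k) (sP i Pi); rewrite !mxE.
- by move=> i j /andP[Pi _] /andP[Pj _]; exact: sep.
Qed.

End packing.

(** * Slices of a cone *)

Section drop_coordinate.
Context {R : realType} {k : nat}.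
Implicit Types (x y e U : 'rV[R]_k.+2) (j l : 'I_k.+2).

Lemma sqr_enorm_col' j x : enorm x ^+ 2 = x 0 j ^+ 2 + enorm (col' j x) ^+ 2.
Proof.
rewrite !sqr_enorm (bigD1_ord j)//=; congr (_ + _).
by apply: eq_bigr => i _; rewrite mxE.
Qed.

Lemma enorm_col'_le j x : enorm (col' j x) <= enorm x.
Proof.
rewrite -(ler_pXn2r (n := 2))// ?nnegrE ?enorm_ge0// (sqr_enorm_col' j x).
by rewrite lerDr sqr_ge0.
Qed.

Lemma enorm_le_col' j x : enorm x <= enorm (col' j x) + `|x 0 j|.
Proof.
rewrite -(ler_pXn2r (n := 2))// ?nnegrE ?addr_ge0 ?enorm_ge0// (sqr_enorm_col' j x).
rewrite sqrrD real_normK ?num_real// addrC lerD2r lerDl.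
by rewrite mulrn_wge0// mulr_ge0// enorm_ge0.
Qed.

Lemma coord_le_enorm_col' j l x : l != j -> `|x 0 l| <= enorm (col' j x).
Proof.
rewrite eq_sym => /unlift_some[i -> _].
by rewrite (_ : x 0 _ = col' j x 0 i) ?coord_le_enorm// mxE.
Qed.

(* [e / |col' j e|] has the coordinates of the normalized [col' j e] and, in position [j],
   [e_j / e_l] times the one in position [l]. *)
Lemma drop_coordinate_sep j l e e' (delta : R) : 0 < delta ->
  enorm e = 1 -> enorm e' = 1 -> l != j ->
  e 0 l != 0 -> e' 0 l != 0 -> `|e 0 j| <= `|e 0 l| -> `|e' 0 j| <= `|e' 0 l| ->
  `|e 0 j / e 0 l - e' 0 j / e' 0 l| <= delta ->
  6 * delta <= enorm (e - e') ->
  delta <= enorm ((enorm (col' j e))^-1 *: col' j e - (enorm (col' j e'))^-1 *: col' j e').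
Proof.
move=> d0 e1 e1' lj el el' ejl ejl' tau; rewrite leNgt => /negP sep.
rewrite leNgt; apply/negP => h; apply: sep.
have N0 x : x 0 l != 0 -> 0 < enorm (col' j x).
  by move=> xl; rewrite (lt_le_trans _ (coord_le_enorm_col' x lj))// normr_gt0.
set N := enorm (col' j e) in h *; set N' := enorm (col' j e') in h *.
have N_gt0 : 0 < N by exact: N0.
have N'_gt0 : 0 < N' by exact: N0.
have N_le1 : N <= 1 by rewrite -e1 enorm_col'_le.
pose v := N^-1 *: e; pose v' := N'^-1 *: e'.
have col_v : col' j (v - v') = N^-1 *: col' j e - N'^-1 *: col' j e'.
  by apply/rowP => i; rewrite !mxE.
have vl : `|v 0 l - v' 0 l| < delta.
  have := le_lt_trans (coord_le_enorm_col' (v - v') lj) (eq_ind_r (fun z => enorm z < delta)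
    h col_v).
  by rewrite !mxE.
have tau1 : `|e 0 j / e 0 l| <= 1 by rewrite normrM normfV ler_pdivrMr ?normr_gt0// mul1r.
have vl'1 : `|v' 0 l| <= 1.
  rewrite mxE normrM gtr0_norm ?invr_gt0// mulrC ler_pdivrMr// mul1r.
  exact: coord_le_enorm_col'.
have vj : `|v 0 j - v' 0 j| <= 2 * delta.
  have -> : v 0 j - v' 0 j = e 0 j / e 0 l * (v 0 l - v' 0 l) +
      (e 0 j / e 0 l - e' 0 j / e' 0 l) * v' 0 l.
    by rewrite !mxE; field; rewrite el el' !gt_eqF.
  rewrite (le_trans (ler_normD _ _))// !normrM.
  have h1 : `|e 0 j / e 0 l| * `|v 0 l - v' 0 l| <= delta.
    by rewrite -[leRHS]mul1r ler_pM// ltW.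
  have h2 : `|e 0 j / e 0 l - e' 0 j / e' 0 l| * `|v' 0 l| <= delta.
    by rewrite -[leRHS]mulr1 ler_pM.
  move: h1; rewrite normrM => h1; lra.
have vv : enorm (v - v') < 3 * delta.
  rewrite (le_lt_trans (enorm_le_col' j _))// col_v.
  have -> : (v - v') 0 j = v 0 j - v' 0 j by rewrite !mxE.
  lra.
have ve : enorm v = N^-1 by rewrite enormZ e1 mulr1 gtr0_norm// invr_gt0.
have ve' : enorm v' = N'^-1 by rewrite enormZ e1' mulr1 gtr0_norm// invr_gt0.
have NN : `|(N - N') / N'| <= enorm (v - v').
  have -> : (N - N') / N' = N * (enorm v' - enorm v) by rewrite ve ve'; field; rewrite !gt_eqF.
  rewrite normrM (gtr0_norm N_gt0) -[leRHS]mul1r ler_pM ?(ltW N_gt0)//.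
  by rewrite ler_norml lerNl opprB lerB_enorm enormB lerB_enorm.
have -> : e - e' = N *: (v - v') + ((N - N') / N') *: e'.
  by apply/rowP => i; rewrite !mxE; field; rewrite !gt_eqF.
rewrite (le_lt_trans (ler_enormD _ _))// !enormZ e1' mulr1 (gtr0_norm N_gt0).
have : N * enorm (v - v') <= enorm (v - v') by rewrite ler_piMl ?enorm_ge0.
lra.
Qed.

(** The line through [b] of direction [e] meets [x_l = 0] in the point with coordinates
    [b_i - e_i / e_l * b_l]. Taking [l] where [e] is largest keeps all slopes at most 1; taking [j]
    where this point is largest makes one coordinate control the distance of the line from the
    origin. *)
Lemma unit_pivot e (b : 'rV[R]_k.+2) : enorm e = 1 -> exists l j,
  [/\ l != j, 1 <= k.+2%:R * `|e 0 l|, forall i, `|e 0 i| <= `|e 0 l| &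
   forall i, `|b 0 i - e 0 i / e 0 l * b 0 l| <= `|b 0 j - e 0 j / e 0 l * b 0 l|].
Proof.
move=> e1; have [l lmax ln] := unit_argmax e1.
have l0 : e 0 l != 0.
  by apply/eqP => h; move: ln; rewrite h normr0 mulr0 ler10.
pose L i := `|b 0 i - e 0 i / e 0 l * b 0 l|.
have LL : L l = 0 by rewrite /L divff// mul1r subrr normr0.
pose j := [arg max_(i > lift l ord0 | i != l) L i]%O.
have [jl jmax] : j != l /\ forall i, i != l -> L i <= L j.
  by rewrite /j; case: arg_maxP => [|i il imax]; [rewrite eq_sym neq_lift|].
exists l, j; split=> // [|i]; first by rewrite eq_sym.
have [->|/jmax//] := eqVneq i l; by rewrite -/(L l) LL.
Qed.

End drop_coordinate.

(** Index 0 collects everything below [c] and carries no lower bound: it will hold the offsets too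
    small to be normalised and the innermost ball of a bush. *)
Lemma dyadic_scale {R : realType} (K : nat) (c y : R) : y < 2 ^+ K * c ->
  exists2 mc : 'I_K.+1, y < 2 ^+ mc * c & (mc : nat) = 0 \/ 2 ^+ mc * c / 2 <= y.
Proof.
move=> yK.
have ex : exists i, y < 2 ^+ i * c by exists K.
have mK : (ex_minn ex < K.+1)%N by rewrite ltnS; case: ex_minnP => i _; exact.
exists (Ordinal mK) => /=; case: ex_minnP => // -[|i] _ imin; first by left.
right; rewrite leNgt; apply/negP => h.
have /imin : y < 2 ^+ i * c.
  by move: h; rewrite exprS (_ : 2 * 2 ^+ i * c / 2 = 2 ^+ i * c)//; field.
by rewrite ltnn.
Qed.

Section slices.
Context {R : realType} {k : nat}.
Variables (delta rho d ell tau tau0 t : R) (mc0 : bool) (e1 U : 'rV[R]_k.+2) (j l : 'I_k.+2).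

(* [U] is a point of a line of direction [e] with [tau = e_j / e_l], close to the point [t e1] of
   a ray of the bush (with vertex 0), and [tau0] is the discretized slope. As [ell] is constant
   along the line and nearly [t * Lam], dilating by [gam], which brings [ell] to [d / 4], sends
   [U] near [kap0 e1], whatever [ell] is. In the degenerate case [mc0], [ell] is too small to be
   normalised. *)
Record slice : Prop := Slice {
  slice_delta_gt0 : 0 < delta;
  slice_rho_ge : delta <= rho;
  slice_rho_le : rho <= 6;
  slice_unit : enorm e1 = 1;
  slice_t_le : `|t| <= 3 * rho;
  slice_dist : enorm (U - t *: e1) <= 7 * delta;
  slice_tau_le1 : `|tau| <= 1;
  slice_tau_tau0 : `|tau - tau0| <= delta;
  slice_ell : ell = U 0 j - tau * U 0 l;
  slice_ell_lt : `|ell| < d;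
  slice_d : if mc0 then d = 64 * delta else (128 * delta <= d) && (d / 2 <= `|ell|) }.

Let Lam := e1 0 j - tau0 * e1 0 l.
Let gam := if mc0 then 4^-1 else d / (4 * ell).
Let kap0 := if mc0 then 0 else d / (4 * Lam).

Lemma slice_gt0 : slice -> [/\ 0 < rho, 0 < d & 64 * delta <= d].
Proof.
move=> [d0 rd _ _ _ _ _ _ _ _]; have r0 : 0 < rho by lra.
by case: mc0 => [->|/andP[h _]]; split => //; lra.
Qed.

Lemma slice_coord_dist i : slice -> `|U 0 i - t * e1 0 i| <= 7 * delta.
Proof. by move=> [_ _ _ _ _ Ut *]; have := le_trans (coord_le_enorm _ i) Ut; rewrite !mxE. Qed.

(** Replacing [U] by [t *: e1] in the linear form [x_j - tau x_l] costs [14 * delta], and replacing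
    [tau] by [tau0] costs [18 * delta], as [|t| <= 18]. *)
Lemma slice_ell_dist : slice -> `|ell - t * Lam| <= 32 * delta.
Proof.
move=> S; have Uti i := slice_coord_dist i S.
case: S => d0 rho_ge rho_le e1_unit t_le _ tau_le1 tau_tau0 ellE _ _.
have -> : ell - t * Lam = (U 0 j - t * e1 0 j) - tau * (U 0 l - t * e1 0 l)
    - t * (tau - tau0) * e1 0 l by rewrite ellE /Lam; ring.
rewrite (le_trans (ler_normB _ _))//.
have h1 : `|U 0 j - t * e1 0 j - tau * (U 0 l - t * e1 0 l)| <= 14 * delta.
  rewrite (le_trans (ler_normB _ _))// normrM.
  have : `|tau| * `|U 0 l - t * e1 0 l| <= 1 * (7 * delta) by rewrite ler_pM.
  have := Uti j; lra.
have h2 : `|t * (tau - tau0) * e1 0 l| <= 18 * delta.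
  rewrite !normrM -[leRHS]mulr1 ler_pM ?mulr_ge0 ?(unit_coord_le1 _ e1_unit)//.
  rewrite ler_pM// (le_trans t_le)//; lra.
lra.
Qed.

(** The lower bound will keep the projected samples apart; the upper one halves the error
    [7 * delta], so that the points of [slice_center] fit into balls of radius [5 * delta]. *)
Lemma slice_scale_bounds : slice -> 4^-1 <= `|gam| <= 2^-1.
Proof.
move=> S; have [rho0 dpos dg] := slice_gt0 S.
case: S => d0 _ _ _ _ _ _ _ _ ell_lt d_def.
rewrite /gam; move: d_def; case: mc0 => [_|/andP[_ h]].
  by rewrite gtr0_norm//; lra.
have el0 : 0 < `|ell| by rewrite (lt_le_trans _ h)// divr_gt0.
rewrite normrM normfV normrM (gtr0_norm dpos) (gtr0_norm (_ : 0 < 4))//.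
rewrite ler_pdivlMr ?mulr_gt0// ler_pdivrMr ?mulr_gt0//; lra.
Qed.

(** The difference is [d / 4] times [(t Lam - ell) / (ell Lam)]. The numerator is [O(delta)], [ell]
    is about [d], and [Lam] is at least [d / (12 * rho)] because [|t| <= 3 * rho]. *)
Lemma slice_kap_bound : slice -> `|gam * t - kap0| <= 192 * delta * rho / d.
Proof.
move=> S; have [rho0 dpos dg] := slice_gt0 S; have ell_Lam := slice_ell_dist S.
case: S => d0 rho_ge rho_le e1_unit t_le _ tau_le1 tau_tau0 ellE ell_lt d_def; move: d_def.
rewrite /gam /kap0; case: mc0 => [dE|/andP[d1 h]].
  rewrite subr0 normrM (gtr0_norm (_ : 0 < 4^-1))// dE.
  rewrite (_ : 192 * delta * rho / (64 * delta) = 3 * rho); last by field; rewrite gt_eqF.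
  lra.
have el0 : 0 < `|ell| by rewrite (lt_le_trans _ h)// divr_gt0.
(* The error [32 * delta] is at most [d / 4]: this is why the nondegenerate case asks for
   [128 * delta <= d]. *)
have tLam : d / 4 <= `|t * Lam|.
  have := lerB_dist ell (ell - t * Lam); rewrite opprB addrCA subrr addr0; lra.
have Lam_ge : d <= 12 * rho * `|Lam|.
  have : `|t| * `|Lam| <= 3 * rho * `|Lam| by rewrite ler_wpM2r.
  move: tLam; rewrite normrM; lra.
have Lam0 : 0 < `|Lam|.
  rewrite normr_gt0; apply/eqP => h0; move: Lam_ge; rewrite h0 normr0 mulr0; lra.
have -> : d / (4 * ell) * t - d / (4 * Lam) = (d / 4) * ((t * Lam - ell) / (ell * Lam)).
  by field; rewrite -normr_gt0 Lam0 -normr_gt0.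
rewrite normrM (gtr0_norm (_ : 0 < d / 4)) ?divr_gt0// normrM normfV normrM distrC.
rewrite -(ler_pM2r el0) -(ler_pM2r Lam0).
rewrite [leLHS](_ : _ = (d / 4) * `|ell - t * Lam|); last by field; rewrite !gt_eqF.
apply: (@le_trans _ _ (d / 4 * (32 * delta))).
  by rewrite ler_pM2l ?divr_gt0.
rewrite -(ler_pM2r dpos) [leRHS](_ : _ = 16 * delta * `|ell| * (12 * rho * `|Lam|)); last by field;
  rewrite gt_eqF.
rewrite [leLHS](_ : _ = 16 * delta * (d / 2) * d); last by field.
by rewrite ler_pM ?mulr_ge0 ?(ltW d0) ?(ltW dpos)// ler_wpM2l// mulr_ge0// ltW.
Qed.

(* The point [gam * col' j U] of the projected slice lies near the line of direction [col' j e1], on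
   the piece of length [O(delta * rho / d)] around [kap0 * col' j e1]. *)
Lemma slice_center (W : nat) : slice -> 192 * rho / d + 1 <= W%:R ->
  exists sig : 'I_W.*2.+1,
    enorm (gam *: col' j U - (kap0 + (sig%:R - W%:R) * delta) *: col' j e1) <= 9 / 2 * delta.
Proof.
move=> S WP; have [rho0 dpos dg] := slice_gt0 S; have kap_bound := slice_kap_bound S.
have gam_bounds := slice_scale_bounds S.
case: S => d0 _ _ e1_unit _ Ut _ _ _ _ _.
pose y := (gam * t - kap0) / delta + W%:R.
have yb : `|(gam * t - kap0) / delta| <= 192 * rho / d.
  rewrite normrM normfV (gtr0_norm d0) ler_pdivrMr//.
  by rewrite (_ : _ * delta = 192 * delta * rho / d) ?kap_bound//; ring.
have y0 : 0 <= y by move: yb; rewrite /y ler_norml; lra.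
have y2 : y < 2 * W%:R by move: yb; rewrite /y ler_norml; lra.
have /andP[s1 s2] := truncn_bounds y0.
have sW : (Num.truncn y < W.*2.+1)%N.
  by rewrite ltnS -(ler_nat R) -mul2n natrM; lra.
exists (Ordinal sW) => /=; set s := (Num.truncn y)%:R in s1 s2 *.
have -> : gam *: col' j U - (kap0 + (s - W%:R) * delta) *: col' j e1 =
  gam *: col' j (U - t *: e1) + ((y - s) * delta) *: col' j e1.
  by apply/rowP => i; rewrite !mxE /y; field; rewrite gt_eqF.
rewrite (le_trans (ler_enormD _ _))// !enormZ.
have g1 : `|gam| * enorm (col' j (U - t *: e1)) <= 2^-1 * (7 * delta).
  rewrite ler_pM ?enorm_ge0//; first by case/andP: gam_bounds.
  exact: le_trans (enorm_col'_le _ _) Ut.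
have g2 : `|(y - s) * delta| * enorm (col' j e1) <= delta * 1.
  rewrite ler_pM ?enorm_ge0//; last by rewrite -e1_unit enorm_col'_le.
  rewrite normrM (gtr0_norm d0) ger0_norm; last by lra.
  by rewrite ler_piMl ?(ltW d0)//; lra.
lra.
Qed.

Section incidence.
Variables (e u : 'rV[R]_k.+2).
Let n : R := k.+2%:R.

(** With the vertex at 0, [u] is a point of the bush close both to the sample [U] on the axis of a
    tube of direction [e] and to the point [t *: e1] of a ray. *)
Record incident : Prop := Incident {
  incident_slice : slice;
  incident_t : enorm (u - t *: e1) <= 5 * delta;
  incident_U : enorm (u - U) <= 2 * delta;
  incident_le : enorm u < rho;
  incident_ge : rho <= delta \/ rho / 2 <= enorm u;
  incident_unit : enorm e = 1;
  incident_l : 1 <= n * `|e 0 l|;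
  incident_max : forall i, `|U 0 i - e 0 i / e 0 l * U 0 l| <= `|ell| }.

Lemma slice_d_le : incident -> d <= 64 * rho.
Proof.
move=> [S _ uU u_le _ _ _ _]; have [rho0 dpos dg] := slice_gt0 S.
case: S => d0 rho_ge _ _ _ _ tau_le1 _ ellE _ d_def.
have Ui i : `|U 0 i| <= 3 * rho.
  rewrite (le_trans (coord_le_enorm _ _))//.
  have := ler_enormB u (u - U); rewrite opprB addrCA subrr addr0; lra.
have el : `|ell| <= 6 * rho.
  rewrite ellE (le_trans (ler_normB _ _))// normrM.
  have : `|tau| * `|U 0 l| <= 1 * (3 * rho) by rewrite ler_pM.
  have := Ui j; lra.
move: d_def; case: mc0 => [->|/andP[_ h]]; lra.
Qed.

(** If [d] is much smaller than [rho], then [|t|] is comparable to [rho], and [t Lam] close to [ell]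
    forces [Lam = O(d / rho)]. Moreover [U] is within [n * d] of a multiple of [e], so its [l]-th
    coordinate is comparable to [rho], and the same holds for [t *: e1]. *)
Lemma slice_cond : incident -> rho <= 200 * n * d \/
  (`|Lam| <= 8 * d / rho /\ (48 * n)^-1 <= `|e1 0 l|).
Proof.
move=> [S u_t uU u_le far e_unit e_l ell_max].
have [rho0 dpos dg] := slice_gt0 S; have elL := slice_ell_dist S.
have Uti := slice_coord_dist l S.
case: S => d0 _ _ e1_unit t_le _ _ _ _ ell_lt _.
have n2 : 2 <= n by rewrite /n ler_nat.
have [|drho] := lerP rho (200 * n * d); first by left.
right; have n0 : 0 < n by lra.
have nd : 2 * d <= n * d by rewrite ler_pM2r.
have far' : rho / 2 <= enorm u by case: far => // h; lra.
have te : enorm (t *: e1) = `|t| by rewrite enormZ e1_unit mulr1.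
have t_ge : rho / 4 <= `|t|.
  have := lerB_enorm u (u - t *: e1); rewrite opprB addrCA subrr addr0 te; lra.
split.
  have h1 : `|t * Lam| <= 2 * d.
    have := ler_normB ell (ell - t * Lam); rewrite opprB addrCA subrr addr0; lra.
  rewrite ler_pdivlMr //.
  have : rho / 4 * `|Lam| <= `|t| * `|Lam| by rewrite ler_wpM2r.
  move: h1; rewrite normrM; lra.
have el0 : e 0 l != 0.
  by apply/eqP => h; move: e_l; rewrite h normr0 mulr0 ler10.
have U_ge : rho / 4 <= enorm U.
  have := lerB_enorm u (u - U); rewrite opprB addrCA subrr addr0; lra.
have UU : enorm (U - (U 0 l / e 0 l) *: e) <= n * d.
  apply: enorm_le; first exact: ltW.
  move=> i; rewrite !mxE (_ : U 0 l / e 0 l * e 0 i = e 0 i / e 0 l * U 0 l); last by ring.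
  exact: le_trans (ell_max i) (ltW ell_lt).
have Ul : rho / 8 <= n * `|U 0 l|.
  have h1 : enorm U <= n * d + `|U 0 l / e 0 l|.
    have := ler_enormD (U - (U 0 l / e 0 l) *: e) ((U 0 l / e 0 l) *: e).
    by rewrite subrK enormZ e_unit mulr1; lra.
  have h2 : `|U 0 l / e 0 l| <= n * `|U 0 l|.
    rewrite normrM normfV ler_pdivrMr ?normr_gt0//.
    by rewrite mulrAC ler_peMl.
  lra.
have h3 : n * `|U 0 l| <= n * (`|t| * `|e1 0 l| + 7 * delta).
  rewrite ler_pM2l// -normrM; have := Uti.
  have := ler_normD (U 0 l - t * e1 0 l) (t * e1 0 l); rewrite subrK; lra.
have h4 : `|t| * `|e1 0 l| <= 3 * rho * `|e1 0 l| by rewrite ler_wpM2r.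
have h5 : n * (`|t| * `|e1 0 l|) <= n * (3 * rho * `|e1 0 l|) by rewrite ler_pM2l.
have h6 : n * (64 * delta) <= n * d by rewrite ler_pM2l.
have h7 : rho * 1 <= rho * (48 * n * `|e1 0 l|).
  by nra.
move: h7; rewrite ler_pM2l // => h7.
by rewrite -div1r ler_pdivrMr ?mulr_gt0// mulrC.
Qed.

End incidence.
End slices.

Section cells.
Context {R : realType} {k : nat}.
Let n : R := k.+2%:R.

(** The conclusion of [slice_cond]: a necessary condition for the ray of [e1] to matter in the slope
    cell of [tau0]. *)
Definition cell_cond (delta rho d : R) (e1 : 'rV[R]_k.+2) (j l : 'I_k.+2) (tau0 : R) : Prop :=
  rho <= 200 * n * d \/
  (`|e1 0 j - tau0 * e1 0 l| <= 8 * d / rho /\ (48 * n)^-1 <= `|e1 0 l|).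

(** As [tau0] runs through steps of [delta], [tau0 * e1 0 l] moves by at least [delta / (48 * n)],
    while it must stay in an interval of length [O(d / rho)]. This count balances the [O(rho / d)]
    positions of [slice_center]. *)
Lemma card_cells (delta rho d : R) (e1 : 'rV[R]_k.+2) (j l : 'I_k.+2) (T : nat) :
  0 < delta < 1 -> 0 < rho <= 6 -> 64 * delta <= d -> T%:R <= 2 / delta ->
  #|[pred kap : 'I_T.+1 | `[< cell_cond delta rho d e1 j l (kap%:R * delta - 1) >]]|%:R
    <= 1000 * n * (d / (rho * delta)).
Proof.
move=> /andP[d0 d1] /andP[r0 r6] dd Tle.
have n0 : 0 < n by rewrite ltr0n.
have rd0 : 0 < rho * delta by rewrite mulr_gt0.
have [h|h] := lerP rho (200 * n * d).
  apply: (@le_trans _ _ T.+1%:R); first by rewrite ler_nat -[leqRHS]card_ord max_card.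
  rewrite -natr1; apply: (@le_trans _ _ (3 / delta)).
    have : 1 <= 1 / delta by rewrite ler_pdivlMr// mul1r ltW.
    lra.
  rewrite ler_pdivrMr// [leRHS](_ : _ = 1000 * n * d / rho); last by field; rewrite !gt_eqF.
  rewrite ler_pdivlMr//; nra.
have rhs0 : 0 <= 1000 * n * (d / (rho * delta)).
  apply: mulr_ge0; first by apply: mulr_ge0; [exact: ler0n|exact: ltW].
  by apply: divr_ge0; [lra|exact: ltW].
have [e1l|e1l] := ltP `|e1 0 l| (48 * n)^-1.
  rewrite eq_card0// => kap; rewrite !inE; apply/asboolP => -[|[_]].
    by rewrite leNgt h.
  by rewrite leNgt e1l.
have x1 : 1 <= d / (rho * delta) by rewrite ler_pdivlMr// mul1r; nra.
apply: (@le_trans _ _ (2 * (8 * d / rho) / (delta / (48 * n)) + 1)).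
  rewrite -[leRHS]expr1 -[X in _ ^+ X]card_unit.
  apply: (@card_separated_le R 'I_T.+1 unit [pred kap : 'I_T.+1 | `[< cell_cond delta rho d e1 j l (kap%:R * delta - 1) >]]
    (fun kap _ => kap%:R * delta * e1 0 l) (fun=> e1 0 j + e1 0 l)).
  - by rewrite divr_gt0// mulr_gt0.
  - by rewrite divr_ge0 ?(ltW r0)// mulr_ge0//; lra.
  - move=> kap _ /asboolP[|[h1 _]]; first by rewrite leNgt h.
    by rewrite distrC (le_trans _ h1)// le_eqVlt; apply/orP; left; apply/eqP; congr `|_|; ring.
  - move=> i1 i2 _ _ i12; exists tt.
    rewrite -mulrBl -mulrBl normrM normrM (gtr0_norm d0) -mulrA.
    rewrite -[leLHS]mul1r ler_pM ?divr_ge0 ?mulr_ge0 ?(ltW d0) ?(ltW n0)//.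
      wlog ji : i1 i2 i12 / (i2 < i1)%N.
        move=> Wl; have := i12; rewrite -(inj_eq val_inj) neq_ltn => /orP[hh|hh].
          by rewrite distrC Wl// eq_sym.
        exact: Wl.
      by rewrite -natrB 1?ltnW// normr_nat ler1n subn_gt0.
    by rewrite ler_pM2l.
have -> : 2 * (8 * d / rho) / (delta / (48 * n)) = 768 * n * (d / (rho * delta)).
  by field; rewrite !gt_eqF.
have : 1 <= n by rewrite ler1n.
nra.
Qed.

End cells.

(** * Tubes meeting a bush *)

Section key_estimate.
Context {R : realType} (k : nat) (h q : R) (q_gt1 : 1 < q).
Hypothesis kakeya_bound : forall eps : R, 0 < eps -> exists C : R,
  forall (f : 'rV[R]_k.+1 -> R) (delta : R), L1loc f -> 0 < delta < 1 ->
   (Lnorm (@surface R k.+1) q%:E (kakeya_max delta f)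
      <= (C * delta `^ (- h - eps))%:E *
         Lnorm (@lebesgue R k.+1) q%:E (EFin \o f))%E.
Let n : R := k.+2%:R.

(* Points of a tube are discretized at the integers [s - L] times [delta]. *)
Definition position N L (s : 'I_N) : R := s%:R - L%:R.

Definition active (delta : R) (N L : nat) (a e : 'rV[R]_k.+2) (X : set 'rV[R]_k.+2) (s : 'I_N)
  : Prop :=
  `|position L s * delta| <= 2^-1 /\
  exists2 x, X x & enorm (x - (a + (position L s * delta) *: e)) < 2 * delta.

Definition hits delta N L a e X : nat := #|[pred s : 'I_N | `[< active delta L a e X s >]]|.

Lemma hits_gt0 delta N L a e X :
  (0 < hits delta N L a e X)%N -> exists s : 'I_N, active delta L a e X s.
Proof. by rewrite /hits => /card_gt0P[s] /asboolP sact; exists s. Qed.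

Lemma position_sep N L (s s' : 'I_N) : s != s' -> 1 <= `|position L s - position L s'|.
Proof.
move=> ss; rewrite /position opprB addrA subrK.
wlog ji : s s' ss / (s' < s)%N.
  move=> Wl; have := ss; rewrite -(inj_eq val_inj) neq_ltn => /orP[hh|hh].
    by rewrite distrC Wl// eq_sym.
  exact: Wl.
by rewrite -natrB 1?ltnW// normr_nat ler1n subn_gt0.
Qed.

(** The tubes are sorted by pivots [l], [j], by the scale of their offset and by slope cell. In one
    cell the projected directions stay [delta]-separated by [drop_coordinate_sep], which is the
    origin of [6 * delta], and [discrete_kakeya] applies with one set [F kp]. The centres [a i] may
    be anywhere: only [X] is tied to [a0]. *)
Lemma key_estimate eps : 0 < eps -> exists2 C : R, 0 < C &
  forall (delta rho : R) (K N L : nat) (I : finType) (e a : I -> 'rV[R]_k.+2) (a0 : 'rV[R]_k.+2)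
    (Q : {set I}) (X : set 'rV[R]_k.+2),
  0 < delta < 1 -> delta <= rho <= 6 -> 3 <= 2 ^+ K * delta ->
  (forall i, enorm (e i) = 1) -> (forall i j, i != j -> 6 * delta <= enorm (e i - e j)) ->
  (forall x, X x -> enorm (x - a0) < rho) ->
  (forall x, X x -> rho <= delta \/ rho / 2 <= enorm (x - a0)) ->
  (forall x, X x -> exists j t,
     [/\ j \in Q, `|t| <= 3 * rho & enorm (x - a0 - t *: e j) <= 5 * delta]) ->
  \sum_i ((hits delta N L (a i) (e i) X)%:R * delta) `^ q
    <= C * K.+1%:R * delta `^ (- (h + eps) * q) * #|Q|%:R.
Proof.
move=> /(discrete_kakeya q_gt1 kakeya_bound)[C C0 DK].
have n0 : 0 < n by rewrite ltr0n.
have n1 : 1 <= n by rewrite ler1n.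
(* [c4 * delta ^+ k.+1] is the volume that [lebesgue_pack_ge] grants to one ball of radius
   [delta / (8 * n)]. *)
pose c4 : R := (8 * n ^+ 2)^-1 ^+ k.+1.
have c40 : 0 < c4 by rewrite exprn_gt0// invr_gt0 mulr_gt0// exprn_gt0.
(* The constants are hidden behind variables. 704 = 2 * 192 + 5 * 64 bounds the number of positions
   along a ray, 1000 is that of [card_cells], and [t10] comes from boxes of side [10 * delta]. *)
have [s7 s7_gt0 s7E] : exists2 x : R, 0 < x & x = 704 by exists 704; rewrite ?ltr0n.
have [m3 m3_gt0 m3E] : exists2 x : R, 0 < x & x = 1000 by exists 1000; rewrite ?ltr0n.
have [t10 t10_gt0 t10E] : exists2 x : R, 0 < x & x = 10 ^+ k.+1.
  by exists (10 ^+ k.+1) => //; rewrite exprn_gt0// ltr0n.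
exists (C * (t10 * (s7 * m3) * n) * n ^+ 2 / c4 `^ q).
  by rewrite divr_gt0 ?powR_gt0// !mulr_gt0// exprn_gt0.
move=> delta rho K N L I e a a0 Q X d01 /andP[rho_ge rho_le] K3 e1 esep X_lt X_ge X_near.
have /andP[d0 d1] := d01; have rho0 : 0 < rho := lt_le_trans d0 rho_ge.
have q0 : 0 < q by rewrite (lt_trans _ q_gt1).
pose M i := hits delta N L (a i) (e i) X.
pose b i := a i - a0.
pose U i (s : 'I_N) := b i + (position L s * delta) *: e i.
pose ell i (l j : 'I_k.+2) := b i 0 j - e i 0 j / e i 0 l * b i 0 l.
have ellU i l j s : e i 0 l != 0 -> U i s 0 j - e i 0 j / e i 0 l * U i s 0 l = ell i l j.
  by move=> el0; rewrite !mxE /ell /b !mxE; field.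
have XU i s x : enorm (x - (a i + (position L s * delta) *: e i)) < 2 * delta ->
    enorm (x - a0 - U i s) <= 2 * delta.
  move=> /ltW; congr (_ <= _); congr enorm; apply/rowP => z; rewrite !mxE; ring.
pose good i (c : 'I_k.+2 * 'I_k.+2 * 'I_K.+1) := let: (l, j, mc) := c in
  [/\ l != j, 1 <= n * `|e i 0 l|, forall z, `|e i 0 z| <= `|e i 0 l|,
    forall z, `|ell i l z| <= `|ell i l j| &
    `|ell i l j| < 2 ^+ mc * (64 * delta) /\ ((mc : nat) = 0 \/ 2 ^+ mc * (64 * delta)
      / 2 <= `|ell i l j|)].
have /choice[c cP] i : exists c, (0 < M i)%N -> good i c.
  (* Tubes without active sample get a dummy class; they add 0 to the sum. *)
  have [M0|] := ltnP 0 (M i); last by exists (ord0, ord0, ord0).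
  have [s sact] : exists s : 'I_N, active delta L (a i) (e i) X s.
    exact: hits_gt0 M0.
  have [l [j [lj el emax bmax]]] := unit_pivot (b i) (e1 i).
  have el0 : e i 0 l != 0.
    by apply/eqP => hh; move: el; rewrite hh normr0 mulr0 ler10.
  have [_ [x Xx /XU xU]] := sact.
  have Uz z : `|U i s 0 z| <= 8.
    rewrite (le_trans (coord_le_enorm _ _))//.
    have := ler_enormB (x - a0) (x - a0 - U i s); rewrite opprB addrCA subrr addr0.
    have := X_lt _ Xx; lra.
  have ell16 : `|ell i l j| < 2 ^+ K * (64 * delta).
    apply: (@le_lt_trans _ _ 16); last by lra.
    rewrite -(ellU i l j s el0) (le_trans (ler_normB _ _))// normrM.
    have : `|e i 0 j / e i 0 l| * `|U i s 0 l| <= 1 * 8.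
      by rewrite ler_pM// normrM normfV ler_pdivrMr ?normr_gt0// mul1r.
    have := Uz j; lra.
  have [mc mc1 mc2] := dyadic_scale ell16.
  by exists (l, j, mc) => _; split.
suff class_bound c0 : \sum_(i | (0 < M i)%N && (c i == c0)) ((M i)%:R * delta) `^ q
    <= C * (t10 * (s7 * m3) * n) / c4 `^ q * delta `^ (- (h + eps) * q) * #|Q|%:R.
  rewrite (bigID (fun i => (0 < M i)%N))/= [X in _ + X]big1 ?addr0; last first.
    by move=> i; rewrite -eqn0Ngt /M => /eqP->; rewrite mul0r powR0// gt_eqF.
  rewrite (partition_big c predT)//=.
  apply: (le_trans (ler_sum _ (fun c0 _ => class_bound c0))).
  rewrite sumr_const_pred (@eq_card _ _ predT)// cardT -cardE !card_prod !card_ord !natrM.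
  rewrite le_eqVlt; apply/orP; left; apply/eqP; rewrite -/n.
  by field; rewrite gt_eqF ?powR_gt0.
case: c0 => -[l j] mc.
pose Pc i := (0 < M i)%N && (c i == (l, j, mc)).
have Pc_good i : Pc i -> good i (l, j, mc).
  by move=> /andP[M0 /eqP <-]; exact: cP.
have [[i0 Pi0]|nP] := pselect (exists i, Pc i); last first.
  rewrite big1 => [|i Pi]; last by exfalso; apply: nP; exists i.
  by rewrite !mulr_ge0 ?powR_ge0 ?invr_ge0 ?powR_ge0 ?(ltW C0) ?(ltW n0) ?(ltW s7_gt0)
    ?(ltW m3_gt0) ?(ltW t10_gt0).
pose d : R := 2 ^+ mc * (64 * delta); pose mc0 := (mc == 0 :> nat)%N.
pose tau i := e i 0 j / e i 0 l.
(* The slopes lie in [-1, 1], which is cut into cells of length [delta]; [tau0] is the left end of a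
   cell. *)
pose T := Num.truncn (2 / delta).
have /andP[T1 T2] : T%:R <= 2 / delta < T%:R + 1 by apply: truncn_bounds; rewrite divr_ge0// ltW.
have tau1 i : Pc i -> `|tau i| <= 1.
  move=> /Pc_good[_ el emax _ _].
  have el0 : e i 0 l != 0.
    by apply/eqP => hh; move: el; rewrite hh normr0 mulr0 ler10.
  by rewrite normrM normfV ler_pdivrMr ?normr_gt0// mul1r.
have tau_ge0 i : Pc i -> 0 <= (tau i + 1) / delta.
  by move=> /tau1; rewrite ler_norml => /andP[hh _]; rewrite divr_ge0 ?(ltW d0)//; lra.
have kapT i : Pc i -> (Num.truncn ((tau i + 1) / delta) < T.+1)%N.
  move=> /tau1; rewrite ler_norml => /andP[_ hh]; rewrite ltnS; apply: le_truncn.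
  by rewrite ler_pM2r ?invr_gt0//; clear -hh q_gt1 kakeya_bound; lra.
pose kap i : 'I_T.+1 := inord (Num.truncn ((tau i + 1) / delta)).
pose tau0 (kp : 'I_T.+1) : R := kp%:R * delta - 1.
have tau_cell i : Pc i -> 0 <= tau i - tau0 (kap i) <= delta.
  move=> Pi; have /andP[] := truncn_bounds (tau_ge0 i Pi).
  rewrite /tau0 /kap inordK ?kapT//; rewrite ler_pdivlMr// ltr_pdivrMr//.
  by move=> h1 h2; clear -h1 h2 q_gt1 kakeya_bound; apply/andP; lra.
pose gam i := if mc0 then 4^-1 else d / (4 * ell i l j).
pose kap0 j1 kp := if mc0 then 0 else d / (4 * (e j1 0 j - tau0 kp * e j1 0 l)).
have inc i s : Pc i -> active delta L (a i) (e i) X s -> exists j1 t u, j1 \in Q /\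
   incident delta rho d (ell i l j) (tau i) (tau0 (kap i)) t mc0 (e j1) (U i s) j l (e i) u.
  move=> Pi [_ [x Xx /XU xU]]; have [j1 [t [j1Q t_le xt]]] := X_near x Xx.
  have [lj el emax bmax [ell_lt ell_ge]] := Pc_good i Pi.
  have el0 : e i 0 l != 0.
    by apply/eqP => hh; move: el; rewrite hh normr0 mulr0 ler10.
  exists j1, t, (x - a0); split => //; split => //.
  - split => //.
    + have -> : U i s - t *: e j1 = (x - a0 - t *: e j1) - (x - a0 - U i s).
        by apply/rowP => z; rewrite !mxE; ring.
      by rewrite (le_trans (ler_enormB _ _))//; clear -xt xU q_gt1 kakeya_bound; lra.
    + exact: tau1.
    + by have /andP[h1 h2] := tau_cell i Pi; rewrite ger0_norm.
    + by rewrite ellU.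
    + rewrite /mc0 /d; case: eqP => [->|mcn]; first by rewrite expr0 mul1r.
      case: ell_ge => [//|->]; rewrite andbT.
      have : 2 <= 2 ^+ mc :> R.
        have -> : (mc : nat) = mc.-1.+1 by rewrite prednK// lt0n; apply/eqP.
        by rewrite exprS ler_peMr// exprn_ege1// ler1n.
      rewrite -(ler_pM2r (mulr_gt0 (ltr0n _ 64) d0)) => h2; clear -h2 q_gt1 kakeya_bound; lra.
  - exact: X_lt.
  - exact: X_ge.
  - by move=> z; rewrite ellU.
have d_le : d <= 64 * rho.
  have /andP[/hits_gt0[s sact] _] := Pi0.
  by have [j1 [t [u [_ ii]]]] := inc i0 s Pi0 sact; exact: slice_d_le ii.
have d_ge : 64 * delta <= d.
  by rewrite /d ler_peMl ?mulr_ge0 ?(ltW d0)// exprn_ege1// ler1n.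
have dpos : 0 < d by rewrite (lt_le_trans _ d_ge)// mulr_gt0.
pose W := (Num.truncn (192 * rho / d)).+2.
have W0 : 0 <= 192 * rho / d :=
  divr_ge0 (mulr_ge0 (ler0n R 192) (ltW rho0)) (ltW dpos).
have /andP[W1 W2] := truncn_bounds W0.
have WE : W%:R = (Num.truncn (192 * rho / d))%:R + 2 :> R by rewrite /W -addn2 natrD.
have W_ge : 192 * rho / d + 1 <= W%:R by rewrite WE; clear -W2 q_gt1 kakeya_bound; lra.
have dblE (x : nat) : x.*2.+1%:R = 2 * x%:R + 1 :> R by rewrite -natr1 -mul2n natrM.
have S_le : W.*2.+1%:R <= s7 * (rho / d).
  have : 1 <= 64 * (rho / d) by rewrite mulrA ler_pdivlMr// mul1r.
  by move=> h1; rewrite dblE s7E WE; clear -h1 W1 q_gt1 kakeya_bound; lra.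
pose center (p : I * 'I_W.*2.+1) kp : 'rV[R]_k.+1 :=
  (kap0 p.1 kp + (p.2%:R - W%:R) * delta) *: col' j (e p.1).
pose okp kp (p : I * 'I_W.*2.+1) :=
  (p.1 \in Q) && `[< cell_cond delta rho d (e p.1) j l (tau0 kp) >].
(* The centres involve the rays and the slope cell, but no individual tube. *)
pose F kp := \bigcup_(p in [set p | okp kp p]) eball (center p kp) (5 * delta).
pose V kp : R := #|okp kp|%:R * (10 * delta) ^+ k.+1.
have FV kp : (lebesgue_outer (F kp) <= (V kp)%:E)%E.
  rewrite /V (_ : 10 * delta = 2 * (5 * delta)); last by ring.
  apply: (@lebesgue_cover_le _ _ _ (okp kp) (center^~ kp)); first by rewrite mulr_ge0// ltW.
  by move=> x [p /= pok xp]; exists p.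
have oF kp : open (F kp) by apply: bigcup_open => p _; exact: open_eball.
pose w i := (enorm (col' j (e i)))^-1 *: col' j (e i).
pose beta i := gam i *: col' j (b i).
have Nge i : Pc i -> n^-1 <= enorm (col' j (e i)).
  move=> /Pc_good[lj el _ _ _].
  by rewrite (le_trans _ (coord_le_enorm_col' (e i) lj))// -div1r ler_pdivrMr// mulrC.
have N_gt0 i : Pc i -> 0 < enorm (col' j (e i)).
  by move=> /Nge; apply: lt_le_trans; rewrite invr_gt0.
have gam_b i : Pc i -> 4^-1 <= `|gam i| <= 2^-1.
  move=> Pi; have /andP[/hits_gt0[s sact] _] := Pi.
  by have [j1 [t [u [_ ii]]]] := inc i s Pi sact; exact: slice_scale_bounds (incident_slice ii).
have DKk kp : \sum_(i | Pc i && (kap i == kp)) (c4 * (M i)%:R * delta) `^ q * delta ^+ k <=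
    C * delta `^ (- (h + eps) * q) * V kp.
  apply: (DK delta I _ w beta (fun i => c4 * (M i)%:R) (F kp)) => //.
  - move=> i /andP[Pi _]; rewrite enormZ gtr0_norm ?invr_gt0 ?N_gt0// mulVf// gt_eqF// N_gt0//.
  - by move=> i _; rewrite mulr_ge0// ltW.
  - move=> i i' /andP[Pi /eqP ki] /andP[Pi' /eqP ki'] ii'.
    have [lj el emax _ _] := Pc_good i Pi; have [_ el' emax' _ _] := Pc_good i' Pi'.
    apply: (drop_coordinate_sep (l := l)) => //; last exact: esep.
    + by apply/eqP => hh; move: el; rewrite hh normr0 mulr0 ler10.
    + by apply/eqP => hh; move: el'; rewrite hh normr0 mulr0 ler10.
    + have := tau_cell i Pi; have := tau_cell i' Pi'; rewrite ki ki' -/(tau i) -/(tau i').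
      rewrite ler_norml => /andP[h1 h2] /andP[h3 h4]; clear -h1 h2 h3 h4 q_gt1 kakeya_bound.
      by apply/andP; lra.
  move=> i w' /andP[Pi /eqP ki] w'1 ww'.
  pose y s := gam i *: col' j (U i s).
  have Nle : enorm (col' j (e i)) <= 1 by rewrite -(e1 i) enorm_col'_le.
  have /andP[g1 g2] := gam_b i Pi.
  (* Consecutive projected samples are at least [delta / (4 * n)] apart: 1/4 from [gam] and [1 / n]
     from the projected direction. So balls of radius [r] around them are disjoint. *)
  pose r := delta / (8 * n).
  have r0 : 0 < r by rewrite divr_gt0// mulr_gt0.
  have r16 : r <= delta / 8 by rewrite /r invfM mulrA ler_piMr ?divr_ge0 ?(ltW d0)// invf_le1.
  have -> : c4 * (M i)%:R * delta ^+ k.+1 = (M i)%:R * (r / k.+2%:R) ^+ k.+1.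
    rewrite mulrAC mulrC /c4 -exprMn; congr (_ * _ ^+ _); rewrite /r -/n; field.
    by rewrite gt_eqF.
  apply: (@lebesgue_pack_ge _ _ _ [pred s | `[< active delta L (a i) (e i) X s >]] y) => //.
    move=> s s' _ _ ss'.
    have -> : y s - y s' = (gam i * ((position L s - position L s') * delta)) *: col' j (e i).
      by apply/rowP => z; rewrite !mxE; ring.
    rewrite enormZ !normrM (gtr0_norm d0).
    have -> : 2 * r = 4^-1 * (1 * delta) * n^-1 by rewrite /r; field; rewrite gt_eqF.
    rewrite ler_pM ?mulr_ge0 ?invr_ge0 ?(ltW d0) ?(ltW n0) ?Nge//.
    rewrite ler_pM ?mulr_ge0 ?(ltW d0)// ler_pM2r// position_sep//.
  move=> s /asboolP sact z zy; split.
    have [j1 [t [u [j1Q ii]]]] := inc i s Pi sact.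
    have [sg hsg] := slice_center (incident_slice ii) W_ge.
    exists (j1, sg) => /=.
      rewrite /okp j1Q; apply/asboolP; rewrite -ki; exact: slice_cond ii.
    rewrite /eball/= (le_lt_trans (ler_enorm_dist (y s) _ _))//.
    apply: (@lt_le_trans _ _ (r + 9 / 2 * delta)); last by clear -r16 d0 q_gt1 kakeya_bound; lra.
    apply: ltr_leD => //; rewrite /center /kap0/= -ki; exact: hsg.
  (* The parameter of the sample along the normalised projected axis; dilation and projection only
     shrink it. *)
  pose tt := gam i * (position L s * delta) * enorm (col' j (e i)).
  have tt1 : `|tt| <= 4^-1.
    rewrite /tt normrM (normrM (gam i)) (ger0_norm (enorm_ge0 _)) -[leRHS]mulr1.
    have -> : 4^-1 = 2^-1 * 2^-1 :> R by field.
    apply: ler_pM; rewrite ?mulr_ge0 ?enorm_ge0//.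
    by apply: ler_pM => //; case: sact.
  apply/tubeP; exists tt; first by rewrite (le_trans tt1)// lef_pV2 ?posrE// ler_nat.
  have -> : z - (beta i + tt *: w') = (z - y s) + tt *: (w i - w').
    by apply/rowP => x; rewrite !mxE /tt; field; rewrite gt_eqF// N_gt0.
  rewrite (le_lt_trans (ler_enormD _ _))// enormZ.
  have : `|tt| * enorm (w i - w') <= 4^-1 * (delta / 4).
    by rewrite ler_pM ?enorm_ge0// enormB ltW.
  have zy' : enorm (z - y s) < r := zy.
  by clear -zy' r16 d0 q_gt1 kakeya_bound; lra.
(* Summing over slopes first, each ray is counted [O(rho / d)] times [O(d / (rho * delta))], which
   leaves one factor [1 / delta]. *)
have sumV : \sum_kp V kp <= (t10 * (s7 * m3) * n) * #|Q|%:R * delta ^+ k.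
  rewrite -mulr_suml.
  have -> : \sum_kp #|okp kp|%:R = \sum_(p : I * 'I_W.*2.+1 | p.1 \in Q)
     #|[pred kp : 'I_T.+1 | `[< cell_cond delta rho d (e p.1) j l (kp%:R * delta - 1) >]]|%:R :> R.
    under eq_bigr do rewrite -sum1_card natr_sum big_mkcond.
    rewrite exchange_big [RHS]big_mkcond; apply: eq_bigr => p _.
    rewrite -sum1_card natr_sum [in RHS]big_mkcond/=.
    case: (boolP (p.1 \in Q)) => pQ; last first.
      by rewrite big1// => kp _; rewrite unfold_in /okp (negbTE pQ).
    by apply: eq_bigr => kp _; rewrite unfold_in /okp pQ/= inE.
  have cB p : #|[pred kp : 'I_T.+1 | `[< cell_cond delta rho d (e p) j l (kp%:R * delta - 1) >]]|%:R
      <= m3 * n * (d / (rho * delta)).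
    by rewrite m3E; apply: card_cells => //; rewrite rho0.
  apply: (@le_trans _ _ ((\sum_(p : I * 'I_W.*2.+1 | p.1 \in Q) m3 * n * (d / (rho * delta)))
     * (10 * delta) ^+ k.+1)).
    apply: ler_wpM2r; first by rewrite exprn_ge0// mulr_ge0// ltW.
    by apply: ler_sum => p _; exact: cB.
  have cardQ : #|(fun p : I * 'I_W.*2.+1 => p.1 \in Q)| = (#|Q| * W.*2.+1)%N.
    rewrite -[W.*2.+1 in RHS]card_ord -cardX; apply: eq_card => p.
    by rewrite !unfold_in/= andbT.
  rewrite sumr_const_pred cardQ natrM.
  rewrite exprMn [delta ^+ k.+1]exprS -t10E.
  set Qn := #|Q|%:R; set dk := delta ^+ k.
  have Qn0 : 0 <= Qn by rewrite ler0n.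
  have dk0 : 0 <= dk by rewrite exprn_ge0// ltW.
  rewrite [leLHS](_ : _ = W.*2.+1%:R * (d / rho) * (m3 * n * Qn * t10 * dk)); last first.
    by field; rewrite !gt_eqF.
  rewrite [leRHS](_ : _ = s7 * (m3 * n * Qn * t10 * dk)); last by ring.
  apply: ler_wpM2r; first by rewrite !mulr_ge0// ltW.
  apply: (@le_trans _ _ (s7 * (rho / d) * (d / rho))).
    by rewrite ler_wpM2r// divr_ge0// ltW.
  by rewrite le_eqVlt; apply/orP; left; apply/eqP; field; rewrite !gt_eqF.
have dk0 : 0 < delta ^+ k by rewrite exprn_gt0.
have c4q0 : 0 < c4 `^ q by rewrite powR_gt0.
rewrite -(ler_pM2r dk0) -(ler_pM2l c4q0).
rewrite [leRHS](_ : _ = C * delta `^ (- (h + eps) * q) * ((t10 * (s7 * m3) * n)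
  * #|Q|%:R * delta ^+ k)); last first.
  by field; rewrite gt_eqF.
apply: (@le_trans _ _ (\sum_kp C * delta `^ (- (h + eps) * q) * V kp)); last first.
  by rewrite -mulr_sumr ler_wpM2l// mulr_ge0 ?powR_ge0// ltW.
rewrite (partition_big kap predT)//= mulr_suml mulr_sumr; apply: ler_sum => kp _.
apply: le_trans (DKk kp); rewrite mulr_suml mulr_sumr; apply: ler_sum => i _.
have -> : c4 * (M i)%:R * delta = c4 * ((M i)%:R * delta) by rewrite mulrA.
by rewrite [(c4 * _) `^ q]powRM ?mulr_ge0 ?(ltW c40) ?(ltW d0)// mulrA.
Qed.

End key_estimate.

(** * Real powers and covering numbers *)

Section real_powers.
Context {R : realType}.
Implicit Types (x y a q delta : R).

Lemma powR_split x q : 0 < x -> x `^ q = x * x `^ (q - 1).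
Proof.
move=> x0; rewrite -{2}(powRr1 (ltW x0)) -powRD; first by rewrite addrC subrK.
by rewrite (gt_eqF x0) implybT.
Qed.

Lemma powRMp x y q : 0 < x -> 0 < y -> (x * y) `^ q = x `^ q * y `^ q.
Proof. by move=> x0 y0; rewrite powRM// ltW. Qed.

Lemma powRVp x q : 0 < x -> (x^-1) `^ q = (x `^ q)^-1.
Proof. by move=> x0; rewrite -powR_inv1 ?(ltW x0)// -powRrM mulN1r powRN. Qed.

Lemma ler_powR_base x y q : 0 <= q -> 0 <= x -> x <= y -> x `^ q <= y `^ q.
Proof.
move=> q0 x0 xy; apply: ge0_ler_powR => //; rewrite nnegrE//; exact: le_trans xy.
Qed.

Lemma powRN_le delta x y : 0 < delta < 1 -> x <= y -> delta `^ (- x) <= delta `^ (- y).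
Proof.
move=> /andP[d0 d1] xy; rewrite /powR gt_eqF// ler_expR ler_wnM2r ?lerN2//.
by rewrite ln_le0// ltW.
Qed.

Lemma powRN_ge1 delta x : 0 < delta < 1 -> 0 <= x -> 1 <= delta `^ (- x).
Proof. by move=> d01 x0; rewrite -[leLHS](powRr0 delta) -oppr0 powRN_le. Qed.

(* [x <= tau + x^q tau^(1-q)] with [tau = B / (2 D)]; a substitute for Hoelder's inequality. *)
Lemma sum_powR_ge (I : finType) (x : I -> R) (B S q : R) : 1 < q -> (forall i, 0 <= x i) ->
  0 < B -> B <= \sum_i x i -> \sum_i x i `^ q <= S ->
  B `^ q <= 2 `^ q * #|I|%:R `^ (q - 1) * S.
Proof.
move=> q1 x0 B0 Bx xS; pose D : R := #|I|%:R.
have D0 : 0 < D.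
  rewrite ltr0n; apply/card_gt0P; apply: contrapT => nI.
  move: Bx; rewrite big1 ?leNgt ?B0// => i _; by exfalso; apply: nI; exists i.
pose tau := B / (2 * D); have tau0 : 0 < tau by rewrite divr_gt0// mulr_gt0.
have tq0 : 0 < tau `^ (q - 1) by rewrite powR_gt0.
have step i : x i <= tau + x i `^ q / tau `^ (q - 1).
  have [xt|tx] := lerP (x i) tau; first by rewrite (le_trans xt)// lerDl divr_ge0 ?powR_ge0.
  have xi0 : 0 < x i by exact: lt_trans tx.
  rewrite (le_trans _ (_ : x i `^ q / tau `^ (q - 1) <= _)) ?lerDr ?(ltW tau0)//.
  rewrite (powR_split q xi0) ler_pdivlMr// ler_pM2l// ler_powR_base ?(ltW tau0) ?(ltW tx)//.
  by rewrite subr_ge0 ltW.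
have h : B / 2 <= S / tau `^ (q - 1).
  have : B <= D * tau + S / tau `^ (q - 1).
    apply: (le_trans Bx); apply: (le_trans (ler_sum _ (fun i _ => step i))).
    rewrite big_split/= sumr_const_pred (@eq_card _ _ predT)// lerD2l -mulr_suml.
    by rewrite ler_wpM2r// invr_ge0 ltW.
  rewrite (_ : D * tau = B / 2); last by rewrite /tau; field; rewrite gt_eqF.
  lra.
move: h; rewrite ler_pdivlMr// => h.
have -> : B `^ q = 2 `^ q * D `^ (q - 1) * (B / 2 * tau `^ (q - 1)).
  rewrite (powR_split q B0) (@powR_split 2)//.
  have BE : B = (2 * D) * tau by rewrite /tau; field; rewrite gt_eqF.
  rewrite [in LHS]BE -{1}BE powRM ?(ltW tau0) ?mulr_ge0 ?(ltW D0)//.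
  rewrite [(2 * D) `^ _]powRM ?(ltW D0)//; by field.
by rewrite ler_wpM2l// mulr_ge0 ?powR_ge0.
Qed.

Lemma dyadic_exponent eps : 0 < eps :> R -> exists2 C : R, 0 < C &
  forall delta, 0 < delta < 1 -> exists K : nat,
    3 <= 2 ^+ K * delta <= 6 /\ K.+1%:R <= C * delta `^ (- eps).
Proof.
move=> eps0; have l2 : 0 < ln 2 :> R by rewrite ln_gt0// ltr1n.
exists (1 + 6 `^ eps / (eps * ln 2)).
  by rewrite ltr_wpDr// divr_ge0 ?powR_ge0// mulr_ge0 ?ltW.
move=> delta d01; have /andP[d0 d1] := d01.
pose T := Num.truncn (3 / delta).
have T1 : 3 / delta < T.+1%:R by exact: truncnS_gt.
have ex : exists K : nat, 3 <= 2 ^+ K * delta.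
  exists T.+1; rewrite -ler_pdivrMr// ltW// (lt_trans T1)//.
  by rewrite -natrX ltr_nat ltn_expl.
have [K K3 Kmin] := ex_minnP ex; exists K.
have K0 : (0 < K)%N.
  by case: K K3 {Kmin} => //; rewrite expr0 mul1r; lra.
have K6 : 2 ^+ K * delta < 6.
  rewrite -(prednK K0) exprS -mulrA.
  have : 2 ^+ K.-1 * delta < 3.
    by rewrite ltNge; apply/negP => /Kmin; rewrite leqNgt prednK// leqnn.
  lra.
split; first by rewrite K3 ltW.
have d1' : 1 <= delta `^ (- eps) by rewrite powRN_ge1// ltW.
have h : K%:R * (eps * ln 2) <= 6 `^ eps * delta `^ (- eps).
  apply: (@le_trans _ _ ((2 ^+ K) `^ eps)).
    rewrite -powR_mulrn// -powRrM /powR ifF; last by apply/negbTE; rewrite pnatr_eq0.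
    apply: le_trans (expR_ge1Dx _).
    by rewrite mulrA lerDr.
  rewrite powRN ler_pdivlMr ?powR_gt0// -powRM ?exprn_ge0 ?(ltW d0)//.
  by rewrite ler_powR_base ?(ltW eps0) ?(ltW K6)// mulr_ge0 ?exprn_ge0 ?(ltW d0).
rewrite -natr1 mulrDl mul1r addrC lerD// mulrAC ler_pdivlMr// mulr_gt0//.
Qed.

(** The upper limit only speaks of [delta < eta]. For the other [delta] the cover at the fixed scale
    [e1] is also a cover at scale [delta], and its cardinality goes into the constant. *)
Lemma box_dim_cover d (A : set 'rV[R]_d) (s eps : R) : 0 <= s -> (upper_box_dim A <= s%:E)%E ->
  0 < eps -> exists2 C : R, 0 < C & forall delta, 0 < delta < 1 ->
  exists N : nat, exists2 U : 'I_N -> set 'rV[R]_d,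
    (forall i (x y : 'rV[R]_d), U i x -> U i y -> enorm (x - y) <= delta) /\ A `<=` \bigcup_i U i &
    N%:R <= C * delta `^ (- (s + eps)).
Proof.
move=> s0 Adim eps0.
have small (c delta : R) : (covering_number A delta < c%:E)%E ->
    exists N : nat, exists2 U : 'I_N -> set 'rV[R]_d,
    (forall i (x y : 'rV[R]_d), U i x -> U i y -> enorm (x - y) <= delta) /\ A `<=` \bigcup_i U i &
    N%:R <= c.
  by move=> /ereal_inf_lt[_ [N [U UP] <-]]; rewrite lte_fin => /ltW; exists N, U.
have : (upper_box_dim A < (s + eps)%:E)%E by rewrite (le_lt_trans Adim)// lte_fin ltrDl.
move=> /ereal_inf_lt[_ [V V0 <-]] Vsup.
have [eta eta0 etaV] : exists2 eta, 0 < eta & forall delta, 0 < delta < eta -> V delta.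
  move: V0 => /nbhs_ballP[eta /= eta0 etaV]; exists eta => // delta /andP[d0 d1].
  by apply: etaV => //; rewrite -ball_normE/= sub0r normrN gtr0_norm.
have main delta : 0 < delta < 1 -> delta < eta ->
    (covering_number A delta <= (delta `^ (- (s + eps)))%:E)%E.
  move=> /andP[d0 d1] de.
  have y0 : 0 < - ln delta by rewrite oppr_gt0 ln_lt0// d0.
  have : (lne (covering_number A delta) * ((- ln delta)^-1)%:E <= (s + eps)%:E)%E.
    apply: le_trans (ltW Vsup); apply: ereal_sup_ubound; exists delta => //.
    by apply: etaV; rewrite d0.
  rewrite muleC -lee_pdivlMl ?invr_gt0// invrK -EFinM.
  case: (covering_number A delta) => [r| |]//=; last by rewrite !leNye.
  have [r0 _|r0] := lerP r 0.
    by rewrite lee_fin (le_trans r0)// powR_ge0.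
  rewrite !lee_fin /powR gt_eqF// mulNr -mulrN mulrC => h.
  by rewrite -[leLHS](lnK r0) ler_expR.
pose e1 := Num.min eta 1 / 2.
have e10 : 0 < e1 by rewrite divr_gt0// lt_min eta0 ltr01.
have e1e : e1 < eta by rewrite /e1 ltr_pdivrMr// minElt; case: ifP => h; move: eta0; lra.
have e11 : e1 < 1 by rewrite /e1 ltr_pdivrMr// minElt; case: ifP => h; move: eta0; lra.
(* The factor 2 provides the strict inequality that [small] asks for. *)
exists (2 * e1 `^ (- (s + eps))); first by rewrite mulr_gt0// powR_gt0.
move=> delta d01; have /andP[d0 d1] := d01.
have se0 : 0 <= s + eps by rewrite addr_ge0// ltW.
have e1p : 1 <= e1 `^ (- (s + eps)) by rewrite powRN_ge1// e10.
have dp : 1 <= delta `^ (- (s + eps)) by rewrite powRN_ge1.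
have [de|de] := ltP delta eta.
  have := main _ d01 de; set c := delta `^ _ in dp *.
  move=> h; apply: small; apply: (le_lt_trans h); rewrite lte_fin; nra.
have e1d : e1 <= delta by lra.
have [N [U [U1 U2] U3]] : exists N : nat, exists2 U : 'I_N -> set 'rV[R]_d,
    (forall i (x y : 'rV[R]_d), U i x -> U i y -> enorm (x - y) <= e1) /\ A `<=` \bigcup_i U i &
    N%:R <= 2 * e1 `^ (- (s + eps)).
  apply: small; apply: (le_lt_trans (main _ _ e1e)); first by rewrite e10.
  by rewrite lte_fin; move: e1p; set c := e1 `^ _; lra.
exists N, U; last by rewrite (le_trans U3)// ler_peMr// mulr_ge0// powR_ge0.
by split => // i x y Ux Uy; rewrite (le_trans _ e1d)// (U1 i).
Qed.

(* [y] stands for the volume of the bush, [dm] for [delta ^ (n - 1)] and [Dl] for the loss in the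
   (n-1)-dimensional estimate. *)
Lemma bush_algebra (D lam v y dm K N Dl c1 c2 c3 q : R) (n : nat) : 1 < q ->
  0 < D -> 0 < lam -> 0 < v -> 0 < y -> 0 < dm -> 0 < K -> 0 < N -> 0 <= Dl ->
  0 < c1 -> 0 < c2 -> 0 < c3 ->
  (c1 * (D * lam * y / v)) `^ q <= c2 * D `^ (q - 1) * K ^+ 2 * Dl * (y / (lam * dm)) ->
  c3 * (D * dm * lam ^+ n / (N * K ^+ n)) <= y ->
  (D * dm) `^ q * lam `^ (q + 1 + n%:R * (q - 1)) <=
    c2 / (c1 `^ q * c3 `^ (q - 1)) * (K `^ (2 + n%:R * (q - 1)) * N `^ (q - 1)) * Dl * v `^ q.
Proof.
move=> q1 D0 lam0 v0 y0 dm0 K0 N0 Dl0 c10 c20 c30 H1 H2.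
have r0 : 0 <= q - 1 by rewrite subr_ge0 ltW.
have pn (x : R) : 0 < x -> (x ^+ n) `^ (q - 1) = x `^ (n%:R * (q - 1)).
  by move=> x0; rewrite -powR_mulrn ?(ltW x0)// -powRrM.
have lamE : lam `^ (q + 1 + n%:R * (q - 1)) = lam `^ q * lam * lam `^ (n%:R * (q - 1)).
  by rewrite !powRD ?(gt_eqF lam0) ?implybT// powRr1// ltW.
have KE : K `^ (2 + n%:R * (q - 1)) = K ^+ 2 * K `^ (n%:R * (q - 1)).
  by rewrite powRD ?(gt_eqF K0) ?implybT// powR_mulrn// ltW.
have ln0 : 0 < lam ^+ n by rewrite exprn_gt0.
have Kn0 : 0 < K ^+ n by rewrite exprn_gt0.
have E2 : (c3 * (D * dm * lam ^+ n / (N * K ^+ n))) `^ (q - 1) =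
  c3 `^ (q - 1) * (D `^ (q - 1) * dm `^ (q - 1) * lam `^ (n%:R * (q - 1)) /
    (N `^ (q - 1) * K `^ (n%:R * (q - 1)))).
  by rewrite !(powRMp, powRVp) ?pn// ?(invr_gt0, mulr_gt0).
have E1 : (c1 * (D * lam * y / v)) `^ q = c1 `^ q * (D `^ q * lam `^ q * y `^ q / v `^ q).
  by rewrite !(powRMp, powRVp)// ?(invr_gt0, mulr_gt0).
have {}H2 : c3 `^ (q - 1) * (D `^ (q - 1) * dm `^ (q - 1) * lam `^ (n%:R * (q - 1)) /
    (N `^ (q - 1) * K `^ (n%:R * (q - 1)))) <= y `^ (q - 1).
  rewrite -E2; apply: ler_powR_base => //.
  by apply: ltW; rewrite mulr_gt0// divr_gt0// mulr_gt0// mulr_gt0.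
rewrite E1 (powR_split q D0) (powR_split q y0) in H1.
rewrite lamE KE powRMp// (powR_split q D0) (powR_split q dm0).
have Dr : 0 < D `^ (q - 1) by rewrite powR_gt0.
have dr : 0 < dm `^ (q - 1) by rewrite powR_gt0.
have yr : 0 < y `^ (q - 1) by rewrite powR_gt0.
have c1q : 0 < c1 `^ q by rewrite powR_gt0.
have c3r : 0 < c3 `^ (q - 1) by rewrite powR_gt0.
have lq : 0 < lam `^ q by rewrite powR_gt0.
have lnr : 0 < lam `^ (n%:R * (q - 1)) by rewrite powR_gt0.
have Kn : 0 < K `^ (n%:R * (q - 1)) by rewrite powR_gt0.
have Nr : 0 < N `^ (q - 1) by rewrite powR_gt0.
have vq : 0 < v `^ q by rewrite powR_gt0.
clear E1 E2 lamE KE.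
move: (D `^ (q - 1)) (dm `^ (q - 1)) (y `^ (q - 1)) (c1 `^ q) (c3 `^ (q - 1)) (lam `^ q)
  (lam `^ (n%:R * (q - 1))) (K `^ (n%:R * (q - 1))) (N `^ (q - 1)) (v `^ q)
  Dr dr yr c1q c3r lq lnr Kn Nr vq H1 H2.
move=> Dr dr yr c1q c3r lq ln Kn Nr vq Dr0 dr0 yr0 c1q0 c3r0 lq0 ln1 Kn1 Nr0 vq0 H1 H2.
have {}H1 : c1q * D * lq * yr * lam * dm <= c2 * K ^+ 2 * Dl * vq.
  have P0 : 0 < y * Dr / (lam * dm * vq) by rewrite divr_gt0 ?mulr_gt0.
  rewrite -(ler_pM2r P0); move: H1; congr (_ <= _); field; rewrite ?gt_eqF//.
have {}H2 : c3r * Dr * dr * ln <= yr * Nr * Kn.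
  have P0 : 0 < Nr * Kn by rewrite mulr_gt0.
  rewrite -(ler_pM2r P0) in H2; move: H2; congr (_ <= _); field; rewrite ?gt_eqF//.
have P0 : 0 < c1q * c3r by rewrite mulr_gt0.
rewrite -(ler_pM2r P0).
rewrite [leRHS](_ : _ = c2 * K ^+ 2 * Dl * vq * (Nr * Kn)); last by field; rewrite !gt_eqF.
apply: (@le_trans _ _ (c1q * D * lq * yr * lam * dm * (Nr * Kn))); last first.
  by rewrite ler_pM2r ?mulr_gt0.
rewrite [leRHS](_ : _ = c1q * D * lq * lam * dm * (yr * Nr * Kn)); last by ring.
rewrite [leLHS](_ : _ = c1q * D * lq * lam * dm * (c3r * Dr * dr * ln)); last by ring.
by rewrite ler_pM2l// !mulr_gt0.
Qed.

End real_powers.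

(** * Pigeonholing and volume estimates for a bush *)

(* Where few of the [F i] overlap, they capture together at most half of [#|I| * tau]. *)
Lemma popular_part {disp : measure_display} {T : measurableType disp} {R : realType}
    (mu : {measure set T -> \bar R}) (I : finType) (F : I -> set T) (E : set T) (tau v : R) :
  (forall i, measurable (F i)) -> measurable E -> mu E = v%:E -> 0 < v -> 0 <= tau ->
  (forall i, tau%:E <= mu (E `&` F i))%E ->
  let E' := E `&` [set x | #|I|%:R * tau / (2 * v) <= \sum_i \1_(F i) x] in
  measurable E' /\ ((#|I|%:R * tau / 2)%:E <= \sum_i mu (F i `&` E'))%E.
Proof.
move=> mF mE Ev v0 t0 tE; set M := _ / (2 * v) => E'.
have M0 : 0 <= M by rewrite divr_ge0// mulr_ge0// ltW.
have mE' : measurable E'.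
  pose g (x : T) : R := \sum_i \1_(F i) x.
  have mg : measurable_fun E g.
    rewrite /g; under eq_fun do rewrite -big_filter.
    by apply: measurable_sum => i; exact: measurable_indic.
  rewrite (_ : E' = E `&` g @^-1` `[M, +oo[); first exact: mg.
  by congr (_ `&` _); apply/seteqP; split => x/=; rewrite in_itv/= andbT.
split => //.
pose E2 := E `\` E'; have mE2 : measurable E2 by exact: measurableD.
have split i : mu (E `&` F i) = (mu (F i `&` E') + mu (F i `&` E2))%E.
  rewrite -measureU//; last 3 first.
  - exact: measurableI.
  - exact: measurableI.
  - by rewrite setIACA setDIK// setI0.
  by rewrite -setIUr /E2 setDE setUIr setUCr setIT setIC (setUidr (@subIsetl _ _ _)).
have le2 : (\sum_i mu (F i `&` E2) <= (M * v)%:E)%E.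
  apply: (@le_trans _ _ (M%:E * mu E2)%E).
    apply: sum_measure_le => // x [Ex nE'x]; apply: ltW; rewrite ltNge; apply/negP => Mx.
    exact: nE'x.
  by rewrite [(M * v)%:E]EFinM -Ev lee_wpmul2l// le_measure ?inE//; exact: subDsetl.
have : ((#|I|%:R * tau)%:E <= \sum_i mu (F i `&` E') + \sum_i mu (F i `&` E2))%E.
  rewrite -big_split/=; apply: (@le_trans _ _ (\sum_(i : I) tau%:E)%E); last first.
    by apply: lee_sum => i _; rewrite /= -split.
  by rewrite sumEFin lee_fin sumr_const_pred (@eq_card _ _ predT).
move=> h; have {h} := le_trans h (leeD2l _ le2).
rewrite -leeBlDr//; apply: le_trans.
rewrite -EFinB lee_fin le_eqVlt; apply/orP; left; apply/eqP.
by rewrite /M; field; rewrite gt_eqF.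
Qed.

Lemma weighted_pigeonhole {R : realType} (I J : finType) (N : nat) (cl : I -> 'I_N)
    (w : I -> J -> R) (tau : R) : (0 < #|I|)%N -> 0 < tau ->
  #|I|%:R * tau / 2 <= \sum_i \sum_j w i j ->
  exists c, exists j, #|I|%:R * tau / (4 * N%:R * #|J|%:R) <=
    \sum_(i | (cl i == c) && (tau / (4 * #|J|%:R) <= w i j)) w i j.
Proof.
move=> I0 tau0 Iw.
have D0 : 0 < #|I|%:R :> R by rewrite ltr0n.
set D : R := #|I|%:R in D0 Iw *.
have Dt : 0 < D * tau / 2 by rewrite divr_gt0// mulr_gt0.
have J0 : 0 < #|J|%:R :> R.
  rewrite ltr0n; apply/card_gt0P; apply: contrapT => nJ.
  move: Iw; rewrite leNgt big1 ?Dt// => i _; rewrite big1// => j _.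
  by exfalso; apply: nJ; exists j.
have N0 : 0 < N%:R :> R.
  rewrite ltr0n; case: (N) cl => // cl0; have /card_gt0P[i _] := I0; by case: (cl0 i).
apply: contrapT => nh.
have hlt c j : \sum_(i | (cl i == c) && (tau / (4 * #|J|%:R) <= w i j)) w i j
    < D * tau / (4 * N%:R * #|J|%:R).
  by rewrite ltNge; apply/negP => h; apply: nh; exists c, j.
have c0 : exists c0 : 'I_N, True by have /card_gt0P[i _] := I0; exists (cl i).
have [{}c0 _] := c0.
have [j0 _] : exists j, j \in J by apply/card_gt0P; rewrite -(ltr0n R).
have : \sum_i \sum_j w i j < D * tau / 4 + D * tau / 4.
  rewrite exchange_big/=.
  rewrite (eq_bigr (fun j => \sum_(i | ~~ (tau / (4 * #|J|%:R) <= w i j)) w i j +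
    \sum_c \sum_(i | (cl i == c) && (tau / (4 * #|J|%:R) <= w i j)) w i j)); last first.
    move=> j _; rewrite (bigID (fun i => tau / (4 * #|J|%:R) <= w i j))/= addrC; congr (_ + _).
    rewrite (partition_big cl predT)//=; apply: eq_bigr => c _.
    by apply: eq_bigl => i; rewrite andbC.
  rewrite big_split/=; apply: ler_ltD.
    apply: (@le_trans _ _ (\sum_(j : J) D * (tau / (4 * #|J|%:R)))).
      apply: ler_sum => j _; rewrite big_mkcond/= /D -sumr_const_pred.
      rewrite [leRHS](@eq_bigl _ _ _ _ _ _ xpredT)//.
      apply: ler_sum => i _; case: ifPn; first by rewrite -ltNge => /ltW.
      by move=> _; rewrite divr_ge0// ?mulr_ge0// ltW.
    rewrite sumr_const_pred (@eq_card _ _ predT)// le_eqVlt; apply/orP; left; apply/eqP.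
    by field; rewrite gt_eqF.
  apply: (@lt_le_trans _ _ (\sum_(j : J) \sum_(c < N) D * tau / (4 * N%:R * #|J|%:R))).
    apply: ltr_sum.
      by apply/hasP; exists j0 => //; rewrite mem_index_enum.
    move=> j _; apply: ltr_sum => [|c _]; last exact: hlt.
    by apply/hasP; exists c0 => //; rewrite mem_index_enum.
  rewrite sumr_const_pred (@eq_card _ _ predT)// sumr_const_pred (@eq_card _ _ predT)// card_ord.
  rewrite le_eqVlt; apply/orP; left; apply/eqP.
  by field; rewrite !gt_eqF.
apply/negP; rewrite -leNgt; move: Iw; lra.
Qed.

(** Rounding towards 0 keeps the sample on the axis of the tube. *)
Lemma position_near {R : realType} (L : nat) (t delta : R) : 0 < delta -> `|t| <= L%:R * delta ->
  exists2 s : 'I_(2 * L).+1, `|(position L s : R) * delta| <= `|t| & `|t - (position L s : R)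
    * delta| <= delta.
Proof.
move=> d0 tL; pose u := Num.truncn (`|t| / delta).
have /andP[u1 u2] : u%:R <= `|t| / delta < u%:R + 1.
  by apply: truncn_bounds; rewrite divr_ge0// ltW.
have uL : (u <= L)%N.
  by rewrite -(ler_nat R) (le_trans u1)// ler_pdivrMr.
have u1' : u%:R * delta <= `|t| by rewrite -ler_pdivlMr.
have u2' : `|t| < (u%:R + 1) * delta by rewrite -ltr_pdivrMr.
have ud0 : 0 <= u%:R * delta by rewrite mulr_ge0// ltW.
rewrite mulrDl mul1r in u2'.
have [t0|t0] := leP 0 t.
  have lt : (L + u < (2 * L).+1)%N by lia.
  exists (Ordinal lt); rewrite /position/= natrD [L%:R + _]addrC addrK.
    by rewrite ger0_norm.
  rewrite ger0_norm// in u1' u2'.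
  by rewrite ger0_norm; lra.
have lt : (L - u < (2 * L).+1)%N by lia.
exists (Ordinal lt); rewrite /position/= natrB// [L%:R - _]addrC addrK mulNr.
  by rewrite normrN ger0_norm.
rewrite ltr0_norm// in u1' u2'.
by rewrite opprK ler_norml; apply/andP; lra.
Qed.

(** Inside the ball the axis parameter is at most [3 * rho], so [6 * 2 ^ j + 1 <= 7 * 2 ^ j] samples
    suffice. *)
Lemma tube_ball_vol_le {R : realType} d (delta rho : R) (j : nat) (e a a0 : 'rV[R]_d.+1) :
  0 < delta -> rho = 2 ^+ j * delta -> enorm e = 1 -> enorm (a - a0) <= delta ->
  (lebesgue_outer (tube delta e a `&` eball a0 rho) <= (7 * 8 ^+ d.+1 * rho * delta ^+ d)%:E)%E.
Proof.
move=> d0 rhoE e1 aa0; pose L := (3 * 2 ^ j)%N.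
have LE : L%:R * delta = 3 * rho by rewrite /L natrM natrX -mulrA -rhoE.
have pj : 1 <= 2 ^+ j :> R by rewrite exprn_ege1// ler1n.
have drho : delta <= rho by rewrite rhoE ler_peMl// ltW.
apply: (@le_trans _ _ (#|'I_(2 * L).+1|%:R * (2 * (4 * delta)) ^+ d.+1)%:E).
  apply: (@lebesgue_cover_le R d.+1 _ predT (fun s => a0 + (position L s * delta) *: e)).
    by rewrite mulr_ge0// ltW.
  move=> x [/tubeP[t t2 xt] xa0]; rewrite /eball/= in xa0.
  have tr : `|t| <= L%:R * delta.
    rewrite LE (_ : `|t| = enorm (t *: e)); last by rewrite enormZ e1 mulr1.
    rewrite (_ : t *: e = (x - a0) - ((x - (a + t *: e)) + (a - a0))); last first.
      by apply/rowP => i; rewrite !mxE; ring.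
    rewrite (le_trans (ler_enormB _ _))//.
    have := ler_enormD (x - (a + t *: e)) (a - a0); lra.
  have [s _ ts] := position_near d0 tr; exists s => //; rewrite /eball/=.
  rewrite (_ : x - _ = (x - (a + t *: e)) + ((a - a0) + (t - position L s * delta) *: e));
    last first.
    by apply/rowP => i; rewrite !mxE; ring.
  rewrite (le_lt_trans (ler_enormD _ _))//.
  have := ler_enormD (a - a0) ((t - position L s * delta) *: e).
  rewrite [X in _ <= _ + X]enormZ e1 mulr1; lra.
rewrite lee_fin card_ord (_ : 2 * (4 * delta) = 8 * delta); last by ring.
rewrite exprMn [X in _ * (_ * X)]exprS.
have -> : 7 * 8 ^+ d.+1 * rho * delta ^+ d = (7 * 2 ^+ j) * (8 ^+ d.+1 * (delta * delta ^+ d)).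
  by rewrite rhoE; move: (8 ^+ d.+1) (delta ^+ d) (2 ^+ j) => *; ring.
rewrite ler_wpM2r//; first by rewrite !mulr_ge0 ?exprn_ge0// ltW.
rewrite -natr1 /L !natrM natrX; lra.
Qed.

Lemma hits_vol_ge {R : realType} k (delta : R) L (a e : 'rV[R]_k.+2) X :
  0 < delta -> enorm e = 1 -> 1 <= L%:R * delta ->
  (lebesgue_outer (tube delta e a `&` X) <=
    ((hits delta (2 * L).+1 L a e X)%:R * (4 * delta) ^+ k.+2)%:E)%E.
Proof.
move=> d0 e1 Ld; rewrite (_ : 4 * delta = 2 * (2 * delta)); last by ring.
apply: (@lebesgue_cover_le R k.+2 _ _ (fun s => a + (position L s * delta) *: e)).
  by rewrite mulr_ge0// ltW.
move=> x [/tubeP[t t2 xt] Xx].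
have [s ps ts] := @position_near R L t delta d0 ltac:(lra).
have xs : enorm (x - (a + (position L s * delta) *: e)) < 2 * delta.
  rewrite (_ : x - _ = (x - (a + t *: e)) + (t - position L s * delta) *: e); last first.
    by apply/rowP => i; rewrite !mxE; ring.
  rewrite (le_lt_trans (ler_enormD _ _))// enormZ e1 mulr1; lra.
exists s => //; apply/asboolP; split; first exact: le_trans t2.
by exists x.
Qed.

Lemma sum_tube_vol_le {R : realType} m (I : finType) (P : pred I) (e a : I -> 'rV[R]_m.+1)
    (a0 : 'rV[R]_m.+1) (delta rho theta : R) (X : set (lebesgueType R m.+1)) :
  0 < theta -> 0 < delta -> 0 < rho -> (forall i, enorm (e i) = 1) ->
  {in P &, forall i j, i != j -> theta <= enorm (e i - e j)} ->
  (forall i, P i -> enorm (a i - a0) <= delta) -> measurable X ->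
  (forall x, X x -> rho <= delta \/ rho / 2 <= enorm (x - a0)) ->
  (\sum_(i | P i) lebesgue_outer (tube delta (e i) (a i) `&` X) <=
    (4 * m.+1%:R * (32 * m.+1%:R ^+ 3 * (delta / (rho * theta)) + 1) ^+ m)%:E * lebesgue_outer X)%E.
Proof.
move=> t0 d0 r0 e1 sep aa mX X_ge.
apply: (@sum_measure_le _ _ _ (@lebesgue R m.+1) I P (fun i => tube delta (e i) (a i)) X) => //.
- by move=> i; exact: measurable_tube.
- move=> x Xx; rewrite sum_indic_card.
  apply: (@tube_overlap R m I _ e a a0 x delta rho theta) => //; last exact: X_ge.
  + by move=> i j; rewrite !inE => /andP[Pi _] /andP[Pj _]; exact: sep.
  + by move=> i /andP[Pi _]; exact: aa.
  + by move=> i /andP[_]; rewrite inE.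
- have dr0 : 0 <= delta / (rho * theta) by apply/ltW; rewrite divr_gt0// mulr_gt0.
  by rewrite mulr_ge0// exprn_ge0// addr_ge0// mulr_ge0.
Qed.

(** Turning the axis by [delta / rho] moves its points within [3 * rho] of the centre by at most
    [3 * delta]; the radius of the tube and the shift of its centre add one [delta] each. *)
Lemma tube_near_ray {R : realType} d (delta rho : R) (e e' a a0 x : 'rV[R]_d) :
  0 < delta <= rho -> enorm e = 1 -> enorm (a - a0) <= delta -> tube delta e a x ->
  enorm (x - a0) < rho -> enorm (e - e') < delta / rho ->
  exists2 t, `|t| <= 3 * rho & enorm (x - a0 - t *: e') <= 5 * delta.
Proof.
move=> /andP[d0 dr] e1 aa /tubeP[t _ xt] xa ee; have r0 : 0 < rho by exact: lt_le_trans dr.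
have tr : `|t| <= 3 * rho.
  rewrite (_ : `|t| = enorm (t *: e)); last by rewrite enormZ e1 mulr1.
  rewrite (_ : t *: e = (x - a0) - ((x - (a + t *: e)) + (a - a0))); last first.
    by apply/rowP => i; rewrite !mxE; ring.
  rewrite (le_trans (ler_enormB _ _))//.
  have := ler_enormD (x - (a + t *: e)) (a - a0); lra.
exists t => //.
rewrite (_ : _ - _ = (x - (a + t *: e)) + ((a - a0) + t *: (e - e'))); last first.
  by apply/rowP => i; rewrite !mxE; ring.
rewrite (le_trans (ler_enormD _ _))//.
have := ler_enormD (a - a0) (t *: (e - e')); rewrite [X in _ <= _ + X]enormZ.
have : `|t| * enorm (e - e') <= 3 * rho * (delta / rho).
  by rewrite ler_pM ?enorm_ge0// ltW.
rewrite (_ : 3 * rho * _ = 3 * delta); last by field; rewrite gt_eqF.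
lra.
Qed.

(** * The bush argument *)

Section main_estimate.
Context {R : realType} (k : nat) (h q : R) (q_gt1 : 1 < q).
Hypothesis kakeya_bound : forall eps : R, 0 < eps -> exists C : R,
  forall (f : 'rV[R]_k.+1 -> R) (delta : R), L1loc f -> 0 < delta < 1 ->
   (Lnorm (@surface R k.+1) q%:E (kakeya_max delta f)
      <= (C * delta `^ (- h - eps))%:E *
         Lnorm (@lebesgue R k.+1) q%:E (EFin \o f))%E.

Lemma main_estimate eps : 0 < eps -> exists2 C : R, 0 < C &
  forall (delta lam v : R) (K N : nat) (I : finType) (e a : I -> 'rV[R]_k.+2)
    (cl : I -> 'I_N) (a0 : 'I_N -> 'rV[R]_k.+2) (E : set (lebesgueType R k.+2)),
  0 < delta < 1 -> 3 <= 2 ^+ K * delta <= 6 -> (0 < #|I|)%N ->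
  (forall i, enorm (e i) = 1) -> (forall i j, i != j -> 6 * delta <= enorm (e i - e j)) ->
  (forall i, enorm (a i - a0 (cl i)) <= delta) ->
  measurable E -> lebesgue_outer E = v%:E -> 0 < lam ->
  (forall i, ((lam * (2^-1 / k.+3%:R ^+ k.+2 * delta ^+ k.+1))%:E <=
     lebesgue_outer (E `&` tube delta (e i) (a i)))%E) ->
  (#|I|%:R * delta ^+ k.+1) `^ q * lam `^ (q + 1 + k.+2%:R * (q - 1)) <=
    C * (K.+1%:R `^ (2 + k.+2%:R * (q - 1)) * N%:R `^ (q - 1)) *
    delta `^ (- (h + eps) * q) * v `^ q.
Proof.
move=> eps0; have [Ck Ck0 key] := key_estimate q_gt1 kakeya_bound eps0.
set n := k.+2; set m := k.+1.
pose c1 : R := 2^-1 / k.+3%:R ^+ n.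
(* [Ca] and [Cb] are the overlap constants of [tube_overlap] for directions with separation
   [6 * delta] and [delta / rho]; [Cv] is the constant of [tube_ball_vol_le]. *)
pose Ca : R := 4 * n%:R * (12 * n%:R ^+ 3) ^+ m.
pose Cb : R := 4 * n%:R * (32 * n%:R ^+ 3 + 1) ^+ m.
pose Cv : R := 7 * 8 ^+ n.
have c10 : 0 < c1 by rewrite divr_gt0// exprn_gt0.
have n1 : 1 <= n%:R :> R by rewrite ler1n.
have n30 : 1 <= n%:R ^+ 3 :> R by rewrite exprn_ege1.
have Ca0 : 0 < Ca by apply: mulr_gt0; [lra|apply: exprn_gt0; lra].
have Cb0 : 0 < Cb by apply: mulr_gt0; [lra|apply: exprn_gt0; lra].
have Cv0 : 0 < Cv by rewrite mulr_gt0// exprn_gt0.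
pose b1 := c1 / (2 * 4 ^+ n).
pose b2 := 2 `^ q * Ck * (4 * Cb / c1).
pose b3 := c1 ^+ n / (4 ^+ n * Cv ^+ m * Ca).
have b10 : 0 < b1 by rewrite divr_gt0// mulr_gt0// exprn_gt0.
have b20 : 0 < b2 by rewrite !mulr_gt0 ?powR_gt0 ?invr_gt0.
have b30 : 0 < b3 by rewrite divr_gt0 ?exprn_gt0// mulr_gt0// mulr_gt0// exprn_gt0.
exists (b2 / (b1 `^ q * b3 `^ (q - 1))); first by rewrite divr_gt0// mulr_gt0 ?powR_gt0.
move=> delta lam v K N I e a cl a0 E d01 K36 I0 e1 sep acl mE Ev lam0 tE.
have /andP[d0 d1] := d01; have /andP[K3 K6] := K36.
pose D : R := #|I|%:R; have D0 : 0 < D by rewrite ltr0n.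
pose tau := lam * (c1 * delta ^+ m).
have tau0 : 0 < tau by rewrite !mulr_gt0// exprn_gt0.
have v0 : 0 < v.
  have /card_gt0P[i _] := I0; rewrite -lte_fin -Ev.
  apply: lt_le_trans (le_lebesgue_outer (@subIsetl _ E (tube delta (e i) (a i)))).
  by apply: lt_le_trans (tE i); rewrite lte_fin.
pose T i : set (lebesgueType R n) := tube delta (e i) (a i).
have mT i : measurable (T i) by exact: measurable_tube.
have [mE' E'half] := @popular_part _ _ R (@lebesgue R n) I T E tau v mT mE Ev v0 (ltW tau0) tE.
set E' := E `&` _ in mE' E'half.
pose Sh (c : 'I_N) (j : 'I_K.+1) : set 'rV[R]_n := [set x | enorm (x - a0 c) < 2 ^+ j * delta /\
  (2 ^+ j * delta <= delta \/ 2 ^+ j * delta / 2 <= enorm (x - a0 c))].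
have mSh c j : measurable (Sh c j : set (lebesgueType R n)).
  have oS (r : R) : measurable (eball (a0 c) r : set (lebesgueType R n)).
    exact/open_lebesgue_measurable/open_eball.
  rewrite (_ : Sh c j = if 2 ^+ j * delta <= delta then eball (a0 c) (2 ^+ j * delta)
    else eball (a0 c) (2 ^+ j * delta) `\` eball (a0 c) (2 ^+ j * delta / 2)).
    by case: ifP => _; [exact: oS|exact: measurableD].
  apply/seteqP; split => x; case: ifPn => jd; rewrite /Sh /eball/=.
  - by case.
  - case=> x1 [jd'|x2]; first by rewrite jd' in jd.
    by split => //; apply/negP; rewrite -leNgt.
  - by split => //; left.
  - by case=> x1 x2; split => //; right; rewrite leNgt; exact/negP.
pose vol (Y : set 'rV[R]_n) := fine (lebesgue_outer Y).
have volE Y : Y `<=` E -> lebesgue_outer Y = (vol Y)%:E.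
  move=> YE; rewrite fineK// ge0_fin_numE; last exact: (outer_measure_ge0 (@lebesgue_outer R n)).
  by rewrite (le_lt_trans (le_lebesgue_outer YE))// Ev ltry.
have vol_ge0 Y : 0 <= vol Y by apply/fine_ge0/(outer_measure_ge0 (@lebesgue_outer R n)).
have E'E : E' `<=` E by exact: subIsetl.
pose w i j := vol (T i `&` E' `&` Sh (cl i) j).
have TE i : T i `&` E' `<=` E by move=> x [_ /E'E].
have TSE i c j : T i `&` E' `&` Sh c j `<=` E by move=> x [/TE].
have wsum : D * tau / 2 <= \sum_i \sum_j w i j.
  rewrite -lee_fin -!sumEFin; apply: (le_trans E'half); apply: lee_sum => i _.
  have -> : (\sum_j w i j)%:E = (\sum_(j : 'I_K.+1) lebesgue_outer (Sh (cl i)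
    j `&` (T i `&` E')))%E.
    by rewrite -sumEFin; apply: eq_bigr => j _; rewrite setIC volE//; exact: TSE.
  rewrite -[leLHS]mul1e.
  apply: (@sum_measure_ge _ _ _ (@lebesgue R n) _ _ (Sh (cl i)) (T i `&` E')) => //.
  - exact: measurableI.
  - move=> x [/tubeP[t t2 xt] _].
    have x3 : enorm (x - a0 (cl i)) < 2 ^+ K * delta.
      apply: lt_le_trans K3.
      rewrite (_ : x - a0 _ = (x - (a i + t *: e i)) + ((a i - a0 (cl i)) + t *: e i)); last first.
        by apply/rowP => l; rewrite !mxE; ring.
      rewrite (le_lt_trans (ler_enormD _ _))//.
      have := ler_enormD (a i - a0 (cl i)) (t *: e i); rewrite [X in _ <= _ + X]enormZ e1 mulr1.
      have := acl i; move: t2 d1 xt; lra.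
    have [j xj jx] := dyadic_scale x3.
    rewrite (bigD1 j)//= indicE mem_set ?lerDl ?sumr_ge0//; split => //.
    by case: jx => [->|]; [left; rewrite expr0 mul1r|right].
have [c [j]] := weighted_pigeonhole cl I0 tau0 wsum.
rewrite card_ord -/D.
pose P0 i := (cl i == c) && (tau / (4 * K.+1%:R) <= w i j).
rewrite (@eq_bigl _ _ _ _ _ _ P0)// => P0w.
pose rho : R := 2 ^+ j * delta.
have pj1 : 1 <= 2 ^+ j :> R by rewrite exprn_ege1// ler1n.
have drho : delta <= rho by rewrite ler_peMl// ltW.
have rho6 : rho <= 6.
  by rewrite (le_trans _ K6)// ler_pM2r// ler_eXn2l// ?ltr1n// -ltnS.
have rho0 : 0 < rho by exact: lt_le_trans drho.
pose X : set (lebesgueType R n) := \bigcup_(i in [set i | P0 i]) (T i `&` E' `&` Sh c j).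
have mX : measurable X.
  apply: (@fin_bigcup_measurable _ (lebesgueType R n)); first exact: finite_finset.
  by move=> i _; apply: measurableI => //; exact: measurableI.
have XE' : X `<=` E' by move=> x [i _ [[]]].
have XE : X `<=` E by move=> x /XE' /E'E.
have XSh : X `<=` Sh c j by move=> x [i _ []].
have X_lt x : X x -> enorm (x - a0 c) < rho by move=> /XSh[].
have X_ge x : X x -> rho <= delta \/ rho / 2 <= enorm (x - a0 c) by move=> /XSh[].
have P0cl i : P0 i -> cl i = c by move=> /andP[/eqP].
have P0a i : P0 i -> enorm (a i - a0 c) <= delta by move=> /P0cl <-.
have P0X i : P0 i -> w i j = vol (T i `&` X).
  move=> Pi; rewrite /w (P0cl _ Pi); congr vol; apply/seteqP; split => [x [[Tx E'x] Sx]|x [Tx Xx]].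
    by split => //; exists i.
  by split; [split => //; exact: XE'|exact: XSh].
have TXE i : T i `&` X `<=` E by move=> x [_ /XE].
pose y := vol X.
have muX : lebesgue_outer X = y%:E by exact: volE.
have y_ge0 : 0 <= y by exact: vol_ge0.
have K0 : 0 < K.+1%:R :> R by rewrite ltr0n.
have dr0 : 0 < delta / rho by rewrite divr_gt0.
have N0 : 0 < N%:R :> R by rewrite ltr0n (leq_ltn_trans _ (ltn_ord c)).
have sumw_gt0 : 0 < \sum_(i | P0 i) w i j.
  apply: lt_le_trans P0w; apply: divr_gt0; first by rewrite mulr_gt0.
  rewrite mulr_gt0// mulr_gt0//.
have sum_le (P : {pred I}) (theta B : R) : 0 < theta -> subpred P P0 ->
    {in P &, forall i j, i != j -> theta <= enorm (e i - e j)} ->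
    4 * n%:R * (32 * n%:R ^+ 3 * (delta / (rho * theta)) + 1) ^+ m <= B ->
    \sum_(i | P i) w i j <= B * y.
  move=> th0 PP0 Psep PB.
  rewrite -lee_fin -sumEFin (eq_bigr (fun i => lebesgue_outer (T i `&` X))); last first.
    by move=> i Pi; rewrite P0X ?PP0// volE.
  apply: (@le_trans _ _ ((4 * n%:R * (32 * n%:R ^+ 3 * (delta / (rho * theta)) + 1) ^+ m)%:E *
      lebesgue_outer X)%E); last first.
    by rewrite muX -EFinM lee_fin ler_wpM2r.
  by apply: (@sum_tube_vol_le R m I P e a (a0 c)) => // i Pi; exact/P0a/PP0.
(* All tubes of the class count here; [rho <= 6] absorbs the [+ 1] of the overlap bound. *)
have y_lower : \sum_(i | P0 i) w i j <= Ca / rho ^+ m * y.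
  apply: (sum_le P0 (6 * delta)); rewrite ?mulr_gt0//.
    by move=> i i' _ _; exact: sep.
  rewrite /Ca -[leRHS]mulrA ler_wpM2l ?mulr_ge0//.
  have -> : delta / (rho * (6 * delta)) = (6 * rho)^-1 by field; rewrite !gt_eqF.
  have ir0 : 0 < (6 * rho)^-1 by rewrite invr_gt0 mulr_gt0.
  rewrite -expr_div_n lerXn2r ?nnegrE//.
  - by rewrite addr_ge0// mulr_ge0 ?(ltW ir0)// mulr_ge0.
  - by rewrite divr_ge0 ?(ltW rho0)// mulr_ge0.
  rewrite ler_pdivlMr// [leLHS](_ : _ = 32 / 6 * n%:R ^+ 3 + rho); last by field; rewrite gt_eqF.
  by move: n30 rho6; lra.
have y0 : 0 < y.
  rewrite lt0r y_ge0 andbT; apply/eqP => yE; move: y_lower.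
  by rewrite yE mulr0 leNgt sumw_gt0.
(* With separation [delta / rho] the overlap at distance [rho] is bounded, and nothing is lost:
   within [rho] of the vertex, closer directions give the same ray up to [O(delta)]. *)
have [Q [QP Qsep Qmax]] := maximal_separated_sub P0 e dr0.
have Q_le : #|Q|%:R * (tau / (4 * K.+1%:R)) <= Cb * y.
  apply: (@le_trans _ _ (\sum_(i in Q) w i j)).
    by rewrite -sumr_const_pred; apply: ler_sum => i /QP/andP[].
  apply: (sum_le (mem Q) (delta / rho)) => //.
  rewrite (_ : delta / _ = 1) ?mulr1//; field; rewrite !gt_eqF//.
have rho_ge : tau / (4 * K.+1%:R) <= Cv * rho * delta ^+ m.
  have [i P0i] : exists i, P0 i.
    apply: contrapT => nP; move: sumw_gt0; rewrite big1 ?ltxx// => i Pi.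
    by exfalso; apply: nP; exists i.
  have /andP[_] := P0i; move=> /le_trans; apply.
  rewrite -lee_fin -volE//.
  apply: le_trans (tube_ball_vol_le d0 (erefl rho) (e1 i) (P0a _ P0i)).
  apply: le_lebesgue_outer => x [[Tx _] [Sx _]]; split => //.
  by rewrite (P0cl _ P0i) in Sx.
have near x : X x -> exists i t,
    [/\ i \in Q, `|t| <= 3 * rho & enorm (x - a0 c - t *: e i) <= 5 * delta].
  move=> Xx; have [i P0i [[Tx _] [Sx _]]] := Xx.
  have [i' Qi' ii'] := Qmax _ P0i.
  have [|t t1 t2] := tube_near_ray _ (e1 i) (P0a _ P0i) Tx Sx ii'; first by rewrite d0.
  by exists i', t.
pose L := (Num.truncn (delta^-1)).+1.
have L1 : 1 <= L%:R * delta.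
  by rewrite -ler_pdivrMr// mul1r ltW// truncnS_gt.
have rho16 : delta <= rho <= 6 by rewrite drho.
have key1 := key delta rho K (2 * L).+1 L I e a (a0 c) Q X d01 rho16 K3 e1 sep X_lt X_ge near.
pose M i : R := (hits delta (2 * L).+1 L (a i) (e i) X)%:R.
(* The sum runs over all [D] tubes, not only those of the bush: [X] lies in [E'], each point of
   which is on at least [D * tau / (2 * v)] tubes. *)
have Msum : b1 * (D * lam * y / v) <= \sum_i M i * delta.
  have : (D * tau / (2 * v) * y <= \sum_i M i * (4 * delta) ^+ n).
    rewrite -lee_fin EFinM -muX -sumEFin.
    apply: (@le_trans _ _ (\sum_i lebesgue_outer (T i `&` X))%E); last first.
      by apply: lee_sum => i _; exact: hits_vol_ge.
    apply: (@sum_measure_ge _ _ _ (@lebesgue R n) _ _ T X) => //.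
      by move=> x /XE'[_].
    by apply: ltW; apply: divr_gt0; rewrite mulr_gt0.
  rewrite -mulr_suml -mulr_suml exprMn exprS => Mh.
  have d4 : 0 < 4 ^+ n * delta ^+ m by rewrite mulr_gt0 ?exprn_gt0.
  rewrite -(ler_pM2r d4) [leRHS](_ : _ = (\sum_i M i) * (4 ^+ n * (delta * delta ^+ m))).
    apply: le_trans Mh; rewrite le_eqVlt; apply/orP; left; apply/eqP.
    rewrite /b1 /tau; have : 4 ^+ n != 0 :> R by rewrite gt_eqF// exprn_gt0.
    by move: (4 ^+ n) (delta ^+ m) => A B A0; field; rewrite A0 gt_eqF.
  by move: (\sum_i M i) (4 ^+ n) (delta ^+ m) => A B C; ring.
have B0 : 0 < b1 * (D * lam * y / v) by rewrite mulr_gt0// divr_gt0// !mulr_gt0.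
have M0 i : 0 <= M i * delta by rewrite mulr_ge0// ltW.
have dm0 : 0 < delta ^+ m by rewrite exprn_gt0.
have Dl0 : 0 <= delta `^ (- (h + eps) * q) by exact: powR_ge0.
apply: (@bush_algebra R D lam v y (delta ^+ m) K.+1%:R N%:R _ b1 b2 b3 q n) => //.
  have := sum_powR_ge q_gt1 M0 B0 Msum key1; move=> /le_trans; apply.
  rewrite -/D /b2; set Dl := delta `^ _; set D1 := D `^ _; set q2 := 2 `^ q.
  have tE2 : #|Q|%:R <= 4 * Cb / c1 * (K.+1%:R * (y / (lam * delta ^+ m))).
    have t4 : 0 < tau / (4 * K.+1%:R) by rewrite divr_gt0// mulr_gt0.
    rewrite -(ler_pM2r t4) (le_trans Q_le)// le_eqVlt; apply/orP; left; apply/eqP.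
    rewrite /tau; move: (delta ^+ m) dm0 => dm dm0'.
    by field; rewrite !gt_eqF// ?ltr0n//.
  rewrite [leRHS](_ : _ = q2 * D1 * (Ck * K.+1%:R * Dl * (4 * Cb / c1 * (K.+1%:R * (y / (lam * delta ^+ m)))))); last by ring.
  by rewrite ler_wpM2l ?mulr_ge0 ?powR_ge0// ler_wpM2l ?mulr_ge0 ?powR_ge0 ?(ltW Ck0) ?(ltW K0).
have P0w2 := le_trans P0w y_lower.
pose r1 := lam * c1 / (4 * K.+1%:R * Cv).
have r1rho : r1 <= rho.
  have t4 : 0 < Cv * delta ^+ m by rewrite mulr_gt0.
  rewrite -(ler_pM2r t4) [leRHS](_ : _ = Cv * rho * delta ^+ m); last by rewrite mulrCA mulrA.
  apply: le_trans rho_ge; rewrite le_eqVlt; apply/orP; left; apply/eqP.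
  by rewrite /r1 /tau; move: (delta ^+ m) => dm; field; rewrite !gt_eqF.
have r10 : 0 < r1 by rewrite /r1 divr_gt0// mulr_gt0// mulr_gt0.
(* The power [lam ^+ n] consists of one factor from [tau] and [m] factors from [rho ^+ m], through
   [r1 <= rho]. *)
apply: (@le_trans _ _ (D * tau / (4 * N%:R * K.+1%:R) * (r1 ^+ m / Ca))).
  rewrite le_eqVlt; apply/orP; left; apply/eqP.
  rewrite /b3 /r1 /tau; clear -c10 Ca0 Cv0 K0 N0; clearbody c1 Ca Cv.
  rewrite ![_ ^+ n]exprS -/m expr_div_n !exprMn.
  have [e4 ek ec] : [/\ 0 < 4 ^+ m :> R, 0 < K.+1%:R ^+ m :> R & 0 < Cv ^+ m].
    by split; rewrite exprn_gt0.
  move: (4 ^+ m) (K.+1%:R ^+ m) (Cv ^+ m) e4 ek ec => x4 xk xc e4 ek ec.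
  move: (c1 ^+ m) (lam ^+ m) (delta ^+ m) => xc1 xl xd.
  by field; rewrite !gt_eqF.
apply: (@le_trans _ _ (Ca / rho ^+ m * y * (rho ^+ m / Ca))).
  apply: ler_pM => //.
  - by apply/ltW/divr_gt0; rewrite mulr_gt0// mulr_gt0.
  - by rewrite divr_ge0 ?(ltW Ca0)// exprn_ge0// ltW.
  - by rewrite ler_pM2r ?invr_gt0// lerXn2r// ?nnegrE ltW.
have rm0 : 0 < rho ^+ m by rewrite exprn_gt0.
rewrite le_eqVlt; apply/orP; left; apply/eqP.
by move: (rho ^+ m) rm0 => rm rm0; field; rewrite !gt_eqF.
Qed.

End main_estimate.

(** * Level sets and the weak-type estimate *)

Lemma restricted_kakeya_level {R : realType} d (delta lam : R) (A : set 'rV[R]_d) f e : 0 <= lam ->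
  A !=set0 -> (lam%:E < `|restricted_kakeya_max delta A f e|)%E ->
  exists2 a, A a & (lam%:E < tube_avg delta f e a)%E.
Proof.
move=> lam0 [a0 Aa0].
have avg_ge0 a : (0 <= tube_avg delta f e a)%E.
  rewrite /tube_avg mule_ge0//; first by rewrite inve_ge0.
  by apply: integral_ge0 => x _; rewrite lee_fin.
(* For empty [A] the supremum would be [-oo], of absolute value [+oo]; a point of [A] makes it
   nonnegative. *)
rewrite gee0_abs; last first.
  by apply: le_trans (avg_ge0 a0) _; apply: ereal_sup_ubound; exists a0.
by move=> /ereal_sup_gt[_ [a Aa <-]]; exists a.
Qed.

Section level_sets.
Context {R : realType} (k : nat) (h q : R) (q_gt1 : 1 < q).
Hypothesis kakeya_bound : forall eps : R, 0 < eps -> exists C : R,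
  forall (f : 'rV[R]_k.+1 -> R) (delta : R), L1loc f -> 0 < delta < 1 ->
   (Lnorm (@surface R k.+1) q%:E (kakeya_max delta f)
      <= (C * delta `^ (- h - eps))%:E *
         Lnorm (@lebesgue R k.+1) q%:E (EFin \o f))%E.

Let P := q + 1 + k.+2%:R * (q - 1).

(** The weak-type inequality at one level, raised to the power [P]. The real number [Sg] stands for
    the area of the level set, which keeps the algebra out of the extended reals. *)
Lemma level_set_estimate s (A : set 'rV[R]_k.+2) eps : 0 <= s -> A !=set0 ->
  (upper_box_dim A <= s%:E)%E -> 0 < eps -> exists2 C : R, 0 < C &
  forall (delta lam v : R) (E : set (lebesgueType R k.+2)), 0 < delta < 1 -> 0 < lam ->
  measurable E -> lebesgue_outer E = v%:E -> exists2 Sg : R,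
    0 <= Sg /\
    (surface_outer [set x | lam%:E < `|restricted_kakeya_max delta A \1_E x|] <= Sg%:E)%E &
    Sg `^ q * lam `^ P <= C * delta `^ (- (h * q + s * (q - 1)) - eps * P) * v `^ q.
Proof.
(* The maximal estimate, the number of scales and the number of cells are each used with [eps / 2];
   the resulting exponents together stay below [eps * P]. *)
move=> s0 A0 Adim eps0; have e20 : 0 < eps / 2 by rewrite divr_gt0.
have [C1 C10 main] := main_estimate q_gt1 kakeya_bound e20.
have [C2 C20 dyad] := dyadic_exponent e20.
have [C3 C30 cover] := box_dim_cover s0 Adim e20.
set n := k.+2; set m := k.+1; pose r := q - 1.
have q0 : 0 < q by rewrite (lt_trans _ q_gt1).
have r0 : 0 < r by rewrite subr_gt0.
have nr0 : 0 < n%:R * r by rewrite mulr_gt0.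
pose c : R := m.+1%:R * 7 * 4 ^+ m.+1 * 6 ^+ m.
have c0 : 0 < c by rewrite mulr_gt0 ?exprn_gt0// mulr_gt0 ?exprn_gt0.
pose Ct := c `^ q * (C1 * (C2 `^ (2 + n%:R * r) * C3 `^ r)).
exists Ct; first by rewrite !mulr_gt0 ?powR_gt0.
move=> delta lam v E d01 lam0 mE Ev; have /andP[d0 d1] := d01.
set Om := [set x | _].
pose Om1 := Om `&` @unit_sphere R n.
have d60 : 0 < 6 * delta by rewrite mulr_gt0.
have [D [e [eOm esep emax]]] := @maximal_separated R m (6 * delta) Om1 d60 (fun x Ox => Ox.2).
have e1 i : enorm (e i) = 1 by have [] := eOm i.
pose Sg := D%:R * delta ^+ m * c.
have dm0 : 0 < delta ^+ m by rewrite exprn_gt0.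
have Sg0 : 0 <= Sg by rewrite mulr_ge0 ?(ltW c0)// mulr_ge0// ltW.
exists Sg.
  split => //; rewrite -surface_outerI_sphere -/Om1.
  have : 0 < 6 * delta <= 6 by rewrite d60/=; lra.
  move=> /(@surface_cover_le R m 'I_D e (6 * delta) Om1)/(_ e1) h1.
  apply: le_trans (h1 _) _; first by move=> x Ox _; exact: emax.
  rewrite lee_fin card_ord exprMn le_eqVlt; apply/orP; left; apply/eqP.
  by rewrite /Sg /c; move: (4 ^+ m.+1) (6 ^+ m) (delta ^+ m) => *; ring.
have v0 : 0 <= v by rewrite -lee_fin -Ev; exact: (outer_measure_ge0 (@lebesgue_outer R n)).
have [D0|D0] := posnP D.
  rewrite /Sg D0 !mul0r powR0 ?gt_eqF// mul0r.
  by rewrite mulr_ge0 ?powR_ge0// mulr_ge0 ?powR_ge0// !mulr_ge0 ?powR_ge0 ?(ltW C10).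
have /choice[a aP] i : exists a, A a /\ (lam%:E < tube_avg delta \1_E (e i) a)%E.
  have [Oe _] := eOm i.
  by have [a Aa la] := restricted_kakeya_level (ltW lam0) A0 Oe; exists a.
have [N [U [Ud AU] NC]] := cover _ d01.
have /choice[cl clP] i : exists c, U c (a i).
  by have [/AU[c' _ Uc] _] := aP i; exists c'.
(* The vertex of a cell is one of the tube centres in it, or 0 if the cell contains none. *)
have /choice[a0 a0P] c' : exists a0, forall i, cl i = c' -> enorm (a i - a0) <= delta.
  have [[i ci]|nc] := pselect (exists i, cl i = c').
    by exists (a i) => j cj; apply: (Ud c'); [rewrite -cj|rewrite -ci]; exact: clP.
  by exists 0 => i ci; exfalso; apply: nc; exists i.
have [K [K36 KC]] := dyad _ d01.
have := main delta lam v K N 'I_D e a cl a0 E d01 K36.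
rewrite card_ord => /(_ D0 e1 esep (fun i => a0P _ _ erefl) mE Ev lam0) {}main.
have {}main := main (fun i => @lt_tube_avg R m delta (e i) (a i) E lam (e1 i) d01 lam0 mE (aP i).2).
have N0 : 0 < N%:R :> R by rewrite ltr0n (leq_ltn_trans _ (ltn_ord (cl (Ordinal D0)))).
have K0 : 0 < K.+1%:R :> R by rewrite ltr0n.
have D0' : 0 < D%:R :> R by rewrite ltr0n.
have Kpow : K.+1%:R `^ (2 + n%:R * r) <= C2 `^ (2 + n%:R * r)
  * delta `^ (- (eps / 2 * (2 + n%:R * r))).
  rewrite -mulNr powRrM -powRMp ?powR_gt0//; apply: ler_powR_base => //.
  by rewrite addr_ge0// ltW.
have Npow : N%:R `^ r <= C3 `^ r * delta `^ (- ((s + eps / 2) * r)).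
  rewrite -mulNr powRrM -powRMp ?powR_gt0//; apply: ler_powR_base => //.
  exact: ltW.
have -> : Sg `^ q * lam `^ P = c `^ q * ((D%:R * delta ^+ m) `^ q * lam `^ P).
  by rewrite (powRMp q (mulr_gt0 D0' dm0) c0 : Sg `^ q = _) -mulrA mulrCA.
rewrite /Ct -!mulrA ler_wpM2l ?powR_ge0//; apply: (le_trans main).
rewrite -!mulrA ler_wpM2l ?(ltW C10)// !mulrA ler_wpM2r ?powR_ge0//.
apply: (@le_trans _ _ (C2 `^ (2 + n%:R * r) * delta `^ (- (eps / 2 * (2 + n%:R * r))) *
  (C3 `^ r * delta `^ (- ((s + eps / 2) * r))) * delta `^ (- (h + eps / 2) * q))).
  by rewrite ler_wpM2r ?powR_ge0// ler_pM ?powR_ge0.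
rewrite [leLHS](_ : _ = C2 `^ (2 + n%:R * r) * C3 `^ r * (delta `^ (- (eps / 2 * (2 + n%:R * r))) *
  delta `^ (- ((s + eps / 2) * r)) * delta `^ (- (h + eps / 2) * q))); last by ring.
rewrite ler_wpM2l ?mulr_ge0 ?powR_ge0//.
rewrite -!powRD ?(gt_eqF d0) ?implybT//.
rewrite [X in delta `^ X <= _](_ : _ = - (eps / 2 * (2 + n%:R * r) + (s + eps / 2)
  * r + (h + eps / 2) * q)); last by ring.
rewrite [X in _ <= delta `^ X](_ : _ = - (h * q + s * (q - 1) + eps * P)); last by ring.
apply: powRN_le => //; rewrite /P -/n.
rewrite -subr_ge0 (_ : _ - _ = eps / 2 * (1 + n%:R * r)); last by rewrite /r; field.
by rewrite mulr_ge0 ?(ltW e20)// addr_ge0// ltW.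
Qed.

End level_sets.

Theorem theorem2p6 (R : realType) (n : nat) (n_ge3 : (3 <= n)%N)
    (h q : R) (h_gt0 : 0 < h) (q_gt1 : 1 < q)
    (kakeya_bound : forall eps : R, 0 < eps -> exists C : R,
       forall (f : 'rV[R]_n.-1 -> R) (delta : R), L1loc f -> 0 < delta < 1 ->
         (Lnorm (@surface R n.-1) q%:E (kakeya_max delta f)
            <= (C * delta `^ (- h - eps))%:E *
               Lnorm (@lebesgue R n.-1) q%:E (EFin \o f))%E)
    (s : R) (s_bound : 0 <= s <= n%:R)
    (A : set 'rV[R]_n) (A_neq0 : A !=set0) (A_bounded : bounded_set A)
    (A_dim : (upper_box_dim A <= s%:E)%E) :
  let p : R := (q + n%:R * (q - 1) + 1) / q in
  let beta : R := (h * q + s * q - s) / (q + n%:R * (q - 1) + 1) in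
  forall eps : R, 0 < eps -> exists C : R,
    forall (E : set (lebesgueType R n)) (delta : R),
      measurable E -> 0 < delta < 1 ->
      (weakLnorm (@surface R n) p (restricted_kakeya_max delta A \1_E)
         <= (C * delta `^ (- beta - eps))%:E *
            Lnorm (@lebesgue R n) p%:E (EFin \o \1_E))%E.
Proof.
case: n n_ge3 => [//|[//|k]] _ in kakeya_bound s_bound A A_neq0 A_bounded A_dim *.
move=> p beta eps eps0; have s0 : 0 <= s by case/andP: s_bound.
set P := q + k.+2%:R * (q - 1) + 1 in p beta *.
have q0 : 0 < q by rewrite (lt_trans _ q_gt1).
have P0 : 0 < P.
  by rewrite addr_gt0// addr_gt0// mulr_gt0// subr_gt0.
have p0 : 0 < p by rewrite divr_gt0.
have [C C0 level] := level_set_estimate q_gt1 kakeya_bound s0 A_neq0 A_dim eps0.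
exists (C `^ P^-1) => E delta mE d01; have /andP[d0 d1] := d01.
rewrite Lnorm_indic ?gt_eqF//.
(* If [E] has infinite measure, the right side is [+oo] because its constant is positive. *)
have [Eoo|Efin] := eqVneq (lebesgue_outer E) +oo%E.
  rewrite lebesgueE Eoo poweRyr ?invr_eq0 ?gt_eqF//.
  by rewrite gt0_muley ?leey// lte_fin mulr_gt0 ?powR_gt0.
have [v Ev] : exists v, lebesgue_outer E = v%:E.
  exists (fine (lebesgue_outer E)); rewrite fineK// ge0_fin_numE ?ltey//.
  exact: (outer_measure_ge0 (@lebesgue_outer R k.+2)).
have v0 : 0 <= v by rewrite -lee_fin -Ev; exact: (outer_measure_ge0 (@lebesgue_outer R k.+2)).
rewrite lebesgueE Ev.
apply: ge_ereal_sup => _ [lam lam0 <-] /=.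
have [Sg [Sg0 SgOm] Sgle] := level delta lam v E d01 lam0 mE Ev.
apply: (@le_trans _ _ (lam%:E * (Sg%:E `^ p^-1))%E).
  rewrite lee_wpmul2l ?lee_fin ?(ltW lam0)//; apply: gt0_ler_poweR => //.
  - by rewrite invr_ge0 ltW.
  - rewrite in_itv/= leey andbT; exact: (outer_measure_ge0 (@surface_outer R k.+2)).
  - by rewrite in_itv/= lee_fin Sg0 leey.
rewrite !poweR_EFin -!EFinM lee_fin.
have PE : q + 1 + k.+2%:R * (q - 1) = P by rewrite /P; ring.
(* As [p = P / q], both sides become [P]-th roots of those of [level_set_estimate]. *)
have pq (x : R) : x `^ p^-1 = (x `^ q) `^ P^-1 by rewrite -powRrM /p invf_div.
rewrite !pq.
have iP0 : 0 <= P^-1 by rewrite invr_ge0 ltW.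
have -> : lam = (lam `^ P) `^ P^-1 by rewrite -powRrM divff ?gt_eqF// powRr1// ltW.
have -> : delta `^ (- beta - eps) = (delta `^ (- (h * q + s * (q - 1)) - eps * P)) `^ P^-1.
  by rewrite -powRrM; congr (_ `^ _); rewrite /beta; field; rewrite gt_eqF.
have := Sgle; rewrite PE.
move: (lam `^ P) (Sg `^ q) (delta `^ _) (v `^ q) (powR_ge0 lam P) (powR_ge0 Sg q)
  (powR_ge0 delta (- (h * q + s * (q - 1)) - eps * P)) (powR_ge0 v q).
move=> x y z w x0 y0 z0 w0; rewrite mulrC => xy.
rewrite -(powRM _ x0 y0) -(powRM _ (ltW C0) z0) -(powRM _ (mulr_ge0 (ltW C0) z0) w0).
by rewrite ler_powR_base// mulr_ge0.
Qed.
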